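(* Fix an integer $\Delta>0$ and a complex number $\lambda$ with $|\lambda|\neq 1$. There is a deterministic algorithm which, given a graph $G=(V,E)$ with $n$ vertices and maximum degree at most $\Delta$, real edge activities $(\beta_e)_{e\in E}$ with $-1\le\beta_e\le 1$ for every $e$, and $\varepsilon\in(0,1)$, outputs a complex number $\hat Z$ with $|\hat Z-Z_G^{\vec\beta}(\lambda)|\le\varepsilon\,|Z_G^{\vec\beta}(\lambda)|$, and runs in time polynomial in $n$ and $1/\varepsilon$ (the degree of the polynomial may depend on $\Delta$ and $\lambda$; arithmetic operations on the input numbers count as unit cost).
   Context: For a graph $G=(V,E)$ with edge activities $(\beta_e)_{e\in E}$ and vertex activity $\lambda\in\mathbb C$, the Ising partition function is $Z_G^{\vec\beta}(\lambda)=\sum_{S\subseteq V}\Big(\prod_{e\in E(S,\overline S)}\beta_e\Big)\lambda^{|S|}$, where $E(S,\overline S)$ is the set of edges with exactly one endpoint in $S$. (When all $\beta_e$ equal $\beta$ this is $\sum_{S}\beta^{|E(S,\overline S)|}\lambda^{|S|}$.) *)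

(* Defs.v *)
From Stdlib Require Import Reals List Lia.
From Coquelicot Require Import Coquelicot.
Import ListNotations.
Open Scope R_scope.

Definition wedge := (nat * nat * R)%type.

Definition e_u (e : wedge) : nat := fst (fst e).
Definition e_v (e : wedge) : nat := snd (fst e).
Definition e_beta (e : wedge) : R := snd e.

Definition simple_graph (n : nat) (E : list wedge) : Prop :=
  (forall e, In e E -> (e_u e < e_v e)%nat /\ (e_v e < n)%nat) /\
  NoDup (map fst E).

Definition degree (E : list wedge) (x : nat) : nat :=
  length (filter (fun e => orb (Nat.eqb (e_u e) x) (Nat.eqb (e_v e) x)) E).

Definition max_degree_le (n : nat) (E : list wedge) (D : nat) : Prop :=
  forall x, (x < n)%nat -> (degree E x <= D)%nat.

Fixpoint subsets (n : nat) : list (list bool) :=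
  match n with
  | O => [ [] ]
  | S k => map (cons false) (subsets k) ++ map (cons true) (subsets k)
  end.

Definition inS (s : list bool) (x : nat) : bool := nth x s false.

Definition Csum (l : list C) : C := fold_right Cplus (RtoC 0) l.
Definition Cprod (l : list C) : C := fold_right Cmult (RtoC 1) l.

Definition ising_Z (n : nat) (E : list wedge) (lam : C) : C :=
  Csum (map (fun s =>
     Cmult (Cprod (map (fun e => if xorb (inS s (e_u e)) (inS s (e_v e))
                                 then RtoC (e_beta e) else RtoC 1) E))
           (Cpow lam (count_occ Bool.bool_dec s true))) (subsets n)).

(* Model of computation: a deterministic register machine whose       *)
(* registers hold complex numbers (unit-cost arithmetic, real-RAM /   *)
(* BSS style).  Memory is indexed by naturals; indirect addressing is *)
(* allowed only through registers holding a non-negative integer.     *)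
(* Integer constants, + - * /, complex conjugation, and comparisons   *)
(* (equality, and order of real parts) cost one step each.  No floor. *)
Inductive instr : Type :=
| ICst  (a : nat) (z : Z)
| IAdd  (a b c : nat)
| ISub  (a b c : nat)
| IMul  (a b c : nat)
| IDiv  (a b c : nat)
| IConj (a b : nat)
| ILoad (a b : nat)
| IStore (a b : nat)
| IJeq  (a b t : nat)
| IJlt  (a b t : nat)
| IJmp  (t : nat)
| IHalt.

Definition program := list instr.
Definition memory := nat -> C.

Definition upd (m : memory) (a : nat) (z : C) : memory :=
  fun i => if Nat.eqb i a then z else m i.

Definition is_index (z : C) (k : nat) : Prop := z = RtoC (INR k).

Inductive step (P : program) : nat * memory -> nat * memory -> Prop :=
| st_cst pc m a z : nth_error P pc = Some (ICst a z) ->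
    step P (pc, m) (S pc, upd m a (RtoC (IZR z)))
| st_add pc m a b c : nth_error P pc = Some (IAdd a b c) ->
    step P (pc, m) (S pc, upd m a (Cplus (m b) (m c)))
| st_sub pc m a b c : nth_error P pc = Some (ISub a b c) ->
    step P (pc, m) (S pc, upd m a (Cminus (m b) (m c)))
| st_mul pc m a b c : nth_error P pc = Some (IMul a b c) ->
    step P (pc, m) (S pc, upd m a (Cmult (m b) (m c)))
| st_div pc m a b c : nth_error P pc = Some (IDiv a b c) -> m c <> RtoC 0 ->
    step P (pc, m) (S pc, upd m a (Cmult (m b) (Cinv (m c))))
| st_conj pc m a b : nth_error P pc = Some (IConj a b) ->
    step P (pc, m) (S pc, upd m a (Cconj (m b)))
| st_load pc m a b k : nth_error P pc = Some (ILoad a b) -> is_index (m b) k ->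
    step P (pc, m) (S pc, upd m a (m k))
| st_store pc m a b k : nth_error P pc = Some (IStore a b) -> is_index (m a) k ->
    step P (pc, m) (S pc, upd m k (m b))
| st_jeq_t pc m a b t : nth_error P pc = Some (IJeq a b t) -> m a = m b ->
    step P (pc, m) (t, m)
| st_jeq_f pc m a b t : nth_error P pc = Some (IJeq a b t) -> m a <> m b ->
    step P (pc, m) (S pc, m)
| st_jlt_t pc m a b t : nth_error P pc = Some (IJlt a b t) -> Re (m a) < Re (m b) ->
    step P (pc, m) (t, m)
| st_jlt_f pc m a b t : nth_error P pc = Some (IJlt a b t) -> ~ Re (m a) < Re (m b) ->
    step P (pc, m) (S pc, m)
| st_jmp pc m t : nth_error P pc = Some (IJmp t) ->
    step P (pc, m) (t, m).

Inductive exec (P : program) : nat * memory -> nat -> nat * memory -> Prop :=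
| ex_refl c : exec P c 0 c
| ex_step c c' t c'' : step P c c' -> exec P c' t c'' -> exec P c (S t) c''.

Definition halted (P : program) (c : nat * memory) : Prop :=
  nth_error P (fst c) = Some IHalt.

Definition input_memory (n : nat) (E : list wedge) (lam : C) (eps : R) : memory :=
  fun i =>
    match i with
    | 0%nat => RtoC (INR n)
    | 1%nat => RtoC (INR (length E))
    | 2%nat => lam
    | 3%nat => RtoC eps
    | S (S (S (S j))) =>
        match nth_error E (Nat.div j 3) with
        | Some e =>
            match Nat.modulo j 3 with
            | 0%nat => RtoC (INR (e_u e))
            | 1%nat => RtoC (INR (e_v e))
            | _ => RtoC (e_beta e)
            end
        | None => RtoC 0
        end
    end.

Definition runs_to (P : program) (n : nat) (E : list wedge) (lam : C) (eps : R)
  (t : nat) (z : C) : Prop :=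
  exists c, exec P (0%nat, input_memory n E lam eps) t c /\ halted P c /\ snd c 0%nat = z.

(* Main.v *)
(**
  Replacing [lam] by [1 / lam] if necessary, assume [|lam| <= r < 1].  Declaring the vertices
  out of the set one after the other writes [Z] as the product over [v] of [1 + R_v], where
  [R_v] is the ratio of the weights of "[v] in" and "[v] out" once the vertices before [v] are out.

  Give every vertex the activity [lam * t].  As a power series in [t], [R_v] has coefficients
  [|a_k| <= r ^ k].  This is a Lee-Yang theorem for commuting contractions: if the activities
  act as contractions on a quadratic form [Q], then [Q (Z_in y) <= Q (Z_out y)] for all [y].
  It is proved by induction on the number of edges, and applied to power series modulo [t ^ K]
  with [y = 1 / Z_out].  Hence the sum of the first O(log(n / eps)) coefficients
  approximates [R_v] with error [eps / poly(n)], while [|1 + R_v| >= 1 - r].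

  The coefficients come from Weitz's recursion: [R_v = lam t * prod_i (b_i + R_i) / (1 + b_i R_i)],
  where [R_i] is the ratio at the i-th neighbour when the copies of [v] at the
  earlier neighbours are out and those at the later ones are in.  Pinning a copy only rescales the
  activity of a neighbour by [b_i] or [1 / b_i].  Each level gains a factor [t], so depth [m]
  gives the first [m] coefficients exactly and costs [Delta ^ m] calls.  Edges with activity 0 are
  first given a tiny nonzero activity; arithmetic is exact, so that it may be exponentially small.

  The register program is the translation of a structured program with arrays, in which array [a]
  occupies the addresses congruent to [a] modulo 64.
*)
Require Import Defs.
From Stdlib Require Import Reals List Lia Lra Psatz Permutation FunctionalExtensionality.
From Coquelicot Require Import Coquelicot.
Import ListNotations.
Open Scope R_scope.

(** The two halves of the argument meet only in formal series. The bound [r ^ k] concerns the true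
    ratio at activities [lam] and 0. Inside the recursion activities are divided by squares of edge
    activities and may become enormous, so no estimate would survive there; what is proved about the
    recursion is an identity modulo a power of [t], for arbitrary complex activities. In the same
    way no partition function is ever inverted by the program: the ratios have no constant term, so
    [1 + R] is invertible as a series, and the divisors are edge activities, nonzero input
    parameters and positive integers. A statement about moduli alone would not bound coefficients. A
    quadratic form with a multiplier [y] treats the complex modulus and a weighted sum of squared
    coefficients in one proof; this is why partition functions are taken over an abstract
    commutative ring. The bound [r] is taken of the form [1 - 1 / q] with [q] an integer, since
    programs contain integer constants only. *)

Definition incident (v : nat) (e : wedge) : bool :=
  orb (Nat.eqb (e_u e) v) (Nat.eqb (e_v e) v).
Definition other (v : nat) (e : wedge) : nat :=
  if Nat.eqb (e_u e) v then e_v e else e_u e.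
Definition loopless (n : nat) (E : list wedge) : Prop :=
  forall e, In e E -> e_u e <> e_v e /\ (e_u e < n)%nat /\ (e_v e < n)%nat.

Definition setf {T : Type} (f : nat -> T) (v : nat) (z : T) : nat -> T :=
  fun x => if Nat.eqb x v then z else f x.

Lemma subsets_length n s : In s (subsets n) -> length s = n.
Proof.
  revert s; induction n as [|n IH]; intros s; simpl.
  - intros [<-|[]]; reflexivity.
  - rewrite in_app_iff, !in_map_iff.
    intros [[x [<- H]]|[x [<- H]]]; simpl; f_equal; auto.
Qed.

Lemma incident_filter_perm v (E : list wedge) :
  Permutation E (filter (incident v) E ++ filter (fun e => negb (incident v e)) E).
Proof.
  induction E as [|e E IH]; simpl; [constructor|].
  destruct (incident v e); simpl.
  - constructor; exact IH.
  - etransitivity; [constructor; exact IH|]. apply Permutation_middle.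
Qed.

Lemma other_lt n E v e : loopless n E -> In e E -> (other v e < n)%nat.
Proof.
  intros HE Hi; destruct (HE e Hi) as (_ & ? & ?); unfold other.
  destruct (Nat.eqb (e_u e) v); assumption.
Qed.

Lemma other_neq n E v e : loopless n E -> In e E -> incident v e = true -> other v e <> v.
Proof.
  intros HE Hi; destruct (HE e Hi) as (? & _ & _); unfold other, incident.
  destruct (Nat.eqb_spec (e_u e) v), (Nat.eqb_spec (e_v e) v); simpl; congruence.
Qed.

Lemma incident_ends (v : nat) (e : wedge) (s : list bool) : incident v e = true ->
  xorb (inS s (e_u e)) (inS s (e_v e)) = xorb (inS s v) (inS s (other v e)).
Proof.
  unfold incident, other. destruct (Nat.eqb_spec (e_u e) v) as [->|]; simpl; [reflexivity|].
  intros H%Nat.eqb_eq. rewrite H. apply Bool.xorb_comm.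
Qed.

(** * Partition functions over a commutative ring, with a weight for each state of each vertex *)

Section Partition.
Variables (A : Type) (zero one : A) (add mul sub : A -> A -> A) (opp : A -> A).
Hypothesis Ath : ring_theory zero one add mul sub opp (@eq A).
Variable iota : R -> A.
Add Ring Aring : Ath.

Declare Scope A_scope.
Delimit Scope A_scope with A.
Bind Scope A_scope with A.
Local Notation "0" := zero : A_scope.
Local Notation "1" := one : A_scope.
Local Infix "+" := add : A_scope.
Local Infix "*" := mul : A_scope.
Local Notation "- x" := (opp x) : A_scope.
Local Open Scope A_scope.

Definition asum (l : list A) : A := fold_right add 0 l.

Definition eterm (s : list bool) (e : wedge) : A :=
  if xorb (inS s (e_u e)) (inS s (e_v e)) then iota (e_beta e) else 1.

Definition eprod (E : list wedge) (s : list bool) : A :=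
  fold_right (fun e p => eterm s e * p) 1 E.

Fixpoint vprod (w : nat -> bool -> A) (k : nat) (s : list bool) : A :=
  match s with
  | [] => 1
  | h :: t => w k h * vprod w (S k) t
  end.

(* [w v i] is the weight of vertex [v] in state [i]. *)
Definition Zg (n : nat) (E : list wedge) (w : nat -> bool -> A) : A :=
  asum (map (fun s => eprod E s * vprod w 0 s) (subsets n)).

(** The forced state gets weight 1 instead of its weight in [w], so a pinned sum no longer depends
    on the activity of [v]; [Zg_split] puts the weights back. *)
Definition pin (w : nat -> bool -> A) (v : nat) (i : bool) : nat -> bool -> A :=
  fun x h => if Nat.eqb x v then (if Bool.eqb h i then 1 else 0) else w x h.

Definition scale (w : nat -> bool -> A) (v : nat) (i : bool) (c : A) : nat -> bool -> A :=
  fun x h => if (Nat.eqb x v && Bool.eqb h i)%bool then c * w x h else w x h.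

Lemma asum_ext {T : Type} (l : list T) (f g : T -> A) :
  (forall s, In s l -> f s = g s) -> asum (map f l) = asum (map g l).
Proof.
  induction l as [|x l IH]; simpl; intros H; [reflexivity|].
  rewrite H, IH; auto.
Qed.

Lemma asum_lin {T : Type} (l : list T) (f g : T -> A) (c d : A) :
  asum (map (fun s => c * f s + d * g s) l) = c * asum (map f l) + d * asum (map g l).
Proof. induction l as [|x l IH]; simpl; [ring|]. rewrite IH. ring. Qed.

Lemma asum_scal {T : Type} (l : list T) (f : T -> A) (c : A) :
  asum (map (fun s => c * f s) l) = c * asum (map f l).
Proof. induction l as [|x l IH]; simpl; [ring|]. rewrite IH. ring. Qed.

Lemma vprod_ext w w' k s :
  (forall x h, (k <= x)%nat -> w x h = w' x h) -> vprod w k s = vprod w' k s.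
Proof.
  revert k; induction s as [|h s IH]; intros k H; simpl; [reflexivity|].
  rewrite H, IH; auto. intros; apply H; lia.
Qed.

Definition free (w : nat -> bool -> A) (v : nat) : nat -> bool -> A :=
  fun x h => if Nat.eqb x v then 1 else w x h.

Lemma vprod_at w k s v : (k <= v < k + length s)%nat ->
  vprod w k s = w v (nth (v - k) s false) * vprod (free w v) k s.
Proof.
  revert k; induction s as [|h s IH]; intros k H; simpl in *; [lia|].
  destruct (Nat.eq_dec v k) as [->|Hn].
  - rewrite Nat.sub_diag. unfold free at 1. rewrite Nat.eqb_refl.
    rewrite (vprod_ext w (free w k) (S k)); [ring|].
    intros x h' Hx; unfold free. destruct (Nat.eqb_spec x k); [lia|reflexivity].
  - replace (v - k)%nat with (S (v - S k)) by lia.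
    rewrite (IH (S k)) by lia. unfold free at 2.
    destruct (Nat.eqb_spec k v); [lia|]. ring.
Qed.

Lemma vprod_inS n s w v : In s (subsets n) -> (v < n)%nat ->
  vprod w 0 s = w v (inS s v) * vprod (free w v) 0 s.
Proof.
  intros Hs Hv. apply subsets_length in Hs.
  rewrite (vprod_at w 0 s v) by lia. rewrite Nat.sub_0_r. reflexivity.
Qed.

Lemma free_pin w v i : free (pin w v i) v = free w v.
Proof.
  extensionality x; extensionality h; unfold free, pin.
  destruct (Nat.eqb x v); reflexivity.
Qed.

Lemma pin_comm w u v i j : u <> v -> pin (pin w u i) v j = pin (pin w v j) u i.
Proof.
  intros H; extensionality x; extensionality h; unfold pin.
  destruct (Nat.eqb_spec x u), (Nat.eqb_spec x v); congruence.
Qed.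

Lemma pin_other w u v i h : u <> v -> pin w u i v h = w v h.
Proof. intros H; unfold pin. destruct (Nat.eqb_spec v u); congruence. Qed.

Lemma pin_self w v i h : pin w v i v h = if Bool.eqb h i then 1 else 0.
Proof. unfold pin. rewrite Nat.eqb_refl. reflexivity. Qed.

Lemma Zg_perm n E E' w : Permutation E E' -> Zg n E w = Zg n E' w.
Proof.
  intros HP; apply asum_ext; intros s _. f_equal.
  induction HP; simpl; auto; congruence || ring.
Qed.

Lemma Zg_split n E w v : (v < n)%nat ->
  Zg n E w = w v false * Zg n E (pin w v false) + w v true * Zg n E (pin w v true).
Proof.
  intros Hv. unfold Zg. rewrite <- asum_lin. apply asum_ext; intros s Hs.
  rewrite (vprod_inS n s w v), (vprod_inS n s (pin w v false) v),
    (vprod_inS n s (pin w v true) v), !free_pin by assumption.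
  unfold pin; rewrite Nat.eqb_refl. destruct (inS s v); simpl; ring.
Qed.

(** With [v] in state [i] the edge counts exactly when its other end is in state [negb i], so its
    activity can be absorbed into that weight and the edge deleted. *)
Lemma Zg_pin_edge n e E w v i : (v < n)%nat -> (other v e < n)%nat ->
  incident v e = true -> other v e <> v ->
  Zg n (e :: E) (pin w v i) = Zg n E (pin (scale w (other v e) (negb i) (iota (e_beta e))) v i).
Proof.
  intros Hv Hu Hi Hn. apply asum_ext; intros s Hs. simpl. unfold eterm.
  rewrite (incident_ends v e s Hi). set (u := other v e) in *.
  rewrite (vprod_inS n s (pin w v i) v), (vprod_inS n s (pin _ v i) v), !free_pin, !pin_self
    by assumption.
  rewrite (vprod_inS n s (free w v) u), (vprod_inS n s (free (scale _ _ _ _) v) u) by assumption.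
  replace (free (free (scale w u (negb i) (iota (e_beta e))) v) u) with (free (free w v) u).
  2:{ extensionality x; extensionality h; unfold free, scale.
      destruct (Nat.eqb x u), (Nat.eqb x v); reflexivity. }
  generalize (vprod (free (free w v) u) 0 s). intros V. unfold free, scale.
  destruct (Nat.eqb_spec u v); [contradiction|]. rewrite Nat.eqb_refl.
  destruct (inS s v), i, (inS s u); simpl; ring.
Qed.

Fixpoint flip (v : nat) (s : list bool) : list bool :=
  match s, v with
  | [], _ => []
  | h :: t, O => negb h :: t
  | h :: t, S v => h :: flip v t
  end.

Lemma asum_app l l' : asum (l ++ l') = asum l + asum l'.
Proof. induction l as [|x l IH]; simpl; [ring|]. rewrite IH. ring. Qed.

Lemma asum_subsets_flip n v (f : list bool -> A) : (v < n)%nat ->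
  asum (map f (subsets n)) = asum (map (fun s => f (flip v s)) (subsets n)).
Proof.
  revert v f; induction n as [|n IH]; intros v f Hv; [lia|].
  simpl. rewrite !map_app, !asum_app, !map_map. destruct v as [|v]; simpl; [ring|].
  rewrite (IH v (fun s => f (false :: s))), (IH v (fun s => f (true :: s))) by lia.
  reflexivity.
Qed.

Lemma asum_subsets_compl n (f : list bool -> A) :
  asum (map f (subsets n)) = asum (map (fun s => f (map negb s)) (subsets n)).
Proof.
  revert f; induction n as [|n IH]; intros f; simpl; [reflexivity|].
  rewrite !map_app, !asum_app, !map_map; simpl.
  rewrite (IH (fun s => f (false :: s))), (IH (fun s => f (true :: s))). ring.
Qed.

Lemma inS_flip v s x : (v < length s)%nat ->
  inS (flip v s) x = if Nat.eqb x v then negb (inS s x) else inS s x.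
Proof.
  unfold inS. revert v x; induction s as [|h s IH]; intros v x Hv; simpl in *; [lia|].
  destruct v as [|v], x as [|x]; simpl; try reflexivity. apply IH; lia.
Qed.

Lemma vprod_flip w k v s : (forall h, w (k + v)%nat h = 1) -> vprod w k (flip v s) = vprod w k s.
Proof.
  revert k v; induction s as [|h s IH]; intros k [|v] H; simpl; try reflexivity.
  - rewrite Nat.add_0_r in H. rewrite !H. reflexivity.
  - rewrite (IH (S k) v); [reflexivity|]. intros h'. rewrite <- (H h'). f_equal; lia.
Qed.

(** Flipping the state of [v] permutes the subsets and changes no edge factor. *)
Lemma Zg_isolated n E w v : (v < n)%nat -> (forall e, In e E -> incident v e = false) ->
  Zg n E (pin w v true) = Zg n E (pin w v false).
Proof.
  intros Hv HE. unfold Zg.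
  rewrite (asum_subsets_flip n v) by assumption.
  apply asum_ext; intros s Hs. pose proof (subsets_length n s Hs) as Hl.
  assert (Hf : forall x, inS (flip v s) x = if Nat.eqb x v then negb (inS s x) else inS s x)
    by (intros; apply inS_flip; lia).
  f_equal.
  - clear Hs. induction E as [|e E IH]; simpl; [reflexivity|].
    rewrite IH by (intros; apply HE; now right). f_equal. unfold eterm.
    specialize (HE e (or_introl eq_refl)). unfold incident in HE.
    apply Bool.orb_false_iff in HE. destruct HE as [H1 H2].
    rewrite !Hf, H1, H2. reflexivity.
  - rewrite (vprod_inS n s _ v) by assumption.
    rewrite (vprod_at _ 0 (flip v s) v).
    2:{ assert (forall v s, length (flip v s) = length s) as ->; [|lia].
        clear. intros v s; revert v; induction s; intros [|v]; simpl; auto. }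
    rewrite Nat.sub_0_r. change (nth v (flip v s) false) with (inS (flip v s) v).
    rewrite Hf, Nat.eqb_refl, !free_pin, !pin_self, vprod_flip.
    + destruct (inS s v); simpl; ring.
    + intros h. unfold free. rewrite Nat.add_0_l, Nat.eqb_refl. reflexivity.
Qed.

Lemma vprod_negb w k s : vprod w k (map negb s) = vprod (fun v h => w v (negb h)) k s.
Proof. revert k; induction s as [|h s IH]; intros k; simpl; [|rewrite IH]; reflexivity. Qed.

(** A set and its complement have the same cut. This is the source of the symmetry between [lam] and
    [1 / lam]. *)
Lemma Zg_compl n E w : loopless n E -> Zg n E w = Zg n E (fun v h => w v (negb h)).
Proof.
  intros HE. unfold Zg. rewrite asum_subsets_compl. apply asum_ext; intros s Hs. f_equal.
  - apply subsets_length in Hs.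
    assert (Hn : forall x, (x < n)%nat -> inS (map negb s) x = negb (inS s x)).
    { intros x Hx. unfold inS.
      rewrite (nth_indep _ false (negb false)) by (rewrite length_map; lia). apply map_nth. }
    induction E as [|e E IH]; simpl; [reflexivity|].
    rewrite IH by (intros e' He'; apply HE; now right). f_equal.
    destruct (HE e (or_introl eq_refl)) as (_ & H1 & H2).
    unfold eterm. rewrite !Hn by assumption.
    destruct (inS s (e_u e)), (inS s (e_v e)); reflexivity.
  - apply vprod_negb.
Qed.

Definition act (b : nat -> A) : nat -> bool -> A := fun v h => if h then b v else 1.

(** * The Lee-Yang inequality for contractions *)

Section LeeYang.
Variables (Q : A -> R) (contr : A -> Prop).
(** These two identities are all that is used of a real quadratic form: its restriction to a line,
    written with the polar form eliminated, and the parallelogram law. *)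
Hypothesis Q_line : forall beta a b,
  Q (iota beta * a + b) = (beta * beta * Q a + Q b + beta * (Q (a + b) - Q a - Q b))%R.
Hypothesis Q_sub : forall a b, (Q (a + b) + Q (a + - b) = 2 * Q a + 2 * Q b)%R.
Hypothesis contr_Q : forall x a, contr x -> Q (x * a) <= Q a.
Hypothesis contr_opp : forall x, contr x -> contr (- x).

Lemma pin_act_setf b v x i : pin (act (setf b v x)) v i = pin (act b) v i.
Proof. extensionality u; extensionality h. unfold act, setf, pin. destruct (Nat.eqb u v); reflexivity. Qed.

Lemma pin_congr w w' v i : (forall x h, x <> v -> w x h = w' x h) -> pin w v i = pin w' v i.
Proof.
  intros H; extensionality x; extensionality h; unfold pin.
  destruct (Nat.eqb_spec x v); auto.
Qed.

(** One edge from [v] to a neighbour [u] is deleted. The four sums [P i j] of the smaller graph,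
    with [v] in state [i] and [u] in state [j], satisfy inequalities from the induction hypothesis
    at [v] and at [u], with the free activity of the other end replaced by plus or minus the
    activity of [u]. These must imply the inequality with the edge restored. The induction runs over
    all [b] and [v] to allow these changes. *)
Lemma lee_yang n E b v y : loopless n E -> (forall e, In e E -> -1 <= e_beta e <= 1) ->
  (forall u, contr (b u)) -> (v < n)%nat ->
  Q (Zg n E (pin (act b) v true) * y) <= Q (Zg n E (pin (act b) v false) * y).
Proof.
  remember (length E) as m eqn:Hm. revert E b v y Hm.
  induction m as [|m IH]; intros E b v y Hm HE Hb Hc Hv.
  { destruct E; [|discriminate]. rewrite Zg_isolated; [lra|assumption|intros ? []]. }
  destruct (filter (incident v) E) as [|e L] eqn:HL.
  { rewrite Zg_isolated; [lra|assumption|].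
    intros e He. destruct (incident v e) eqn:Hi; [|reflexivity].
    assert (In e []) as []. rewrite <- HL. apply filter_In; auto. }
  pose proof (incident_filter_perm v E) as HP. rewrite HL in HP. simpl in HP.
  set (E' := L ++ _) in HP.
  assert (HeE : In e E) by (eapply Permutation_in; [symmetry; exact HP|now left]).
  assert (Hsub : forall e', In e' E' -> In e' E)
    by (intros e' H; eapply Permutation_in; [symmetry; exact HP|now right]).
  assert (Hi : incident v e = true).
  { assert (In e (filter (incident v) E)) as Hf by (rewrite HL; now left).
    apply filter_In in Hf; tauto. }
  pose proof (other_lt n E v e HE HeE) as Hu. pose proof (other_neq n E v e HE HeE Hi) as Hn.
  rewrite !(Zg_perm n E (e :: E') _ HP).
  rewrite !Zg_pin_edge by assumption.
  set (u := other v e) in *. set (beta := e_beta e).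
  assert (Hbeta : -1 <= beta <= 1) by (apply Hb; assumption).
  set (P := fun i j => Zg n E' (pin (pin (act b) v i) u j)).
  assert (Hm' : m = length E').
  { apply Permutation_length in HP. simpl in HP. lia. }
  assert (HE' : loopless n E') by (intros e' ?; apply HE; auto).
  assert (Hb' : forall e, In e E' -> -1 <= e_beta e <= 1) by auto.
  assert (Hgen : forall i c, Zg n E' (pin (act (setf b u c)) v i) = P i false + c * P i true).
  { intros i c. rewrite (Zg_split n E' _ u) by assumption.
    rewrite !pin_other by auto.
    rewrite !(pin_comm _ v u) by auto. rewrite !pin_act_setf. unfold P.
    rewrite !(pin_comm _ v u) by auto.
    unfold act at 1 3, setf. rewrite Nat.eqb_refl. ring. }
  assert (Hgen' : forall j c, Zg n E' (pin (act (setf b v c)) u j) = P false j + c * P true j).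
  { intros j c. rewrite (Zg_split n E' _ v) by assumption.
    rewrite !pin_other by auto.
    rewrite !(pin_comm _ u v) by auto. rewrite !pin_act_setf. unfold P.
    unfold act at 1 3, setf. rewrite Nat.eqb_refl. ring. }
  assert (HT : forall i, Zg n E' (pin (scale (act b) u (negb i) (iota beta)) v i) =
     (if i then iota beta else 1) * P i false + (if i then 1 else iota beta) * (b u * P i true)).
  { intros i.
    rewrite (Zg_split n E' _ u) by assumption. rewrite !pin_other by auto.
    unfold P, scale, act. rewrite !Nat.eqb_refl.
    rewrite !(pin_comm _ v u) by auto.
    rewrite !(pin_congr (fun x h => if (Nat.eqb x u && Bool.eqb h (negb i))%bool then _ else _) (act b) u).
    - fold (act b). destruct i; simpl; ring.
    - intros x h Hx. destruct (Nat.eqb_spec x u); [contradiction|reflexivity].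
    - intros x h Hx. destruct (Nat.eqb_spec x u); [contradiction|reflexivity]. }
  rewrite !HT. clear HT.
  assert (Hset : forall w c, contr c -> forall x, contr (setf b w c x)).
  { intros w c Hcc x. unfold setf. destruct (Nat.eqb x w); auto. }
  pose proof (fun c H => IH E' (setf b u c) v y Hm' HE' Hb' (Hset u c H) Hv) as IHv.
  (* The claim does not involve the activity of [v], so [v] may be given the activity of [u]; then
     the same [d] occurs in all four inequalities. *)
  pose proof (fun c H => IH E' (setf b v c) u y Hm' HE' Hb' (Hset v c H) Hu) as IHu.
  pose proof (IHv _ (Hc u)) as V1. pose proof (IHv _ (contr_opp _ (Hc u))) as V2.
  pose proof (IHu _ (Hc u)) as U1. pose proof (IHu _ (contr_opp _ (Hc u))) as U2.
  rewrite !Hgen in V1, V2. rewrite !Hgen' in U1, U2. clear IHv IHu.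
  set (x := b u) in *.
  set (a := P false false * y). set (bb := x * (P false true * y)).
  set (c := P true false * y). set (d := x * (P true true * y)).
  set (b0 := P false true * y). set (d0 := P true true * y).
  replace ((P true false + x * P true true) * y) with (c + d) in V1 by (unfold c, d; ring).
  replace ((P false false + x * P false true) * y) with (a + bb) in V1 by (unfold a, bb; ring).
  replace ((P true false + - x * P true true) * y) with (c + - d) in V2 by (unfold c, d; ring).
  replace ((P false false + - x * P false true) * y) with (a + - bb) in V2 by (unfold a, bb; ring).
  replace ((P false true + x * P true true) * y) with (b0 + d) in U1 by (unfold b0, d; ring).
  replace ((P false false + x * P true false) * y) with (a + x * c) in U1 by (unfold a, c; ring).
  replace ((P false true + - x * P true true) * y) with (b0 + - d) in U2 by (unfold b0, d; ring).
  replace ((P false false + - x * P true false) * y) with (a + - (x * c)) in U2 by (unfold a, c; ring).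
  replace (((if true then iota beta else 1) * P true false + (if true then 1 else iota beta) * (x * P true true)) * y)
    with (iota beta * c + d) by (unfold c, d; ring).
  replace (((if false then iota beta else 1) * P false false + (if false then 1 else iota beta) * (x * P false true)) * y)
    with (iota beta * bb + a) by (unfold a, bb; ring).
  rewrite !Q_line.
  pose proof (Q_sub c d). pose proof (Q_sub a bb). pose proof (Q_sub b0 d).
  pose proof (Q_sub a (x * c)).
  replace (bb + a) with (a + bb) by ring.
  (* The inequalities at [u] speak of [b0] and [x * c], those at [v] of [bb = x * b0] and [c];
     contraction compares them in the favourable direction in both cases. *)
  pose proof (contr_Q x b0 (Hc u)) as K1. pose proof (contr_Q x c (Hc u)) as K2.
  change (x * b0) with bb in K1.
  clearbody a bb c d b0 d0. clear - Hbeta V1 V2 U1 U2 H H0 H1 H2 K1 K2.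
  set (Qa := Q a) in *. set (Qb := Q bb) in *. set (Qc := Q c) in *. set (Qd := Q d) in *.
  set (k1 := Q (a + bb)) in *. set (k2 := Q (c + d)) in *.
  (* Only the sign flips of [x] are needed: the sum of V1 and V2, and of U1 and U2, kills the cross
     terms, and their difference bounds them. *)
  assert (p1 : (Qa - Qd >= Qb - Qc)%R) by lra.
  assert (p2 : (Qa - Qd >= Qc - Qb)%R) by lra.
  set (k := ((k1 - Qa - Qb) - (k2 - Qc - Qd))%R).
  assert (k3 : (- (Qa - Qd + (Qb - Qc)) <= k <= Qa - Qd + (Qb - Qc))%R) by (unfold k; lra).
  (* With s = Qa - Qd and t = Qb - Qc, the bound on [k] leaves s + beta^2 t - |beta| (s + t) = (1 -
     |beta|) (s - |beta| t), and |t| <= s by [p1] and [p2]. *)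
  cut (0 <= Qa - Qd + beta * beta * (Qb - Qc) + beta * k)%R; [unfold k; lra|].
  destruct (Rle_dec 0 beta).
  - assert (beta * k >= - beta * (Qa - Qd + (Qb - Qc)))%R by nra.
    assert (0 <= (1 - beta) * (Qa - Qd - beta * (Qb - Qc)))%R; [|lra].
    apply Rmult_le_pos; nra.
  - assert (beta * k >= beta * (Qa - Qd + (Qb - Qc)))%R by nra.
    assert (0 <= (1 + beta) * (Qa - Qd + beta * (Qb - Qc)))%R; [|lra].
    apply Rmult_le_pos; nra.
Qed.
End LeeYang.

(** * Weitz's recursion *)

Section Weitz.
Hypothesis iota_1 : iota 1%R = 1.
Hypothesis iota_mul : forall x y, iota (x * y)%R = iota x * iota y.

Definition mulat (c : R -> R) (v : nat) (e : wedge) (b : nat -> A) : nat -> A :=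
  setf b (other v e) (iota (c (e_beta e)) * b (other v e)).

(* Removing a copy of [v] that is out and adding one that is in divides by [beta ^ 2]. *)
Definition inv_sq (x : R) : R := (/ (x * x))%R.

Definition divall (v : nat) (L : list wedge) (b : nat -> A) : nat -> A :=
  fold_right (mulat inv_sq v) b L.

Lemma iota_inv x : x <> 0%R -> iota x * iota (/ x) = 1.
Proof. intros H. rewrite <- iota_mul, Rinv_r by assumption. apply iota_1. Qed.

Lemma setf_comm (b : nat -> A) u u' c c' :
  setf (setf b u (c * b u)) u' (c' * setf b u (c * b u) u') =
  setf (setf b u' (c' * b u')) u (c * setf b u' (c' * b u') u).
Proof.
  extensionality x. unfold setf. destruct (Nat.eq_dec u u') as [->|Hn].
  - rewrite Nat.eqb_refl. destruct (Nat.eqb x u'); [ring|reflexivity].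
  - destruct (Nat.eqb_spec u u'), (Nat.eqb_spec u' u), (Nat.eqb_spec x u'), (Nat.eqb_spec x u);
      congruence.
Qed.

Lemma divall_setf v L b u c :
  divall v L (setf b u (c * b u)) = setf (divall v L b) u (c * divall v L b u).
Proof.
  induction L as [|e L IH]; simpl; [reflexivity|].
  rewrite IH. unfold mulat. apply setf_comm.
Qed.

Lemma divall_other v L b x z : x <> v -> divall v L (setf b v z) x = divall v L b x.
Proof.
  intros Hx. revert x Hx.
  induction L as [|e L IH]; intros x Hx; simpl.
  - unfold setf. destruct (Nat.eqb_spec x v); congruence.
  - revert IH. generalize (divall v L (setf b v z)). intros D IH. unfold mulat, setf.
    destruct (Nat.eqb_spec x (other v e)) as [->|]; auto.
    rewrite IH by assumption. reflexivity.
Qed.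

Lemma divall_root v L b : (forall e, In e L -> other v e <> v) -> divall v L b v = b v.
Proof.
  induction L as [|e L IH]; intros H; simpl; [reflexivity|].
  unfold mulat, setf. destruct (Nat.eqb_spec v (other v e)) as [Heq|].
  - exfalso. apply (H e (or_introl eq_refl)). auto.
  - apply IH. intros; apply H; now right.
Qed.

Lemma scale_in b u c : scale (act b) u true c = act (setf b u (c * b u)).
Proof.
  extensionality x; extensionality h. unfold scale, act, setf.
  destruct (Nat.eqb_spec x u) as [->|], h; reflexivity.
Qed.

(** Taking the factor out of both states of [u] renormalises the weight of the out state to 1, which
    is the form [act]. *)
Lemma Zg_scale_out n E b u v i x : (u < n)%nat -> u <> v -> x <> 0%R ->
  Zg n E (pin (scale (act b) u false (iota x)) v i) =
  iota x * Zg n E (pin (act (setf b u (iota (/ x) * b u))) v i).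
Proof.
  intros Hu Hn Hx. rewrite (Zg_split n E _ u Hu), (Zg_split n E (pin (act _) v i) u Hu).
  rewrite !pin_other by auto. rewrite !(pin_comm _ v u) by auto. rewrite !pin_act_setf.
  assert (H : forall j, pin (scale (act b) u false (iota x)) u j = pin (act b) u j).
  { intros j; extensionality y; extensionality h; unfold pin, scale.
    destruct (Nat.eqb y u); reflexivity. }
  rewrite !H. generalize (Zg n E (pin (pin (act b) u true) v i)); intros Z1.
  generalize (Zg n E (pin (pin (act b) u false) v i)); intros Z0.
  unfold scale, act, setf. rewrite !Nat.eqb_refl. simpl.
  transitivity (iota x * Z0 + (iota x * iota (/ x)) * (b u * Z1)); [|ring].
  rewrite iota_inv by assumption. ring.
Qed.

Definition bprod (L : list wedge) : A := fold_right (fun e p => iota (e_beta e) * p) 1 L.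

(** Edge by edge: with [v] in, the edge puts beta on the out state of the neighbour, that is a
    global beta and 1 / beta on its activity; with [v] out it would put beta on its activity. The
    two differ by beta and a division of the activity by beta^2. *)
Lemma Zg_pin_true_split n L E0 b v : (v < n)%nat ->
  (forall e, In e L -> incident v e = true /\ other v e <> v /\ (other v e < n)%nat /\ e_beta e <> 0%R) ->
  (forall e, In e E0 -> incident v e = false) ->
  Zg n (L ++ E0) (pin (act b) v true) = bprod L * Zg n (L ++ E0) (pin (act (divall v L b)) v false).
Proof.
  intros Hv HL H0. revert b. induction L as [|e L IH]; intros b; simpl app.
  { simpl. rewrite Zg_isolated by assumption. ring. }
  destruct (HL e (or_introl eq_refl)) as (Hi & Hn & Hu & Hb).
  rewrite !Zg_pin_edge by assumption. simpl negb. rewrite Zg_scale_out by assumption.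
  rewrite IH by (intros; apply HL; now right).
  rewrite scale_in. simpl. rewrite divall_setf.
  set (u := other v e). set (B := divall v L b). set (x := e_beta e) in *.
  replace (setf (mulat inv_sq v e B) u (iota x * mulat inv_sq v e B u))
    with (setf B u (iota (/ x) * B u)); [ring|].
  extensionality y. unfold mulat, setf. fold u. rewrite Nat.eqb_refl.
  destruct (Nat.eqb y u); [|reflexivity].
  replace (/ x)%R with (x * inv_sq x)%R by (unfold inv_sq; field; assumption).
  fold x. rewrite iota_mul. ring.
Qed.

Lemma Zg_dead n E b v : (v < n)%nat ->
  Zg n E (act (setf b v 0)) = Zg n E (pin (act b) v false).
Proof.
  intros Hv. rewrite (Zg_split n E _ v Hv), !pin_act_setf.
  unfold act at 1 3, setf. rewrite Nat.eqb_refl. ring.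
Qed.

(** Together with [Zg_dead] this makes both parts of the ratio at [v] partition functions of one and
    the same graph, with [v] of activity 0 and different activities at its neighbours. The quotient
    then telescopes over the edges at [v]. *)
Lemma Zg_pin_true n E b v : (v < n)%nat -> loopless n E ->
  (forall e, In e E -> e_beta e <> 0%R) ->
  Zg n E (pin (act b) v true) =
  bprod (filter (incident v) E) * Zg n E (act (divall v (filter (incident v) E) (setf b v 0))).
Proof.
  intros Hv HE Hb. set (L := filter (incident v) E).
  assert (HL : forall e, In e L -> In e E /\ incident v e = true).
  { intros e He. apply filter_In. assumption. }
  rewrite !(Zg_perm n E _ _ (incident_filter_perm v E)). fold L.
  rewrite Zg_pin_true_split; [|assumption| |].
  - f_equal. rewrite (Zg_split n _ (act _) v Hv).
    assert (Hz : divall v L (setf b v 0) v = 0).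
    { rewrite divall_root; [unfold setf; rewrite Nat.eqb_refl; reflexivity|].
      intros e He. apply (other_neq n E); [assumption| |]; apply HL; assumption. }
    unfold act at 2 4. rewrite Hz.
    rewrite (pin_congr (act (divall v L (setf b v 0))) (act (divall v L b)) v false); [ring|].
    intros x h Hx. unfold act. rewrite divall_other by assumption. reflexivity.
  - intros e He. destruct (HL e He). repeat split; auto.
    + eapply other_neq; eassumption.
    + eapply other_lt; eassumption.
  - intros e He. apply filter_In in He. destruct He as [_ He].
    apply Bool.negb_true_iff in He. assumption.
Qed.

(** One factor of the telescoping product, cleared of denominators. The edge itself stays in the
    graph: when [v] is out it multiplies the ratio at the neighbour by beta, so [rho] is beta R_i,
    and (beta + R_i) / (1 + beta R_i) reads (beta + rho / beta) / (1 + rho). *)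
Lemma Zg_ratio_step n E b v e rho : (other v e < n)%nat -> e_beta e <> 0%R ->
  rho * Zg n E (pin (act b) (other v e) false) = b (other v e) * Zg n E (pin (act b) (other v e) true) ->
  iota (e_beta e) * Zg n E (act (mulat inv_sq v e b)) * (1 + rho) =
  (iota (e_beta e) + iota (/ e_beta e) * rho) * Zg n E (act b).
Proof.
  intros Hu Hb Hr. unfold mulat. set (u := other v e) in *. set (x := e_beta e) in *.
  rewrite (Zg_split n E (act (setf _ _ _)) u Hu), (Zg_split n E (act b) u Hu), !pin_act_setf.
  unfold act at 1 3 5 7, setf. rewrite Nat.eqb_refl.
  set (P := Zg n E (pin (act b) u false)) in *. set (S := Zg n E (pin (act b) u true)) in *.
  replace (/ x)%R with (x * inv_sq x)%R by (unfold inv_sq; field; assumption).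
  rewrite iota_mul.
  transitivity (iota x * (P + iota (inv_sq x) * (b u * S)) * (1 + rho)); [ring|].
  rewrite <- Hr. ring.
Qed.
End Weitz.

Lemma Zg_zero_act n E w : (forall x, w x false = 1 /\ w x true = 0) -> Zg n E w = 1.
Proof.
  intros Hw.
  assert (H : forall (f : list bool -> A) k,
    asum (map (fun s => f s * vprod w k s) (subsets n)) = f (repeat false n)).
  { induction n as [|m IH]; intros f k; simpl; [ring|].
    rewrite map_app, asum_app, !map_map. simpl.
    destruct (Hw k) as [H0 H1]. rewrite H0, H1.
    rewrite (asum_ext _ (fun x => f (false :: x) * (1 * vprod w (S k) x))
       (fun x => f (false :: x) * vprod w (S k) x)) by (intros; ring).
    rewrite (asum_ext _ (fun x => f (true :: x) * (0 * vprod w (S k) x))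
       (fun x => 0 * vprod w (S k) x)) by (intros; ring).
    rewrite asum_scal, (IH (fun s => f (false :: s))). ring. }
  unfold Zg. rewrite H.
  induction E as [|e E IH]; simpl; [reflexivity|]. rewrite IH. unfold eterm, inS.
  rewrite !nth_repeat. simpl. ring.
Qed.

End Partition.

(** * Transfer of partition functions along a relation between two coefficient domains *)

Section Relate.
Variables (A B : Type) (zA oA : A) (zB oB : B).
Variables (addA mulA : A -> A -> A) (addB mulB : B -> B -> B) (iA : R -> A) (iB : R -> B).
Variable rel : A -> B -> Prop.
Hypothesis rel_0 : rel zA zB.
Hypothesis rel_1 : rel oA oB.
Hypothesis rel_add : forall a a' b b', rel a b -> rel a' b' -> rel (addA a a') (addB b b').
Hypothesis rel_mul : forall a a' b b', rel a b -> rel a' b' -> rel (mulA a a') (mulB b b').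
Hypothesis rel_iota : forall x, rel (iA x) (iB x).

(** Applied to two relations between series and complex numbers: having a given constant term, and
    evaluation at [t = 1]. *)
Lemma Zg_rel n E w w' : (forall v i, rel (w v i) (w' v i)) ->
  rel (Zg A zA oA addA mulA iA n E w) (Zg B zB oB addB mulB iB n E w').
Proof.
  intros Hw. unfold Zg.
  assert (Hv : forall s k, rel (vprod A oA mulA w k s) (vprod B oB mulB w' k s)).
  { induction s as [|h s IH]; intros k; simpl; auto. }
  assert (He : forall s, rel (eprod A oA mulA iA E s) (eprod B oB mulB iB E s)).
  { intros s. induction E as [|e E' IH]; simpl; auto.
    apply rel_mul; auto. unfold eterm. destruct (xorb _ _); auto. }
  induction (subsets n) as [|s l IH]; simpl; auto.
Qed.
End Relate.

(** * Formal power series *)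

Definition C_th := F_R C_field_theory.
Notation ZC := (Zg C (RtoC 0) (RtoC 1) Cplus Cmult RtoC).
Notation actC := (act C (RtoC 1)).
Notation pinC := (pin C (RtoC 0) (RtoC 1)).

Definition fps := nat -> C.
Definition ftl (a : fps) : fps := fun n => a (S n).
Definition fadd (a b : fps) : fps := fun n => (a n + b n)%C.
Definition fopp (a : fps) : fps := fun n => (- a n)%C.
Definition fsub (a b : fps) : fps := fadd a (fopp b).
Definition cst (c : C) : fps := fun n => match n with O => c | _ => RtoC 0 end.
Definition tau : fps := fun n => match n with 1%nat => RtoC 1 | _ => RtoC 0 end.
(** The Cauchy product through (a_0 + t a') b = a_0 b + t (a' b), which is structural in the degree;
    [fmul_sum] gives the usual convolution. *)
Definition fmul : fps -> fps -> fps :=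
  fix fmul a b n :=
  match n with
  | O => (a O * b O)%C
  | S m => (a O * b (S m) + fmul (ftl a) b m)%C
  end.

Lemma fmul_addl a b c n : fmul (fadd a b) c n = (fmul a c n + fmul b c n)%C.
Proof.
  revert a b; induction n as [|n IH]; intros a b; simpl; unfold fadd at 1; [ring|].
  change (ftl (fadd a b)) with (fadd (ftl a) (ftl b)). rewrite IH. ring.
Qed.

Lemma fmul_scal z a b n : fmul (fun k => z * a k)%C b n = (z * fmul a b n)%C.
Proof.
  revert a; induction n as [|n IH]; intros a; simpl; [ring|].
  change (ftl (fun k => z * a k)%C) with (fun k => z * ftl a k)%C. rewrite IH. ring.
Qed.

(** The same recursion on the tail of the right factor; the two forms together give
    commutativity. *)
Lemma fmul_last a b n : fmul a b (S n) = (fmul a (ftl b) n + a (S n) * b O)%C.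
Proof.
  revert a; induction n as [|n IH]; intros a; [reflexivity|].
  change (fmul a b (S (S n))) with (a O * b (S (S n)) + fmul (ftl a) b (S n))%C.
  rewrite IH. change (fmul a (ftl b) (S n)) with (a O * b (S (S n)) + fmul (ftl a) (ftl b) n)%C.
  change (ftl a (S n)) with (a (S (S n))). ring.
Qed.

Lemma fmul_comm a b : fmul a b = fmul b a.
Proof.
  extensionality n. revert a b; induction n as [|n IH]; intros a b; [simpl; ring|].
  rewrite fmul_last. simpl. rewrite IH. ring.
Qed.

Lemma fmul_assoc a b c : fmul a (fmul b c) = fmul (fmul a b) c.
Proof.
  extensionality n. revert a b; induction n as [|n IH]; intros a b; [simpl; ring|].
  change (fmul (fmul a b) c (S n)) with (a O * b O * c (S n) + fmul (ftl (fmul a b)) c n)%C.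
  change (ftl (fmul a b)) with (fadd (fun k => a O * ftl b k)%C (fmul (ftl a) b)).
  rewrite fmul_addl, fmul_scal, <- IH. simpl. ring.
Qed.

Lemma fmul_cst z a n : fmul (cst z) a n = (z * a n)%C.
Proof.
  destruct n as [|n]; simpl; [reflexivity|].
  assert (H : forall b m, fmul (ftl (cst z)) b m = 0).
  { intros b m. replace (ftl (cst z)) with (fun k => RtoC 0 * ftl (cst z) k)%C.
    - rewrite fmul_scal. ring.
    - extensionality k. unfold ftl. simpl. ring. }
  rewrite H. ring.
Qed.

Lemma fps_th : ring_theory (cst 0) (cst 1) fadd fmul fsub fopp (@eq fps).
Proof.
  constructor; intros; try (extensionality n).
  - unfold fadd. destruct n; simpl; ring.
  - unfold fadd. ring.
  - unfold fadd. ring.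
  - rewrite fmul_cst. ring.
  - rewrite fmul_comm. reflexivity.
  - rewrite fmul_assoc. reflexivity.
  - rewrite fmul_addl. reflexivity.
  - reflexivity.
  - unfold fadd, fopp. destruct n; simpl; ring.
Qed.
Add Ring fps_ring : fps_th.

Lemma cst_mul x y : cst (x * y)%C = fmul (cst x) (cst y).
Proof. extensionality n. rewrite fmul_cst. destruct n; simpl; ring. Qed.

Lemma fmul_tau a n : fmul tau a n = match n with O => RtoC 0 | S k => a k end.
Proof.
  destruct n as [|n]; simpl; [ring|].
  change (ftl tau) with (cst 1).
  replace (ftl tau) with (cst 1) by (extensionality k; destruct k; reflexivity).
  rewrite fmul_cst. ring.
Qed.

Definition fiota (x : R) : fps := cst (RtoC x).
Notation ZF := (Zg fps (cst 0) (cst 1) fadd fmul fiota).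
Notation actF := (act fps (cst 1)).
Notation pinF := (pin fps (cst 0) (cst 1)).

Definition agree (k : nat) (a b : fps) : Prop := forall j, (j < k)%nat -> a j = b j.

Lemma fmul_agree k a a' b b' : agree k a a' -> agree k b b' -> agree k (fmul a b) (fmul a' b').
Proof.
  intros Ha Hb j Hj. revert k a a' Ha Hb Hj; induction j as [|j IH]; intros k a a' Ha Hb Hj; simpl.
  - rewrite Ha, Hb by assumption. reflexivity.
  - rewrite Ha, Hb by lia. f_equal. apply (IH (pred k)).
    + intros i Hi. unfold ftl. apply Ha. lia.
    + intros i Hi. apply Hb. lia.
    + lia.
Qed.

(* The gain of one order of agreement that makes the truncated recursion exact. *)
Lemma fmul_agree_S k a a' b b' : a O = RtoC 0 -> a' O = RtoC 0 ->
  agree (S k) a a' -> agree k b b' -> agree (S k) (fmul a b) (fmul a' b').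
Proof.
  intros H H' Ha Hb j Hj. destruct j as [|j]; simpl; rewrite H, H'; [ring|].
  rewrite (fmul_agree k (ftl a) (ftl a') b b'); try lia; try assumption.
  - ring.
  - intros i Hi. apply Ha. lia.
Qed.

Fixpoint geom (a : fps) (j : nat) : fps :=
  match j with O => cst 1 | S i => fadd (cst 1) (fmul a (geom a i)) end.

(* An inverse only for constant term 1: then [geom (1 - a) k] has reached its limit in degree [n]
   as soon as [n <= k]. *)
Definition finv (a : fps) : fps := fun n => geom (fsub (cst 1) a) n n.

Lemma geom_agree a j k : a O = RtoC 0 -> (j <= k)%nat -> agree (S j) (geom a j) (geom a k).
Proof.
  intros H0. revert k; induction j as [|j IH]; intros k Hjk.
  - intros i Hi. assert (i = O) as -> by lia. destruct k; simpl; [reflexivity|].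
    unfold fadd; simpl. rewrite H0. ring.
  - destruct k as [|k]; [lia|]. simpl. intros i Hi. unfold fadd. f_equal.
    revert i Hi. apply fmul_agree_S; auto.
    + intros i Hi. reflexivity.
    + apply IH. lia.
Qed.

Lemma finv_r a : a O = RtoC 1 -> fmul a (finv a) = cst 1.
Proof.
  intros H. set (x := fsub (cst 1) a).
  assert (Hx : x O = RtoC 0) by (unfold x, fsub, fadd, fopp; simpl; rewrite H; ring).
  (* [finv a] is a fixed point of f = 1 + (1 - a) f because [geom] has stabilised in every degree
     that is read; the claim rearranges this equation. *)
  assert (Hg : finv a = fadd (cst 1) (fmul x (finv a))).
  { extensionality n. unfold finv. fold x.
    rewrite (geom_agree x n (S n) Hx) by lia. simpl. unfold fadd. f_equal.
    destruct n as [|n]; simpl; rewrite Hx; [ring|].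
    f_equal. apply (fmul_agree (S n)); try lia.
    - intros i _. reflexivity.
    - intros i Hi. fold x. rewrite (geom_agree x i (S n)) by (assumption || lia). reflexivity. }
  replace (fmul a (finv a)) with (fsub (finv a) (fmul x (finv a))).
  - rewrite Hg at 1. ring.
  - unfold x. ring.
Qed.

(** Multiply the congruence of [a] and [b] by the product of the two inverses. *)
Lemma finv_agree k a b : a O = RtoC 1 -> b O = RtoC 1 -> agree k a b -> agree k (finv a) (finv b).
Proof.
  intros Ha Hb H.
  assert (Hk : agree k (fmul (fmul a (finv a)) (finv b)) (fmul (fmul b (finv b)) (finv a))).
  { replace (fmul (fmul a (finv a)) (finv b)) with (fmul a (fmul (finv a) (finv b))) by ring.
    replace (fmul (fmul b (finv b)) (finv a)) with (fmul b (fmul (finv a) (finv b))) by ring.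
    apply fmul_agree; [assumption|]. intros i _. reflexivity. }
  rewrite !finv_r in Hk by assumption.
  intros j Hj. specialize (Hk j Hj). rewrite !fmul_cst, !Cmult_1_l in Hk. symmetry. assumption.
Qed.

(** * The recursion on formal ratios and its exactness to a given order *)

Definition mobius (beta : R) (rho P : fps) : fps :=
  fmul (fmul P (fadd (fiota beta) (fmul (fiota (/ beta)) rho))) (finv (fadd (cst 1) rho)).

Definition mulatC (c : R -> R) (v : nat) (e : wedge) (b : nat -> C) : nat -> C :=
  setf b (other v e) (RtoC (c (e_beta e)) * b (other v e))%C.

Definition divallC (v : nat) (L : list wedge) (b : nat -> C) : nat -> C :=
  fold_right (mulatC inv_sq v) b L.

(** [x] arrives divided at every edge of [L]. Each step undoes one division before asking for the
    ratio there, so edges still ahead stand for copies of [v] that are in, and the current and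
    earlier ones for copies that are out. The edge list of the graph never changes. *)
Fixpoint edge_fold (rec : (nat -> C) -> nat -> fps) (v : nat) (L : list wedge) (x : nat -> C) (P : fps) : fps :=
  match L with
  | [] => P
  | e :: L' =>
      let x' := mulatC (fun b => b * b)%R v e x in
      edge_fold rec v L' x' (mobius (e_beta e) (rec x' (other v e)) P)
  end.

(** Vertices already on the current path have activity 0. They are not filtered out: with [x v]
    equal to 0 the initial series is 0 and so is the result. *)
Fixpoint ratio_rec (E : list wedge) (k : nat) (x : nat -> C) (v : nat) : fps :=
  match k with
  | O => cst 0
  | S k' => let L := filter (incident v) E in
      edge_fold (ratio_rec E k') v L (divallC v L (setf x v (RtoC 0))) (fmul (cst (x v)) tau)
  end.

Definition wt (x : nat -> C) : nat -> fps := fun u => fmul (cst (x u)) tau.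

Definition ratio_fps (n : nat) (E : list wedge) (x : nat -> C) (v : nat) : fps :=
  fmul (fmul (wt x v) (ZF n E (pinF (actF (wt x)) v true))) (finv (ZF n E (pinF (actF (wt x)) v false))).

(** At [t = 0] only the empty set has nonzero weight, and its weight is 1. Hence these partition
    functions are invertible series. *)
Lemma ZF_coef0 n E w : (forall v, w v false O = RtoC 1 /\ w v true O = RtoC 0 \/
   (exists i, w v = (fun h => if Bool.eqb h i then cst 1 else cst 0) /\ i = false)) -> ZF n E w O = RtoC 1.
Proof.
  intros H.
  assert (Hr : ZF n E w O = ZC n E (fun v i => w v i O)).
  { apply (Zg_rel fps C (cst 0) (cst 1) (RtoC 0) (RtoC 1) fadd fmul Cplus Cmult fiota RtoC
      (fun a c => a O = c)); try reflexivity; intros; simpl; unfold fadd; congruence. }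
  rewrite Hr. apply (Zg_zero_act C _ _ _ _ _ _ C_th).
  intros v. destruct (H v) as [?|(i & -> & ->)]; auto.
Qed.

Lemma ZF_act_coef0 n E x : ZF n E (actF (wt x)) O = RtoC 1.
Proof. apply ZF_coef0. intros v. left. unfold act, wt. rewrite fmul_cst. simpl. split; ring. Qed.

Lemma ZF_pin_coef0 n E x v : ZF n E (pinF (actF (wt x)) v false) O = RtoC 1.
Proof.
  apply ZF_coef0. intros u. left. unfold pin. destruct (Nat.eqb u v); [split; reflexivity|].
  unfold act, wt. rewrite fmul_cst. simpl. split; ring.
Qed.

Lemma ratio_fps_spec n E x v :
  fmul (ratio_fps n E x v) (ZF n E (pinF (actF (wt x)) v false)) =
  fmul (wt x v) (ZF n E (pinF (actF (wt x)) v true)).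
Proof.
  unfold ratio_fps. set (D := ZF n E (pinF _ v false)). set (N := ZF n E (pinF _ v true)).
  replace (fmul (fmul (fmul (wt x v) N) (finv D)) D) with (fmul (fmul (wt x v) N) (fmul D (finv D))) by ring.
  rewrite finv_r by apply ZF_pin_coef0. ring.
Qed.

Lemma ratio_fps_0 n E x v : ratio_fps n E x v O = RtoC 0.
Proof. unfold ratio_fps. simpl. unfold wt. rewrite fmul_cst. simpl. ring. Qed.

Lemma fadd_1_coef0 a : a O = RtoC 0 -> fadd (cst 1) a O = RtoC 1.
Proof. intros H. unfold fadd. rewrite H. simpl. ring. Qed.

Lemma mobius_spec beta rho P : rho O = RtoC 0 ->
  fmul (mobius beta rho P) (fadd (cst 1) rho) = fmul P (fadd (fiota beta) (fmul (fiota (/ beta)) rho)).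
Proof.
  intros H. unfold mobius. set (D := fadd (cst 1) rho). set (N := fmul P _).
  replace (fmul (fmul N (finv D)) D) with (fmul N (fmul D (finv D))) by ring.
  rewrite finv_r by (apply fadd_1_coef0; assumption). ring.
Qed.

Lemma wt_mulat c v e x : wt (mulatC c v e x) = mulat fps fmul fiota c v e (wt x).
Proof.
  extensionality u. unfold wt, mulatC, mulat, setf. destruct (Nat.eqb u (other v e)); [|reflexivity].
  rewrite cst_mul. unfold fiota. ring.
Qed.

Lemma wt_divall v L x : wt (divallC v L x) = divall fps fmul fiota v L (wt x).
Proof. induction L as [|e L IH]; simpl; [reflexivity|]. rewrite wt_mulat, IH. reflexivity. Qed.

Lemma wt_setf_0 x v : wt (setf x v (RtoC 0)) = setf (wt x) v (cst 0).
Proof.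
  extensionality u. unfold wt, setf. destruct (Nat.eqb u v); [|reflexivity].
  change (cst (RtoC 0)) with (cst 0). ring.
Qed.

Lemma mulat_inv_sq v e x : e_beta e <> 0%R ->
  mulatC (fun b => b * b)%R v e (mulatC inv_sq v e x) = x.
Proof.
  intros Hb. extensionality u. unfold mulatC, setf. rewrite Nat.eqb_refl.
  destruct (Nat.eqb_spec u (other v e)) as [->|]; [|reflexivity].
  rewrite Cmult_assoc, <- RtoC_mult. unfold inv_sq. rewrite Rinv_r; [ring|].
  apply Rmult_integral_contrapositive; auto.
Qed.

Lemma fmul_cancel a b c : c O = RtoC 1 -> fmul a c = fmul b c -> a = b.
Proof.
  intros H Heq. assert (fmul (fmul a c) (finv c) = fmul (fmul b c) (finv c)) by congruence.
  replace (fmul (fmul a c) (finv c)) with (fmul a (fmul c (finv c))) in H0 by ring.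
  replace (fmul (fmul b c) (finv c)) with (fmul b (fmul c (finv c))) in H0 by ring.
  rewrite finv_r in H0 by assumption.
  replace a with (fmul a (cst 1)) by ring. rewrite H0. ring.
Qed.

(** The telescoping: by [Zg_ratio_step] each factor of the fold is beta times a quotient of
    consecutive partition functions, so only the first, the last and the product of the edge
    activities remain. *)
Lemma edge_fold_spec n E v L x P : (forall e, In e L -> (other v e < n)%nat /\ e_beta e <> 0%R) ->
  fmul (edge_fold (ratio_fps n E) v L (divallC v L x) P) (ZF n E (actF (wt x))) =
  fmul (fmul P (bprod fps (cst 1) fmul fiota L)) (ZF n E (actF (wt (divallC v L x)))).
Proof.
  revert P. induction L as [|e L IH]; intros P HL; simpl; [ring|].
  destruct (HL e (or_introl eq_refl)) as [Hu Hb].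
  rewrite mulat_inv_sq by assumption. rewrite IH by (intros; apply HL; now right).
  set (b := divallC v L x). set (rho := ratio_fps n E b (other v e)).
  assert (Hr : rho O = RtoC 0) by apply ratio_fps_0.
  apply (fmul_cancel _ _ (fadd (cst 1) rho)); [apply fadd_1_coef0; assumption|].
  pose proof (Zg_ratio_step fps (cst 0) (cst 1) fadd fmul fsub fopp fps_th fiota) as HW.
  specialize (HW ltac:(intros; unfold fiota; rewrite RtoC_mult; apply cst_mul)).
  specialize (HW n E (wt b) v e rho Hu Hb (ratio_fps_spec n E b (other v e))).
  rewrite <- wt_mulat in HW.
  set (K := bprod fps (cst 1) fmul fiota L).
  set (Z1 := ZF n E (actF (wt b))) in *. set (Z2 := ZF n E (actF (wt (mulatC inv_sq v e b)))) in *.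
  transitivity (fmul (fmul (fmul (mobius (e_beta e) rho P) (fadd (cst 1) rho)) K) Z1); [ring|].
  rewrite mobius_spec by assumption.
  transitivity (fmul (fmul P K) (fmul (fmul (fiota (e_beta e)) Z2) (fadd (cst 1) rho))); [|ring].
  rewrite HW. ring.
Qed.

(** The true ratios are a fixed point of the recursion: [Zg_pin_true] produces exactly the product
    and the divided activities that [edge_fold_spec] leaves over. *)
Lemma edge_fold_ratio_fps n E x v : loopless n E -> (v < n)%nat -> (forall e, In e E -> e_beta e <> 0%R) ->
  let L := filter (incident v) E in
  edge_fold (ratio_fps n E) v L (divallC v L (setf x v (RtoC 0))) (wt x v) = ratio_fps n E x v.
Proof.
  intros HE Hv Hb L.
  apply (fmul_cancel _ _ (ZF n E (actF (wt (setf x v (RtoC 0)))))); [apply ZF_act_coef0|].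
  rewrite edge_fold_spec.
  - rewrite wt_divall, !wt_setf_0.
    rewrite (Zg_dead fps (cst 0) (cst 1) fadd fmul fsub fopp fps_th) by assumption.
    rewrite ratio_fps_spec.
    rewrite (Zg_pin_true fps (cst 0) (cst 1) fadd fmul fsub fopp fps_th fiota); auto.
    + fold L. ring.
    + intros; unfold fiota; rewrite RtoC_mult; apply cst_mul.
  - intros e He. apply filter_In in He. destruct He. split; auto.
    eapply other_lt; eassumption.
Qed.

Lemma mobius_agree k beta r r' P P' : r O = RtoC 0 -> r' O = RtoC 0 -> P O = RtoC 0 -> P' O = RtoC 0 ->
  agree k r r' -> agree (S k) P P' -> agree (S k) (mobius beta r P) (mobius beta r' P').
Proof.
  intros Hr Hr' HP HP' H1 H2. unfold mobius.
  replace (fmul (fmul P (fadd (fiota beta) (fmul (fiota (/ beta)) r))) (finv (fadd (cst 1) r)))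
    with (fmul P (fmul (fadd (fiota beta) (fmul (fiota (/ beta)) r)) (finv (fadd (cst 1) r)))) by ring.
  replace (fmul (fmul P' (fadd (fiota beta) (fmul (fiota (/ beta)) r'))) (finv (fadd (cst 1) r')))
    with (fmul P' (fmul (fadd (fiota beta) (fmul (fiota (/ beta)) r')) (finv (fadd (cst 1) r')))) by ring.
  apply fmul_agree_S; auto. apply fmul_agree.
  - intros j Hj. unfold fadd, fiota. rewrite !fmul_cst, H1 by assumption. reflexivity.
  - apply finv_agree; try (apply fadd_1_coef0; assumption).
    intros j Hj. unfold fadd. rewrite H1 by assumption. reflexivity.
Qed.

Lemma mobius_0 beta r P : P O = RtoC 0 -> mobius beta r P O = RtoC 0.
Proof. intros H. unfold mobius. simpl. rewrite H. ring. Qed.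

Lemma edge_fold_0 rec v L x P : P O = RtoC 0 -> edge_fold rec v L x P O = RtoC 0.
Proof. revert x P; induction L as [|e L IH]; intros x P H; simpl; auto. apply IH, mobius_0, H. Qed.

Lemma ratio_rec_0 E k x v : ratio_rec E k x v O = RtoC 0.
Proof. destruct k; simpl; [reflexivity|]. apply edge_fold_0. rewrite fmul_cst. simpl. ring. Qed.

Lemma edge_fold_agree k rec rec' v L x P P' :
  (forall x u, rec x u O = RtoC 0) -> (forall x u, rec' x u O = RtoC 0) ->
  P O = RtoC 0 -> P' O = RtoC 0 -> agree (S k) P P' ->
  (forall e y, In e L -> agree k (rec y (other v e)) (rec' y (other v e))) ->
  agree (S k) (edge_fold rec v L x P) (edge_fold rec' v L x P').
Proof.
  intros Hr Hr'. revert x P P'. induction L as [|e L IH]; intros x P P' HP HP' H HL; simpl; auto.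
  apply IH; auto using mobius_0.
  - apply mobius_agree; auto. apply HL. now left.
  - intros; apply HL; now right.
Qed.

(** Both sides are one fold applied to recursive ratios that agree to order [k + 1]; the initial
    series has no constant term, so the fold gains an order. At depth 0 the zero series has the
    right constant term. *)
Lemma ratio_rec_agree n E : loopless n E -> (forall e, In e E -> e_beta e <> 0%R) ->
  forall k x v, (v < n)%nat -> agree (S k) (ratio_rec E k x v) (ratio_fps n E x v).
Proof.
  intros HE Hb. induction k as [|k IH]; intros x v Hv.
  - intros j Hj. assert (j = O) as -> by lia. rewrite ratio_fps_0. reflexivity.
  - rewrite <- edge_fold_ratio_fps by assumption. simpl ratio_rec.
    assert (HP : fmul (cst (x v)) tau O = RtoC 0) by (rewrite fmul_cst; simpl; ring).
    apply edge_fold_agree; auto using ratio_rec_0, ratio_fps_0.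
    + intros j _. reflexivity.
    + intros e y He. apply filter_In in He. apply IH. eapply other_lt; [eassumption|tauto].
Qed.

(** * Bounds on the coefficients and truncation error *)

Definition sqn (z : C) : R := fst z * fst z + snd z * snd z.

Lemma sqn_Cmod z : sqn z = Cmod z * Cmod z.
Proof. pose proof (Cmod2_alt z) as H. unfold Re, Im in H. unfold sqn. simpl in H. lra. Qed.

Lemma sqn_ge0 z : 0 <= sqn z.
Proof. unfold sqn. nra. Qed.

Lemma sqn_mult a b : sqn (a * b)%C = sqn a * sqn b.
Proof. unfold sqn. destruct a, b; simpl. ring. Qed.

Lemma sqn_line (beta : R) a b :
  sqn (beta * a + b)%C = beta * beta * sqn a + sqn b + beta * (sqn (a + b)%C - sqn a - sqn b).
Proof. unfold sqn. destruct a, b; simpl. ring. Qed.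

Lemma sqn_par a b : sqn (a + b)%C + sqn (a + - b)%C = 2 * sqn a + 2 * sqn b.
Proof. unfold sqn. destruct a, b; simpl. ring. Qed.

Definition beta_ok (E : list wedge) : Prop := forall e, In e E -> -1 <= e_beta e <= 1.

Lemma lee_yang_C n E (x : nat -> C) v : loopless n E -> beta_ok E ->
  (forall u, Cmod (x u) <= 1) -> (v < n)%nat ->
  Cmod (ZC n E (pinC (actC x) v true)) <= Cmod (ZC n E (pinC (actC x) v false)).
Proof.
  intros HE Hb Hx Hv.
  pose proof (lee_yang C 0 1 Cplus Cmult Cminus Copp C_th RtoC sqn (fun z => Cmod z <= 1)
    sqn_line sqn_par) as H.
  specialize (H ltac:(intros z a Hz; rewrite sqn_mult, sqn_Cmod; pose proof (sqn_ge0 a);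
    pose proof (Cmod_ge_0 z); assert (Cmod z * Cmod z <= 1) by nra; nra)
    ltac:(intros z Hz; cbv beta; rewrite Cmod_opp; assumption) n E x v 1 HE Hb Hx Hv).
  rewrite !Cmult_1_r, !sqn_Cmod in H.
  apply Rsqr_incr_0; auto using Cmod_ge_0.
Qed.

Section FormFps.
Variable r : R.
Hypothesis Hr : 0 < r < 1.

(** The sum of |a_k|^2 / r^(2k) over k < K. The weights make multiplication by z t with |z| <= r a
    contraction, and the truncation makes the form finite on every series. *)
Fixpoint wnorm (K : nat) (a : fps) : R :=
  match K with O => 0 | S K => sqn (a O) + / (r * r) * wnorm K (ftl a) end.

Lemma wnorm_ext K a b : (forall k, a k = b k) -> wnorm K a = wnorm K b.
Proof. intros H. replace b with a; [reflexivity|]. extensionality k. apply H. Qed.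

Lemma wnorm_line K (beta : R) a b :
  wnorm K (fadd (fmul (fiota beta) a) b) =
  beta * beta * wnorm K a + wnorm K b + beta * (wnorm K (fadd a b) - wnorm K a - wnorm K b).
Proof.
  revert a b; induction K as [|K IH]; intros a b; simpl; [ring|].
  change (ftl (fadd a b)) with (fadd (ftl a) (ftl b)).
  rewrite (wnorm_ext K (ftl (fadd (fmul (fiota beta) a) b)) (fadd (fmul (fiota beta) (ftl a)) (ftl b))).
  2:{ intros k. unfold ftl, fadd, fiota. rewrite !fmul_cst. reflexivity. }
  rewrite IH. unfold fadd at 1 3. unfold fiota. rewrite fmul_cst, sqn_line. ring.
Qed.

Lemma wnorm_par K a b : wnorm K (fadd a b) + wnorm K (fadd a (fopp b)) = 2 * wnorm K a + 2 * wnorm K b.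
Proof.
  revert a b; induction K as [|K IH]; intros a b; simpl; [ring|].
  change (ftl (fadd a b)) with (fadd (ftl a) (ftl b)).
  change (ftl (fadd a (fopp b))) with (fadd (ftl a) (fopp (ftl b))).
  specialize (IH (ftl a) (ftl b)). pose proof (sqn_par (a O) (b O)) as H.
  unfold fadd at 1 3, fopp at 1.
  transitivity ((sqn (a O + b O)%C + sqn (a O + - b O)%C) +
    / (r * r) * (wnorm K (fadd (ftl a) (ftl b)) + wnorm K (fadd (ftl a) (fopp (ftl b))))); [ring|].
  rewrite IH, H. ring.
Qed.

Lemma inv_rr : 0 < / (r * r).
Proof. apply Rinv_0_lt_compat. nra. Qed.

Lemma wnorm_ge0 K a : 0 <= wnorm K a.
Proof.
  revert a; induction K as [|K IH]; intros a; simpl; [lra|].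
  pose proof (sqn_ge0 (a O)). pose proof inv_rr. specialize (IH (ftl a)). nra.
Qed.

Lemma wnorm_mono K a : wnorm K a <= wnorm (S K) a.
Proof.
  revert a; induction K as [|K IH]; intros a.
  - apply (wnorm_ge0 1).
  - specialize (IH (ftl a)). simpl in *. pose proof inv_rr. nra.
Qed.

Lemma wnorm_scal K z a : wnorm K (fmul (cst z) a) = sqn z * wnorm K a.
Proof.
  revert a; induction K as [|K IH]; intros a; cbn [wnorm]; [ring|].
  rewrite (wnorm_ext K (ftl (fmul (cst z) a)) (fmul (cst z) (ftl a))).
  - rewrite IH, fmul_cst, sqn_mult. ring.
  - intros k. unfold ftl. rewrite !fmul_cst. reflexivity.
Qed.

Definition contrF (x : fps) : Prop := exists z, x = fmul (cst z) tau /\ Cmod z <= r.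

(** The shift by [t] costs a factor 1 / r^2 in the weights, compensated by |z|^2, and pushes the top
    coefficient out of the truncation. *)
Lemma contrF_wnorm K x a : contrF x -> wnorm K (fmul x a) <= wnorm K a.
Proof.
  intros (z & -> & Hz).
  replace (fmul (fmul (cst z) tau) a) with (fmul (cst z) (fmul tau a)) by ring.
  rewrite wnorm_scal. destruct K as [|K]; [simpl; lra|].
  etransitivity; [|apply wnorm_mono]. cbn [wnorm]. rewrite fmul_tau.
  rewrite (wnorm_ext K (ftl (fmul tau a)) a) by (intros k; unfold ftl; rewrite fmul_tau; reflexivity).
  assert (H0 : sqn 0%C = 0) by (unfold sqn; simpl; ring). rewrite H0.
  pose proof (wnorm_ge0 K a). rewrite sqn_Cmod.
  pose proof (Cmod_ge_0 z). pose proof inv_rr as Hi.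
  assert (H3 : Cmod z * Cmod z * / (r * r) <= 1).
  { apply (Rmult_le_reg_r (r * r)); [nra|]. rewrite Rmult_assoc, Rinv_l by nra. nra. }
  nra.
Qed.

Lemma contrF_opp x : contrF x -> contrF (fopp x).
Proof.
  intros (z & -> & Hz). exists (- z)%C. split; [|rewrite Cmod_opp; assumption].
  extensionality k. unfold fopp. rewrite !fmul_cst. ring.
Qed.

Lemma wnorm_coef K a k : (k < K)%nat -> sqn (a k) <= wnorm K a * (r * r) ^ k.
Proof.
  revert K a; induction k as [|k IH]; intros K a Hk; destruct K as [|K]; try lia.
  - simpl. pose proof (wnorm_ge0 K (ftl a)). pose proof inv_rr. nra.
  - specialize (IH K (ftl a) ltac:(lia)). simpl wnorm. unfold ftl at 1 in IH. simpl pow.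
    pose proof (sqn_ge0 (a O)).
    assert (0 <= (r * r) ^ k) by (apply pow_le; nra).
    replace ((sqn (a O) + / (r * r) * wnorm K (ftl a)) * (r * r * (r * r) ^ k))
      with (sqn (a O) * (r * r) * (r * r) ^ k + wnorm K (ftl a) * (r * r) ^ k) by (field; nra).
    assert (0 <= sqn (a O) * (r * r) * (r * r) ^ k) by (apply Rmult_le_pos; nra).
    lra.
Qed.

(** With the multiplier [finv D] the Lee-Yang inequality compares the series N / D with 1, whose
    form is 1, so coefficient k of N / D is at most r^k. The prefactor [wt x v] raises the degree by
    one and contributes one more factor [r]. *)
Lemma ratio_fps_coef_bound n E x v k : loopless n E -> beta_ok E ->
  (forall u, Cmod (x u) <= r) -> (v < n)%nat -> Cmod (ratio_fps n E x v k) <= r ^ k.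
Proof.
  intros HE Hb Hx Hv.
  set (D := ZF n E (pinF (actF (wt x)) v false)). set (N := ZF n E (pinF (actF (wt x)) v true)).
  assert (HD : fmul D (finv D) = cst 1) by (apply finv_r, ZF_pin_coef0).
  assert (HT : ratio_fps n E x v = fmul (cst (x v)) (fmul tau (fmul N (finv D)))).
  { unfold ratio_fps, wt at 1. fold N D. ring. }
  rewrite HT, fmul_cst, fmul_tau. destruct k as [|k].
  { rewrite Cmult_0_r, Cmod_0. simpl. lra. }
  rewrite Cmod_mult. simpl.
  assert (Hk : Cmod (fmul N (finv D) k) <= r ^ k).
  { pose proof (lee_yang fps (cst 0) (cst 1) fadd fmul fsub fopp fps_th fiota (wnorm (S k)) contrF
      (wnorm_line (S k)) (wnorm_par (S k)) (contrF_wnorm (S k)) contrF_opp n E (wt x) v (finv D) HE Hb) as H.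
    specialize (H ltac:(intros u; exists (x u); split; [reflexivity|apply Hx]) Hv).
    fold N D in H. rewrite HD in H.
    assert (H1 : wnorm (S k) (cst 1) = 1).
    { simpl. rewrite (wnorm_ext k (ftl (cst 1)) (fmul (cst 0) (cst 1))).
      - rewrite wnorm_scal. unfold sqn; simpl. ring.
      - intros i. rewrite fmul_cst. unfold ftl; simpl. ring. }
    rewrite H1 in H. pose proof (wnorm_coef (S k) (fmul N (finv D)) k ltac:(lia)) as H2.
    rewrite sqn_Cmod in H2.
    assert (H3 : 0 <= (r * r) ^ k) by (apply pow_le; nra).
    apply Rsqr_incr_0; auto using Cmod_ge_0; [|apply pow_le; lra].
    unfold Rsqr. rewrite <- Rpow_mult_distr. nra. }
  specialize (Hx v). pose proof (Cmod_ge_0 (x v)). pose proof (Cmod_ge_0 (fmul N (finv D) k)).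
  nra.
Qed.

(** * Evaluation of the ratio series at t = 1 by partial sums *)

Fixpoint psum (a : fps) (K : nat) : C := match K with O => RtoC 0 | S k => (psum a k + a k)%C end.

Lemma psum_fadd a b K : psum (fadd a b) K = (psum a K + psum b K)%C.
Proof. induction K as [|K IH]; simpl; [ring|]. rewrite IH. unfold fadd. ring. Qed.

Lemma psum_cst z a K : psum (fmul (cst z) a) K = (z * psum a K)%C.
Proof. induction K as [|K IH]; simpl; [ring|]. rewrite IH, fmul_cst. ring. Qed.

Lemma psum_tau a K : psum (fmul tau a) (S K) = psum a K.
Proof.
  induction K as [|K IH].
  - simpl. ring.
  - change (psum (fmul tau a) (S (S K))) with (psum (fmul tau a) (S K) + fmul tau a (S K))%C.
    rewrite IH, fmul_tau. reflexivity.
Qed.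

Definition geo (B : R) (a : fps) : Prop := forall k, Cmod (a k) <= B * r ^ k.

(* [p] acts on geometrically bounded series as multiplication of their sums by [z]. *)
Definition evals (p : fps) (z : C) : Prop :=
  forall B, 0 <= B -> exists B', 0 <= B' /\ forall a, geo B a ->
    geo B' (fmul p a) /\ forall K, Cmod (psum (fmul p a) K - z * psum a K)%C <= B' * r ^ K.

Lemma rK K : 0 < r ^ K.
Proof. apply pow_lt. lra. Qed.

Lemma evals_cst z : evals (cst z) z.
Proof.
  intros B HB. exists (Cmod z * B). pose proof (Cmod_ge_0 z). split; [nra|].
  intros a Ha. split.
  - intros k. rewrite fmul_cst, Cmod_mult, Rmult_assoc. apply Rmult_le_compat_l; auto.
  - intros K. rewrite psum_cst. replace (z * psum a K - z * psum a K)%C with (RtoC 0) by ring.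
    rewrite Cmod_0. pose proof (rK K). apply Rmult_le_pos; nra.
Qed.

Lemma evals_tau : evals tau 1.
Proof.
  intros B HB. exists (B / r). assert (Hi : 0 <= B / r) by (apply Rdiv_le_0_compat; lra).
  assert (Hs : forall K, B * r ^ K = B / r * r ^ S K) by (intros; simpl; field; lra).
  split; [assumption|]. intros a Ha. split.
  - intros k. rewrite fmul_tau. destruct k as [|k].
    + rewrite Cmod_0. simpl. lra.
    + rewrite <- Hs. apply Ha.
  - intros [|K].
    + simpl. replace (0 - 1 * 0)%C with (RtoC 0) by ring. rewrite Cmod_0. lra.
    + rewrite psum_tau. simpl psum. replace (psum a K - 1 * (psum a K + a K))%C with (- a K)%C by ring.
      rewrite Cmod_opp, <- Hs. apply Ha.
Qed.

Lemma evals_add p q z w : evals p z -> evals q w -> evals (fadd p q) (z + w)%C.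
Proof.
  intros Hp Hq B HB. destruct (Hp B HB) as (B1 & HB1 & H1). destruct (Hq B HB) as (B2 & HB2 & H2).
  exists (B1 + B2). split; [lra|]. intros a Ha.
  destruct (H1 a Ha) as [G1 S1]. destruct (H2 a Ha) as [G2 S2].
  replace (fmul (fadd p q) a) with (fadd (fmul p a) (fmul q a)) by ring. split.
  - intros k. unfold fadd. etransitivity; [apply Cmod_triangle|].
    rewrite Rmult_plus_distr_r. apply Rplus_le_compat; auto.
  - intros K. rewrite psum_fadd.
    replace (psum (fmul p a) K + psum (fmul q a) K - (z + w) * psum a K)%C with
      ((psum (fmul p a) K - z * psum a K) + (psum (fmul q a) K - w * psum a K))%C by ring.
    etransitivity; [apply Cmod_triangle|].
    rewrite Rmult_plus_distr_r. apply Rplus_le_compat; auto.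
Qed.

(** Here the quantification over all [B] pays off: multiplication by [q] returns a geometrically
    bounded series with another constant, to which the property of [p] applies. *)
Lemma evals_mul p q z w : evals p z -> evals q w -> evals (fmul p q) (z * w)%C.
Proof.
  intros Hp Hq B HB. destruct (Hq B HB) as (B1 & HB1 & H1). destruct (Hp B1 HB1) as (B2 & HB2 & H2).
  pose proof (Cmod_ge_0 z) as Hz.
  exists (B2 + Cmod z * B1). split; [nra|]. intros a Ha.
  destruct (H1 a Ha) as [G1 S1]. destruct (H2 _ G1) as [G2 S2].
  replace (fmul (fmul p q) a) with (fmul p (fmul q a)) by ring. split.
  - intros k. etransitivity; [apply G2|]. pose proof (rK k).
    assert (0 <= Cmod z * B1 * r ^ k) by (apply Rmult_le_pos; nra). lra.
  - intros K.
    replace (psum (fmul p (fmul q a)) K - z * w * psum a K)%C with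
      ((psum (fmul p (fmul q a)) K - z * psum (fmul q a) K) +
       z * (psum (fmul q a) K - w * psum a K))%C by ring.
    etransitivity; [apply Cmod_triangle|]. rewrite Cmod_mult.
    rewrite Rmult_plus_distr_r, Rmult_assoc. apply Rplus_le_compat; auto.
    apply Rmult_le_compat_l; auto.
Qed.

Lemma evals_Zg n E w w' : (forall v i, evals (w v i) (w' v i)) -> evals (ZF n E w) (ZC n E w').
Proof.
  intros Hw. apply (Zg_rel fps C _ _ _ _ fadd fmul Cplus Cmult fiota RtoC evals); try assumption.
  - apply evals_cst.
  - apply evals_cst.
  - intros; apply evals_add; assumption.
  - intros; apply evals_mul; assumption.
  - intros; apply evals_cst.
Qed.

Lemma psum_geo_tail a K m : (m <= K)%nat -> (forall k, Cmod (a k) <= r ^ k) ->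
  Cmod (psum a K - psum a m)%C <= (r ^ m - r ^ K) / (1 - r).
Proof.
  intros HmK Ha. induction K as [|K IH].
  - assert (m = O) as -> by lia. simpl. replace (0 - 0)%C with (RtoC 0) by ring. rewrite Cmod_0.
    unfold Rdiv. lra.
  - destruct (Nat.eq_dec m (S K)) as [->|Hn].
    + replace (psum a (S K) - psum a (S K))%C with (RtoC 0) by ring. rewrite Cmod_0.
      unfold Rdiv. lra.
    + simpl psum. replace (psum a K + a K - psum a m)%C with ((psum a K - psum a m) + a K)%C by ring.
      etransitivity; [apply Cmod_triangle|].
      apply (Rle_trans _ ((r ^ m - r ^ K) / (1 - r) + r ^ K)).
      * apply Rplus_le_compat; auto. apply IH; lia.
      * right. simpl. field. lra.
Qed.

Lemma pow_lt_eps (B eps : R) : 0 <= B -> 0 < eps -> exists K0, forall K, (K0 <= K)%nat -> B * r ^ K <= eps.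
Proof.
  intros HB He.
  destruct (pow_lt_1_zero r ltac:(rewrite Rabs_pos_eq; lra) (eps / (B + 1))) as [K0 HK].
  { apply Rdiv_lt_0_compat; lra. }
  exists K0. intros K HKK. specialize (HK K HKK). pose proof (rK K).
  rewrite Rabs_pos_eq in HK by lra.
  assert (eps / (B + 1) * (B + 1) = eps) by (field; lra).
  nra.
Qed.

Definition ratioC n E (x : nat -> C) v : C :=
  (x v * ZC n E (pinC (actC x) v true) / ZC n E (pinC (actC x) v false))%C.

(** The series identity D R = (x t) N is evaluated at [t = 1] with errors of order r^K. Dividing by
    the number D shows that the partial sums of R tend to the ratio, and the coefficient bound
    controls the tail after [m] terms. *)
Lemma ratio_fps_error n E x v m : loopless n E -> beta_ok E ->
  (forall u, Cmod (x u) <= r) -> (v < n)%nat ->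
  ZC n E (pinC (actC x) v false) <> 0 ->
  Cmod (ratioC n E x v - psum (ratio_fps n E x v) m)%C <= r ^ m / (1 - r).
Proof.
  intros HE Hb Hx Hv HD. unfold ratioC.
  set (D := ZC n E (pinC (actC x) v false)) in *. set (N := ZC n E (pinC (actC x) v true)).
  assert (Hw : forall v i, evals (actF (wt x) v i) (actC x v i)).
  { intros u [|]; simpl; [|apply evals_cst]. unfold wt.
    rewrite <- (Cmult_1_r (x u)). apply evals_mul.
    - rewrite Cmult_1_r. apply evals_cst.
    - apply evals_tau. }
  assert (Hp : forall i u h, evals (pinF (actF (wt x)) v i u h) (pinC (actC x) v i u h)).
  { intros i u h. unfold pin. destruct (Nat.eqb u v); [|apply Hw].
    destruct (Bool.eqb h i); apply evals_cst. }
  pose proof (evals_Zg n E _ _ (Hp false)) as ED. fold D in ED.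
  pose proof (evals_mul _ _ _ _ (Hw v true) (evals_Zg n E _ _ (Hp true))) as EN. fold N in EN.
  change (actC x v true) with (x v) in EN. change (actF (wt x) v true) with (wt x v) in EN.
  pose proof (ratio_fps_coef_bound n E x v) as HT.
  destruct (ED 1 ltac:(lra)) as (B1 & HB1 & H1). destruct (EN 1 ltac:(lra)) as (B2 & HB2 & H2).
  destruct (H1 (ratio_fps n E x v)) as [_ S1].
  { intros k. rewrite Rmult_1_l. apply HT; assumption. }
  destruct (H2 (cst 1)) as [_ S2].
  { intros [|k]; simpl; [rewrite Cmod_1; lra|]. rewrite Cmod_0. pose proof (rK k). nra. }
  assert (Hone : forall K, psum (cst 1) (S K) = 1).
  { induction K as [|K IH]; [simpl; ring|].
    change (psum (cst 1) (S (S K))) with (psum (cst 1) (S K) + 0)%C. rewrite IH. ring. }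
  rewrite (fmul_comm (ZF n E _)), ratio_fps_spec in S1.
  replace (fmul (fmul (wt x v) (ZF n E (pinF (actF (wt x)) v true))) (cst 1)) with
    (fmul (wt x v) (ZF n E (pinF (actF (wt x)) v true))) in S2 by ring.
  pose proof (Cmod_gt_0 D) as HD0. destruct HD0 as [HD0 _]. specialize (HD0 HD).
  apply le_epsilon. intros eps He.
  destruct (pow_lt_eps ((B1 + B2) / Cmod D) eps) as [K0 HK].
  { apply Rdiv_le_0_compat; lra. } { assumption. }
  (* A successor, because the partial sum of the series 1 is 1 only once its constant term is
     included. *)
  set (K := S (max K0 m)).
  specialize (HK K ltac:(unfold K; lia)). specialize (S1 K). specialize (S2 K).
  assert (HmK : (m <= K)%nat) by (unfold K; lia).
  unfold K at 2 in S2. rewrite Hone in S2.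
  set (PN := psum (fmul (wt x v) _) K) in *. set (PT := psum (ratio_fps n E x v) K) in *.
  assert (Hd : Cmod (x v * N / D - PT)%C <= eps).
  { etransitivity; [|apply HK].
    replace (x v * N / D - PT)%C with (((PN - D * PT) - (PN - x v * N * 1)) / D)%C by (field; assumption).
    rewrite Cmod_div by assumption. unfold Cminus at 1.
    apply (Rmult_le_reg_r (Cmod D)); [assumption|].
    replace (Cmod _ / Cmod D * Cmod D) with (Cmod (PN - D * PT + - (PN - x v * N * 1))%C)
      by (field; lra).
    replace ((B1 + B2) / Cmod D * r ^ K * Cmod D) with (B1 * r ^ K + B2 * r ^ K) by (field; lra).
    etransitivity; [apply Cmod_triangle|]. rewrite Cmod_opp. apply Rplus_le_compat; assumption. }
  replace (x v * N / D - psum (ratio_fps n E x v) m)%C with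
    ((PT - psum (ratio_fps n E x v) m) + (x v * N / D - PT))%C by ring.
  etransitivity; [apply Cmod_triangle|]. apply Rplus_le_compat; [|assumption].
  etransitivity; [apply (psum_geo_tail _ K m HmK)|].
  - intros k. apply HT; assumption.
  - unfold Rdiv. apply Rmult_le_compat_r; [left; apply Rinv_0_lt_compat; lra|].
    pose proof (rK K). lra.
Qed.
End FormFps.

(** * Approximation of the partition function *)

(* The vertices before [k] have been put out of the set. *)
Definition acts (lam : C) (n k : nat) : nat -> C :=
  fun u => if (Nat.leb k u && Nat.ltb u n)%bool then lam else RtoC 0.

Lemma Cmod_sub_le a b : Cmod a - Cmod b <= Cmod (a + b)%C.
Proof.
  pose proof (Cmod_triangle (a + b) (- b)). rewrite Cmod_opp in H.
  replace (a + b + - b)%C with a in H by ring. lra.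
Qed.

Section Approx.
Variables (r : R) (lam : C) (n : nat).
Hypothesis Hr : 0 < r < 1.
Hypothesis Hlam : Cmod lam <= r.

Lemma acts_le k u : Cmod (acts lam n k u) <= r.
Proof. unfold acts. destruct (_ && _)%bool; [assumption|]. rewrite Cmod_0. lra. Qed.

Definition Z_from (E : list wedge) (k : nat) : C := ZC n E (actC (acts lam n k)).

Lemma Z_from_n E : Z_from E n = 1.
Proof.
  apply (Zg_zero_act C _ _ _ _ _ _ C_th). intros u. split; [reflexivity|]. simpl. unfold acts.
  destruct (Nat.leb_spec n u), (Nat.ltb_spec u n); simpl; (reflexivity || lia).
Qed.

Lemma acts_S k : acts lam n (S k) = setf (acts lam n k) k (RtoC 0).
Proof.
  extensionality u. unfold setf, acts.
  destruct (Nat.eqb_spec u k), (Nat.leb_spec (S k) u), (Nat.leb_spec k u); simpl; (reflexivity || lia).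
Qed.

Lemma Z_from_dead E k : (k < n)%nat -> Z_from E (S k) = ZC n E (pinC (actC (acts lam n k)) k false).
Proof.
  intros Hk. unfold Z_from. rewrite acts_S. apply (Zg_dead C _ _ _ _ _ _ C_th). assumption.
Qed.

Lemma Z_from_split E k : (k < n)%nat ->
  Z_from E k = (Z_from E (S k) + acts lam n k k * ZC n E (pinC (actC (acts lam n k)) k true))%C.
Proof.
  intros Hk. rewrite Z_from_dead by assumption. unfold Z_from.
  rewrite (Zg_split C _ _ _ _ _ _ C_th RtoC n E _ k Hk).
  unfold act at 1 3. ring.
Qed.

Lemma Z_from_ratio_le E k : loopless n E -> beta_ok E -> (k < n)%nat ->
  Cmod (acts lam n k k * ZC n E (pinC (actC (acts lam n k)) k true))%C <= r * Cmod (Z_from E (S k)).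
Proof.
  intros HE Hb Hk. rewrite Z_from_dead, Cmod_mult by assumption.
  apply Rmult_le_compat; auto using Cmod_ge_0, acts_le.
  apply lee_yang_C; auto. intros u. pose proof (acts_le k u). lra.
Qed.

Lemma Z_from_step_lower E k : loopless n E -> beta_ok E -> (k < n)%nat ->
  (1 - r) * Cmod (Z_from E (S k)) <= Cmod (Z_from E k).
Proof.
  intros HE Hb Hk. pose proof (Z_from_ratio_le E k HE Hb Hk) as H. rewrite (Z_from_split E k Hk).
  pose proof (Cmod_sub_le (Z_from E (S k)) (acts lam n k k * ZC n E (pinC (actC (acts lam n k)) k true))).
  lra.
Qed.

(** Besides excluding zeros, this quantitative bound turns the absolute error caused by replacing
    zero edge activities into a relative one. *)
Lemma Z_from_lower E k : loopless n E -> beta_ok E -> (k <= n)%nat -> (1 - r) ^ (n - k) <= Cmod (Z_from E k).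
Proof.
  intros HE Hb Hk. remember (n - k)%nat as d eqn:Hd. revert k Hk Hd.
  induction d as [|d IH]; intros k Hk Hd.
  - assert (k = n) as -> by lia. rewrite Z_from_n, Cmod_1. simpl. lra.
  - pose proof (Z_from_step_lower E k HE Hb ltac:(lia)). specialize (IH (S k) ltac:(lia) ltac:(lia)).
    simpl. nra.
Qed.

Lemma Z_from_neq_0 E k : loopless n E -> beta_ok E -> (k <= n)%nat -> Z_from E k <> 0.
Proof.
  intros HE Hb Hk H. pose proof (Z_from_lower E k HE Hb Hk) as Hl. rewrite H, Cmod_0 in Hl.
  pose proof (pow_lt (1 - r) (n - k) ltac:(lra)). lra.
Qed.

(** Depth [m] is exact through degree [m], hence [S m] coefficients. *)
Definition factor (E : list wedge) (m k : nat) : C :=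
  (1 + psum (ratio_rec E m (acts lam n k) k) (S m))%C.

Fixpoint prodf (f : nat -> C) (k : nat) : C :=
  match k with O => RtoC 1 | S j => (prodf f j * f j)%C end.

Definition R_from E k : C := ratioC n E (acts lam n k) k.

Lemma Z_from_R_from E k : loopless n E -> beta_ok E -> (k < n)%nat -> Z_from E k = (Z_from E (S k) * (1 + R_from E k))%C.
Proof.
  intros HE Hb Hk. unfold R_from, ratioC. rewrite <- Z_from_dead by assumption.
  rewrite (Z_from_split E k Hk). field. apply Z_from_neq_0; auto.
Qed.

Lemma prodf_R_from E k : loopless n E -> beta_ok E -> (k <= n)%nat ->
  Z_from E 0 = (prodf (fun j => 1 + R_from E j)%C k * Z_from E k)%C.
Proof.
  intros HE Hb. induction k as [|k IH]; intros Hk; [simpl; ring|].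
  rewrite IH, (Z_from_R_from E k) by (assumption || lia). simpl. ring.
Qed.

Lemma R_from_lower E k : loopless n E -> beta_ok E -> (k < n)%nat -> 1 - r <= Cmod (1 + R_from E k)%C.
Proof.
  intros HE Hb Hk. pose proof (Z_from_step_lower E k HE Hb Hk) as H.
  rewrite (Z_from_R_from E k HE Hb Hk), Cmod_mult in H.
  assert (0 < Cmod (Z_from E (S k))) by (apply Cmod_gt_0, Z_from_neq_0; auto).
  apply (Rmult_le_reg_l (Cmod (Z_from E (S k)))); lra.
Qed.

Lemma psum_agree a b K : agree K a b -> psum a K = psum b K.
Proof.
  induction K as [|K IH]; intros H; simpl; [reflexivity|].
  rewrite IH, (H K); auto. intros j Hj. apply H. lia.
Qed.

Lemma factor_error E m k : loopless n E -> beta_ok E -> (forall e, In e E -> e_beta e <> 0) ->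
  (k < n)%nat -> Cmod (factor E m k - (1 + R_from E k))%C <= r ^ S m / (1 - r).
Proof.
  intros HE Hb H0 Hk. unfold factor, R_from.
  rewrite (psum_agree _ (ratio_fps n E (acts lam n k) k) (S m)) by (apply ratio_rec_agree; assumption).
  pose proof (ratio_fps_error r Hr n E (acts lam n k) k (S m) HE Hb (acts_le k) Hk) as H.
  rewrite <- Z_from_dead in H by assumption. specialize (H ltac:(apply Z_from_neq_0; auto)).
  rewrite <- Cmod_opp. eapply Rle_trans; [|exact H]. right. f_equal. ring.
Qed.

(** Relative errors compound as (1 + h)^k. The second division by [1 - r] makes the error of one
    factor relative, each true factor having modulus at least [1 - r]. *)
Lemma prodf_error E m h k : loopless n E -> beta_ok E -> (forall e, In e E -> e_beta e <> 0) ->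
  (k <= n)%nat -> r ^ S m / (1 - r) / (1 - r) <= h ->
  Cmod (prodf (factor E m) k - prodf (fun j => 1 + R_from E j) k)%C <=
  ((1 + h) ^ k - 1) * Cmod (prodf (fun j => 1 + R_from E j)%C k).
Proof.
  intros HE Hb H0 Hk Hh.
  assert (Hh0 : 0 <= h).
  { etransitivity; [|exact Hh]. assert (0 < r ^ S m) by (apply pow_lt; lra).
    repeat apply Rdiv_le_0_compat; lra. }
  induction k as [|k IH]; simpl prodf.
  { replace (1 - 1)%C with (RtoC 0) by ring. rewrite Cmod_0, Cmod_1. simpl. lra. }
  specialize (IH ltac:(lia)).
  pose proof (factor_error E m k HE Hb H0 ltac:(lia)) as Hf.
  pose proof (R_from_lower E k HE Hb ltac:(lia)) as Hl.
  set (P := prodf (factor E m) k) in *. set (T := prodf (fun j => 1 + R_from E j)%C k) in *.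
  set (s := factor E m k) in *. set (t := (1 + R_from E k)%C) in *.
  assert (Hs : Cmod (s - t)%C <= h * Cmod t).
  { etransitivity; [exact Hf|].
    replace (r ^ S m / (1 - r)) with (r ^ S m / (1 - r) / (1 - r) * (1 - r)) by (field; lra).
    assert (0 <= r ^ S m / (1 - r) / (1 - r)).
    { assert (0 < r ^ S m) by (apply pow_lt; lra). repeat apply Rdiv_le_0_compat; lra. }
    nra. }
  replace (P * s - T * t)%C with ((P - T) * (t + (s - t)) + T * (s - t))%C by ring.
  etransitivity; [apply Cmod_triangle|]. rewrite !Cmod_mult.
  pose proof (Cmod_triangle t (s - t)) as Ht.
  pose proof (Cmod_ge_0 T). pose proof (Cmod_ge_0 t). pose proof (Cmod_ge_0 (P - T)%C).
  pose proof (Cmod_ge_0 (t + (s - t))%C).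
  pose proof (pow_R1_Rle (1 + h) k ltac:(lra)) as Hp.
  apply (Rle_trans _ (((1 + h) ^ k - 1) * Cmod T * (Cmod t + h * Cmod t) + Cmod T * (h * Cmod t))).
  - apply Rplus_le_compat.
    + apply Rmult_le_compat; lra.
    + apply Rmult_le_compat_l; lra.
  - right. simpl. ring.
Qed.

Lemma one_plus_pow h k : 0 <= h -> INR k * h <= 1 / 2 -> (1 + h) ^ k <= 1 + 2 * INR k * h.
Proof.
  intros Hh. induction k as [|k IH]; intros Hk; [simpl; lra|].
  rewrite S_INR in *. pose proof (pos_INR k). simpl pow.
  specialize (IH ltac:(lra)).
  apply (Rle_trans _ ((1 + h) * (1 + 2 * INR k * h))); [apply Rmult_le_compat_l; lra|].
  assert (INR k * h <= 1 / 2) by lra. assert (INR k * h * h <= 1 / 2 * h) by (apply Rmult_le_compat_r; lra). lra.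
Qed.

Lemma prodf_approx E m eps : loopless n E -> beta_ok E -> (forall e, In e E -> e_beta e <> 0) ->
  0 < eps < 1 -> INR n * (r ^ S m / (1 - r) / (1 - r)) <= eps / 4 ->
  Cmod (prodf (factor E m) n - Z_from E 0)%C <= eps / 2 * Cmod (Z_from E 0).
Proof.
  intros HE Hb H0 He Hm. rewrite (prodf_R_from E n HE Hb (le_n n)), Z_from_n, Cmult_1_r.
  etransitivity; [apply (prodf_error E m _ n HE Hb H0 (le_n n) (Rle_refl _))|].
  apply Rmult_le_compat_r; [apply Cmod_ge_0|].
  assert (0 <= r ^ S m / (1 - r) / (1 - r)).
  { assert (0 < r ^ S m) by (apply pow_lt; lra). repeat apply Rdiv_le_0_compat; lra. }
  pose proof (one_plus_pow _ n H ltac:(lra)). lra.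
Qed.

(** * Replacement of zero edge activities *)

Definition perturb (delta : R) (e : wedge) : wedge :=
  (fst e, if Req_dec_T (e_beta e) 0 then delta else e_beta e).

Lemma loopless_perturb d E : loopless n E -> loopless n (map (perturb d) E).
Proof. intros H e He. apply in_map_iff in He. destruct He as (e' & <- & He'). apply (H e' He'). Qed.

Lemma perturb_ok d E : 0 < d <= 1 -> beta_ok E -> beta_ok (map (perturb d) E).
Proof.
  intros Hd H e He. apply in_map_iff in He. destruct He as (e' & <- & He').
  specialize (H e' He'). unfold perturb. simpl. destruct (Req_dec_T _ _); lra.
Qed.

Lemma perturb_neq_0 d E : 0 < d -> forall e, In e (map (perturb d) E) -> e_beta e <> 0.
Proof.
  intros Hd e He. apply in_map_iff in He. destruct He as (e' & <- & He').
  unfold perturb. simpl. destruct (Req_dec_T _ _); lra.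
Qed.

Notation eprodC := (eprod C (RtoC 1) Cmult RtoC).
Notation vprodC := (vprod C (RtoC 1) Cmult).

Lemma eterm_le1 s e : -1 <= e_beta e <= 1 -> Cmod (eterm C (RtoC 1) RtoC s e) <= 1.
Proof.
  intros H. unfold eterm. destruct (xorb _ _); [|rewrite Cmod_1; lra].
  rewrite Cmod_R. apply Rabs_le. assumption.
Qed.

Lemma eprod_le1 s E : beta_ok E -> Cmod (eprodC E s) <= 1.
Proof.
  induction E as [|e E IH]; intros H; simpl; [rewrite Cmod_1; lra|].
  rewrite Cmod_mult. pose proof (eterm_le1 s e (H e (or_introl eq_refl))).
  specialize (IH ltac:(intros e' ?; apply H; now right)).
  pose proof (Cmod_ge_0 (eterm C (RtoC 1) RtoC s e)). pose proof (Cmod_ge_0 (eprodC E s)). nra.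
Qed.

(** All factors have modulus at most 1, so exchanging them one at a time costs at most [d] per
    edge. *)
Lemma eprod_perturb d s E : 0 < d <= 1 -> beta_ok E ->
  Cmod (eprodC (map (perturb d) E) s - eprodC E s)%C <= INR (length E) * d.
Proof.
  intros Hd. induction E as [|e E IH]; intros H; cbn [eprod fold_right map length].
  { simpl. replace (1 - 1)%C with (RtoC 0) by ring. rewrite Cmod_0. lra. }
  assert (HE : beta_ok E) by (intros e' ?; apply H; now right).
  specialize (IH HE). fold (eprodC (map (perturb d) E) s). fold (eprodC E s).
  set (a := eprodC (map (perturb d) E) s) in *. set (b := eprodC E s) in *.
  set (x := eterm C (RtoC 1) RtoC s e).
  pose proof (eterm_le1 s e (H e (or_introl eq_refl))) as Hx. fold x in Hx.
  assert (Ha : Cmod a <= 1) by (apply eprod_le1, perturb_ok; assumption).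
  assert (Hy : Cmod (eterm C (RtoC 1) RtoC s (perturb d e) - x)%C <= d).
  { unfold x, eterm. change (e_u (perturb d e)) with (e_u e). change (e_v (perturb d e)) with (e_v e).
    destruct (xorb _ _).
    - unfold perturb. simpl. destruct (Req_dec_T _ _) as [->|].
      + rewrite <- RtoC_minus, Cmod_R, Rabs_pos_eq; lra.
      + unfold Cminus. rewrite Cplus_opp_r, Cmod_0. lra.
    - unfold Cminus. rewrite Cplus_opp_r, Cmod_0. lra. }
  set (y := eterm C (RtoC 1) RtoC s (perturb d e)) in *.
  replace (y * a - x * b)%C with ((y - x) * a + x * (a - b))%C by ring.
  etransitivity; [apply Cmod_triangle|]. rewrite !Cmod_mult, S_INR.
  pose proof (Cmod_ge_0 a). pose proof (Cmod_ge_0 (y - x)%C). pose proof (Cmod_ge_0 x).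
  pose proof (Cmod_ge_0 (a - b)%C).
  assert (Cmod (y - x)%C * Cmod a <= d * 1) by (apply Rmult_le_compat; lra).
  assert (Cmod x * Cmod (a - b)%C <= 1 * (INR (length E) * d)) by (apply Rmult_le_compat; lra).
  lra.
Qed.

Lemma vprod_le1 w k s : (forall v i, Cmod (w v i) <= 1) -> Cmod (vprodC w k s) <= 1.
Proof.
  intros Hw. revert k; induction s as [|h s IH]; intros k; simpl; [rewrite Cmod_1; lra|].
  rewrite Cmod_mult. specialize (Hw k h). specialize (IH (S k)).
  pose proof (Cmod_ge_0 (w k h)). pose proof (Cmod_ge_0 (vprodC w (S k) s)). nra.
Qed.

Lemma subsets_card k : length (subsets k) = (2 ^ k)%nat.
Proof. induction k as [|k IH]; simpl; [reflexivity|]. rewrite length_app, !length_map, IH. lia. Qed.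

Lemma Z_from_perturb d E : 0 < d <= 1 -> beta_ok E ->
  Cmod (Z_from (map (perturb d) E) 0 - Z_from E 0)%C <= 2 ^ n * (INR (length E) * d).
Proof.
  intros Hd Hb. unfold Z_from, Zg.
  assert (Hw : forall v i, Cmod (actC (acts lam n 0) v i) <= 1).
  { intros v [|]; simpl; [|rewrite Cmod_1; lra]. pose proof (acts_le 0 v). lra. }
  generalize dependent (actC (acts lam n 0)). intros w Hw.
  replace (2 ^ n) with (INR (length (subsets n))).
  2:{ rewrite subsets_card, pow_INR. reflexivity. }
  induction (subsets n) as [|s l IH]; cbn [map asum fold_right length].
  { unfold Cminus. rewrite Cplus_opp_r, Cmod_0. simpl. lra. }
  fold (asum C 0 Cplus).
  change (fold_right Cplus 0 ?l) with (asum C 0 Cplus l).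
  set (A := asum C _ _ _) in *. set (B := asum C _ _ _) in IH |- *.
  replace (eprodC (map (perturb d) E) s * vprodC w 0 s + A - (eprodC E s * vprodC w 0 s + B))%C
    with ((eprodC (map (perturb d) E) s - eprodC E s) * vprodC w 0 s + (A - B))%C by ring.
  etransitivity; [apply Cmod_triangle|]. rewrite Cmod_mult, S_INR.
  pose proof (eprod_perturb d s E Hd Hb) as H1. pose proof (vprod_le1 w 0 s Hw) as H2.
  pose proof (Cmod_ge_0 (vprodC w 0 s)). pose proof (Cmod_ge_0 (eprodC (map (perturb d) E) s - eprodC E s)%C).
  assert (Cmod (eprodC (map (perturb d) E) s - eprodC E s)%C * Cmod (vprodC w 0 s) <= INR (length E) * d * 1)
    by (apply Rmult_le_compat; lra).
  lra.
Qed.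

Lemma approx_small E m d eps : loopless n E -> beta_ok E -> 0 < eps < 1 ->
  INR n * (r ^ S m / (1 - r) / (1 - r)) <= eps / 4 ->
  0 < d <= 1 -> 2 ^ n * (INR (length E) * d) <= eps / 4 * (1 - r) ^ n ->
  Cmod (prodf (factor (map (perturb d) E) m) n - Z_from E 0)%C <= eps * Cmod (Z_from E 0).
Proof.
  intros HE Hb He Hm Hd Hdd.
  pose proof (prodf_approx (map (perturb d) E) m eps (loopless_perturb d E HE)
    (perturb_ok d E Hd Hb) (perturb_neq_0 d E (proj1 Hd)) He Hm) as H1.
  pose proof (Z_from_perturb d E Hd Hb) as H2.
  pose proof (Z_from_lower E 0 HE Hb ltac:(lia)) as H3. rewrite Nat.sub_0_r in H3.
  set (P := prodf _ n) in *. set (Z' := Z_from (map (perturb d) E) 0) in *. set (Z := Z_from E 0) in *.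
  assert (H4 : Cmod (Z' - Z)%C <= eps / 4 * Cmod Z) by nra.
  replace (P - Z)%C with ((P - Z') + (Z' - Z))%C by ring.
  etransitivity; [apply Cmod_triangle|].
  assert (H5 : Cmod Z' <= Cmod Z + Cmod (Z' - Z)%C).
  { replace Z' with (Z + (Z' - Z))%C at 1 by ring. apply Cmod_triangle. }
  pose proof (Cmod_ge_0 Z).
  (* In fact |Z'| <= (1 + eps / 4) |Z| <= 5/4 |Z|, and the total relative error is eps (5/8 + 1/4) <
     eps. *)
  assert (Cmod Z' <= 2 * Cmod Z) by nra.
  assert (eps / 2 * Cmod Z' <= eps / 2 * (5 / 4 * Cmod Z)) by (apply Rmult_le_compat_l; nra).
  nra.
Qed.
End Approx.

(** * The partition function of the statement and the inversion of the activity *)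

Lemma vprod_const z w k s :
  vprod C (RtoC 1) Cmult (fun v h => z * w v h)%C k s = (z ^ length s * vprod C (RtoC 1) Cmult w k s)%C.
Proof. revert k; induction s as [|h s IH]; intros k; simpl; [ring|]. rewrite IH. ring. Qed.

Lemma ising_Z_ZC n E (lam : C) : ising_Z n E lam = ZC n E (actC (fun _ => lam)).
Proof.
  unfold ising_Z, Zg, Csum, asum. f_equal. apply map_ext. intros s. f_equal.
  - unfold Cprod. induction E as [|e E IH]; simpl; [reflexivity|]. rewrite IH. reflexivity.
  - generalize 0%nat. induction s as [|h s IH]; intros k; simpl; [reflexivity|].
    destruct h; simpl; rewrite (IH (S k)); unfold act; ring.
Qed.

Lemma ising_Z_from n E (lam : C) : ising_Z n E lam = Z_from lam n E 0.
Proof.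
  rewrite ising_Z_ZC. unfold Z_from, Zg. apply asum_ext. intros s Hs. f_equal.
  apply subsets_length in Hs.
  assert (H : forall k, (k + length s <= n)%nat ->
    vprod C (RtoC 1) Cmult (actC (fun _ => lam)) k s = vprod C (RtoC 1) Cmult (actC (acts lam n 0)) k s).
  { clear Hs. induction s as [|h s IH]; intros k Hk; simpl in *; [reflexivity|].
    rewrite IH by lia. f_equal. unfold act, acts. destruct (Nat.ltb_spec k n); [reflexivity|lia]. }
  apply H. lia.
Qed.

(** Complementation turns the vertex weights (1, lam) into (lam, 1), which is lam times (1, 1 /
    lam). *)
Lemma ising_Z_inv n E (lam : C) : loopless n E -> lam <> 0 ->
  ising_Z n E lam = (lam ^ n * ising_Z n E (/ lam))%C.
Proof.
  intros HE Hl. rewrite !ising_Z_ZC.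
  rewrite (Zg_compl C _ _ _ _ _ _ C_th) by assumption.
  unfold Zg. rewrite <- (asum_scal C _ _ _ _ _ _ C_th). apply asum_ext. intros s Hs.
  apply subsets_length in Hs. rewrite <- Hs.
  rewrite Cmult_assoc, (Cmult_comm (lam ^ _)), <- Cmult_assoc. f_equal.
  rewrite <- vprod_const. apply vprod_ext. intros x h _. unfold act.
  destruct h; simpl; field; assumption.
Qed.

(** * A structured language and its compiler *)

Inductive expr : Type :=
| ECst (z : Z)
| EVar (a : nat)
| EArr (a : nat) (e : expr)
| EAdd (e1 e2 : expr)
| ESub (e1 e2 : expr)
| EMul (e1 e2 : expr)
| EDiv (e1 e2 : expr).

Inductive cond : Type := CEq (e1 e2 : expr) | CLt (e1 e2 : expr).

Inductive stmt : Type :=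
| SSkip
| SSet (a : nat) (e : expr)
| SArr (a : nat) (e1 e2 : expr)
| SSeq (s1 s2 : stmt)
| SIf (c : cond) (s1 s2 : stmt)
| SWhile (c : cond) (s : stmt).

(* [st a i] is the value of array [a] at index [i]; a scalar variable is index 0 of its array. *)
Definition state := nat -> nat -> C.

(* Kept apart from [Nat.eqb] so that lookups reduce on array names but not on indices. *)
Definition ieq : nat -> nat -> bool := Nat.eqb.

Definition up (st : state) (a i : nat) (z : C) : state :=
  fun a' i' => if (Nat.eqb a' a && ieq i' i)%bool then z else st a' i'.

Definition CN (k : nat) : C := RtoC (INR k).

(** A relation, since a division by zero and an index that is not a natural number have no value, as
    on the machine. *)
Inductive ev (st : state) : expr -> C -> Prop :=
| ev_cst z : ev st (ECst z) (RtoC (IZR z))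
| ev_var a : ev st (EVar a) (st a O)
| ev_arr a e k : ev st e (CN k) -> ev st (EArr a e) (st a k)
| ev_add e1 e2 x y : ev st e1 x -> ev st e2 y -> ev st (EAdd e1 e2) (x + y)%C
| ev_sub e1 e2 x y : ev st e1 x -> ev st e2 y -> ev st (ESub e1 e2) (x - y)%C
| ev_mul e1 e2 x y : ev st e1 x -> ev st e2 y -> ev st (EMul e1 e2) (x * y)%C
| ev_div e1 e2 x y : ev st e1 x -> ev st e2 y -> y <> RtoC 0 -> ev st (EDiv e1 e2) (x * / y)%C.

Inductive cv (st : state) : cond -> bool -> Prop :=
| cv_eq_t e1 e2 x : ev st e1 x -> ev st e2 x -> cv st (CEq e1 e2) true
| cv_eq_f e1 e2 x y : ev st e1 x -> ev st e2 y -> x <> y -> cv st (CEq e1 e2) false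
| cv_lt_t e1 e2 x y : ev st e1 x -> ev st e2 y -> Re x < Re y -> cv st (CLt e1 e2) true
| cv_lt_f e1 e2 x y : ev st e1 x -> ev st e2 y -> ~ Re x < Re y -> cv st (CLt e1 e2) false.

(** Arrays have numbers below 48 and array [a] at index [i] sits at 64 i + a, so addresses 48 to 63
    are left for the expression stack. *)
Definition tmp (d : nat) : nat := (48 + d)%nat.

Definition caddr (a d d' : nat) : list instr :=
  [ICst (tmp d') 64; IMul (tmp d) (tmp d) (tmp d'); ICst (tmp d') (Z.of_nat a);
   IAdd (tmp d) (tmp d) (tmp d')].

(** The value is left in stack cell [d], and only cells from [d] on are touched. There is no move
    instruction; a copy is an addition to 0. *)
Fixpoint ce (e : expr) (d : nat) : list instr :=
  match e with
  | ECst z => [ICst (tmp d) z]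
  | EVar a => [ICst (tmp d) 0; IAdd (tmp d) (tmp d) a]
  | EArr a e => ce e d ++ caddr a d (S d) ++ [ILoad (tmp d) (tmp d)]
  | EAdd e1 e2 => ce e1 d ++ ce e2 (S d) ++ [IAdd (tmp d) (tmp d) (tmp (S d))]
  | ESub e1 e2 => ce e1 d ++ ce e2 (S d) ++ [ISub (tmp d) (tmp d) (tmp (S d))]
  | EMul e1 e2 => ce e1 d ++ ce e2 (S d) ++ [IMul (tmp d) (tmp d) (tmp (S d))]
  | EDiv e1 e2 => ce e1 d ++ ce e2 (S d) ++ [IDiv (tmp d) (tmp d) (tmp (S d))]
  end.

Fixpoint wfe (e : expr) (d : nat) : bool :=
  match e with
  | ECst _ => Nat.ltb d 16
  | EVar a => (Nat.ltb d 16 && Nat.ltb a 48)%bool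
  | EArr a e => (wfe e d && Nat.ltb a 48 && Nat.ltb (S d) 16)%bool
  | EAdd e1 e2 | ESub e1 e2 | EMul e1 e2 | EDiv e1 e2 => (wfe e1 d && wfe e2 (S d))%bool
  end.

Fixpoint esz (e : expr) : nat :=
  match e with
  | ECst _ => 1
  | EVar _ => 2
  | EArr _ e => esz e + 5
  | EAdd e1 e2 | ESub e1 e2 | EMul e1 e2 | EDiv e1 e2 => esz e1 + esz e2 + 1
  end.

Definition cargs (c : cond) : expr * expr :=
  match c with CEq e1 e2 | CLt e1 e2 => (e1, e2) end.
Definition cjump (c : cond) (t : nat) : instr :=
  match c with CEq _ _ => IJeq (tmp 0) (tmp 1) t | CLt _ _ => IJlt (tmp 0) (tmp 1) t end.
Definition cc (c : cond) (t : nat) : list instr :=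
  ce (fst (cargs c)) 0 ++ ce (snd (cargs c)) 1 ++ [cjump c t].
Definition csz (c : cond) : nat := (esz (fst (cargs c)) + esz (snd (cargs c)) + 1)%nat.
Definition wfc (c : cond) : bool := (wfe (fst (cargs c)) 0 && wfe (snd (cargs c)) 1)%bool.

Fixpoint ssz (s : stmt) : nat :=
  match s with
  | SSkip => 0
  | SSet _ e => esz e + 2
  | SArr _ e1 e2 => esz e1 + esz e2 + 5
  | SSeq s1 s2 => ssz s1 + ssz s2
  | SIf c s1 s2 => csz c + ssz s2 + 1 + ssz s1
  | SWhile c s => csz c + 1 + ssz s + 1
  end.

(** Jump targets are absolute, hence the argument [pc] and the separate size function. The else
    branch is placed first, because the conditional jump is taken when the test holds. *)
Fixpoint cs (s : stmt) (pc : nat) : list instr :=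
  match s with
  | SSkip => []
  | SSet a e => ce e 0 ++ [ICst a 0; IAdd a a (tmp 0)]
  | SArr a e1 e2 => ce e1 0 ++ ce e2 1 ++ caddr a 0 2 ++ [IStore (tmp 0) (tmp 1)]
  | SSeq s1 s2 => cs s1 pc ++ cs s2 (pc + ssz s1)
  | SIf c s1 s2 =>
      cc c (pc + csz c + ssz s2 + 1) ++ cs s2 (pc + csz c) ++
      [IJmp (pc + csz c + ssz s2 + 1 + ssz s1)] ++ cs s1 (pc + csz c + ssz s2 + 1)
  | SWhile c s =>
      cc c (pc + csz c + 1) ++ [IJmp (pc + csz c + 1 + ssz s + 1)] ++
      cs s (pc + csz c + 1) ++ [IJmp pc]
  end.

Fixpoint wfs (s : stmt) : bool :=
  match s with
  | SSkip => true
  | SSet a e => (wfe e 0 && Nat.ltb a 48)%bool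
  | SArr a e1 e2 => (wfe e1 0 && wfe e2 1 && Nat.ltb a 48)%bool
  | SSeq s1 s2 => (wfs s1 && wfs s2)%bool
  | SIf c s1 s2 => (wfc c && wfs s1 && wfs s2)%bool
  | SWhile c s => (wfc c && wfs s)%bool
  end.

(** The number is the exact count of machine steps of the compiled code; the isolated ones are the
    unconditional jumps after an else branch, out of a loop and back to its test. *)
Inductive run : stmt -> state -> nat -> state -> Prop :=
| r_skip st : run SSkip st 0 st
| r_set st a e v : ev st e v -> run (SSet a e) st (esz e + 2) (up st a 0 v)
| r_arr st a e1 e2 k v : ev st e1 (CN k) -> ev st e2 v ->
    run (SArr a e1 e2) st (esz e1 + esz e2 + 5) (up st a k v)
| r_seq s1 s2 st t1 st1 t2 st2 : run s1 st t1 st1 -> run s2 st1 t2 st2 ->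
    run (SSeq s1 s2) st (t1 + t2) st2
| r_if_t c s1 s2 st t st' : cv st c true -> run s1 st t st' ->
    run (SIf c s1 s2) st (csz c + t) st'
| r_if_f c s1 s2 st t st' : cv st c false -> run s2 st t st' ->
    run (SIf c s1 s2) st (csz c + (t + 1)) st'
| r_while_f c s st : cv st c false -> run (SWhile c s) st (csz c + 1) st
| r_while_t c s st t st1 t' st2 : cv st c true -> run s st t st1 ->
    run (SWhile c s) st1 t' st2 -> run (SWhile c s) st (csz c + (t + (1 + t'))) st2.

(** * Correctness of the compiler *)

Definition code_at (P : program) (pc : nat) (l : list instr) : Prop :=
  forall i x, nth_error l i = Some x -> nth_error P (pc + i) = Some x.

Lemma code_at_app P pc l1 l2 : code_at P pc (l1 ++ l2) ->
  code_at P pc l1 /\ code_at P (pc + length l1) l2.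
Proof.
  intros H; split; intros i x Hi.
  - apply H. rewrite nth_error_app1; [assumption|]. apply nth_error_Some. congruence.
  - rewrite <- Nat.add_assoc. apply H. rewrite nth_error_app2 by lia.
    rewrite <- Hi. f_equal. lia.
Qed.

Lemma code_at_cons P pc x l : code_at P pc (x :: l) ->
  nth_error P pc = Some x /\ code_at P (S pc) l.
Proof.
  intros H; split.
  - rewrite <- (Nat.add_0_r pc). apply H. reflexivity.
  - intros i y Hi. replace (S pc + i)%nat with (pc + S i)%nat by lia. apply H. assumption.
Qed.

Lemma exec_trans P c t c' t' c'' : exec P c t c' -> exec P c' t' c'' -> exec P c (t + t') c''.
Proof. induction 1; simpl; intros; [assumption|]. econstructor; eauto. Qed.

Lemma exec_1 P c c' : step P c c' -> exec P c 1 c'.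
Proof. intros H. econstructor; [eassumption|constructor]. Qed.

Lemma ce_length e d : length (ce e d) = esz e.
Proof. revert d; induction e; intros d; simpl; rewrite ?length_app, ?IHe, ?IHe1, ?IHe2; simpl; lia. Qed.

Lemma cc_length c t : length (cc c t) = csz c.
Proof. unfold cc, csz. rewrite !length_app, !ce_length. simpl. lia. Qed.

Lemma cs_length s pc : length (cs s pc) = ssz s.
Proof.
  revert pc; induction s; intros pc; cbn [cs ssz];
    rewrite ?length_app, ?ce_length, ?cc_length, ?IHs, ?IHs1, ?IHs2; simpl; try lia;
    rewrite ?length_app, ?ce_length, ?cc_length, ?IHs, ?IHs1, ?IHs2; simpl; lia.
Qed.

Definition repr (st : state) (m : memory) : Prop :=
  forall a i, (a < 48)%nat -> m (64 * i + a)%nat = st a i.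

(** Stack cells below [d] count as memory to be preserved: that is what keeps a left operand alive
    while the right one is evaluated. *)
Definition low_eq (d : nat) (m m' : memory) : Prop :=
  forall x, (tmp d <= x < 64)%nat \/ m' x = m x.

Lemma low_eq_trans d d' m m' m'' : (d <= d')%nat -> low_eq d m m' -> low_eq d' m' m'' -> low_eq d m m''.
Proof.
  intros Hd H1 H2 x. destruct (H1 x) as [?|E1]; [now left|].
  destruct (H2 x) as [?|E2]; [left; unfold tmp in *; lia|right; congruence].
Qed.

Lemma low_eq_upd d d' m z : (d <= d' < 16)%nat -> low_eq d m (upd m (tmp d') z).
Proof.
  intros Hd x. unfold upd. destruct (Nat.eqb_spec x (tmp d')) as [->|]; [left; unfold tmp; lia|now right].
Qed.

Lemma low_eq_repr d st m m' : low_eq d m m' -> repr st m -> repr st m'.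
Proof.
  intros H Hr a i Ha. destruct (H (64 * i + a)%nat) as [Hx|Hx].
  - unfold tmp in Hx. lia.
  - rewrite Hx. apply Hr. assumption.
Qed.

Lemma upd_same m a z : upd m a z a = z.
Proof. unfold upd. rewrite Nat.eqb_refl. reflexivity. Qed.

Lemma upd_diff m a b z : b <> a -> upd m a z b = m b.
Proof. intros H. unfold upd. destruct (Nat.eqb_spec b a); congruence. Qed.

Lemma tmp_neq d d' : d <> d' -> tmp d <> tmp d'.
Proof. unfold tmp; lia. Qed.

Lemma CN_addr k a : (RtoC (IZR 64) * CN k + RtoC (IZR (Z.of_nat a)) = CN (64 * k + a))%C.
Proof.
  unfold CN. rewrite <- RtoC_mult, <- RtoC_plus. f_equal.
  rewrite plus_INR, mult_INR, <- (INR_IZR_INZ a). f_equal. f_equal. simpl. lra.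
Qed.

Ltac code H :=
  repeat match type of H with
  | code_at _ _ (_ ++ _) => let H1 := fresh "Hc" in apply code_at_app in H; destruct H as [H1 H]
  end.

Lemma caddr_correct P pc m a d d' k : code_at P pc (caddr a d d') -> d <> d' ->
  (d < 16)%nat -> (d' < 16)%nat -> m (tmp d) = CN k ->
  exists m', exec P (pc, m) 4 ((pc + 4)%nat, m') /\ m' (tmp d) = CN (64 * k + a) /\
    (forall x, x <> tmp d -> x <> tmp d' -> m' x = m x).
Proof.
  intros Hc Hd H1 H2 Hm. unfold caddr in Hc.
  apply code_at_cons in Hc; destruct Hc as [C1 Hc].
  apply code_at_cons in Hc; destruct Hc as [C2 Hc].
  apply code_at_cons in Hc; destruct Hc as [C3 Hc].
  apply code_at_cons in Hc; destruct Hc as [C4 Hc].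
  pose proof (tmp_neq d d' Hd) as Hn. pose proof (not_eq_sym Hn) as Hn'.
  eexists. split; [|split].
  - eapply ex_step; [apply st_cst; eassumption|].
    eapply ex_step; [apply st_mul; eassumption|].
    eapply ex_step; [apply st_cst; eassumption|].
    eapply ex_step; [apply st_add; eassumption|].
    replace (pc + 4)%nat with (S (S (S (S pc)))) by lia. apply ex_refl.
  - repeat (rewrite upd_same || rewrite upd_diff by assumption). rewrite Hm.
    rewrite (Cmult_comm (CN k)). apply CN_addr.
  - intros x Hx Hx'. rewrite !upd_diff by assumption. reflexivity.
Qed.

Lemma low_eq_S d m m' : low_eq (S d) m m' -> low_eq d m m'.
Proof. intros H x. destruct (H x) as [Hx|Hx]; [left; unfold tmp in *; lia|now right]. Qed.

Lemma wfe_lt e d : wfe e d = true -> (d < 16)%nat.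
Proof.
  revert d; induction e; intros d; simpl; rewrite ?Bool.andb_true_iff, ?Nat.ltb_lt; intros;
    intuition.
Qed.

Definition ce_ok (P : program) (st : state) (e : expr) (v : C) : Prop :=
  forall d pc m, wfe e d = true -> code_at P pc (ce e d) -> repr st m ->
  exists m', exec P (pc, m) (esz e) ((pc + esz e)%nat, m') /\ m' (tmp d) = v /\ low_eq d m m'.

Lemma ce_pair P st e1 e2 x y : ce_ok P st e1 x -> ce_ok P st e2 y ->
  forall d pc m l, wfe e1 d = true -> wfe e2 (S d) = true ->
  code_at P pc (ce e1 d ++ ce e2 (S d) ++ l) -> repr st m ->
  exists m', exec P (pc, m) (esz e1 + esz e2) ((pc + (esz e1 + esz e2))%nat, m') /\
    m' (tmp d) = x /\ m' (tmp (S d)) = y /\ low_eq d m m' /\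
    code_at P (pc + (esz e1 + esz e2)) l.
Proof.
  intros IH1 IH2 d pc m l W1 W2 Hc Hr. code Hc. rewrite ?ce_length in *.
  destruct (IH1 d pc m W1 Hc0 Hr) as (m1 & E1 & V1 & L1).
  destruct (IH2 (S d) _ m1 W2 Hc1 (low_eq_repr _ _ _ _ L1 Hr)) as (m2 & E2 & V2 & L2).
  apply wfe_lt in W2. exists m2. rewrite Nat.add_assoc. split; [|split; [|split; [|split]]].
  - eapply exec_trans; eassumption.
  - rewrite <- V1. destruct (L2 (tmp d)) as [Hx|Hx]; [unfold tmp in Hx; lia|assumption].
  - assumption.
  - eapply low_eq_trans; [reflexivity|exact L1|]. apply low_eq_S. assumption.
  - assumption.
Qed.

Lemma ce_correct P st e v : ev st e v -> ce_ok P st e v.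
Proof.
  induction 1 as [z|a|a e k He IH|e1 e2 x y H1 IH1 H2 IH2|e1 e2 x y H1 IH1 H2 IH2
    |e1 e2 x y H1 IH1 H2 IH2|e1 e2 x y H1 IH1 H2 IH2 Hy]; intros d pc m Hw Hc Hr;
    pose proof (wfe_lt _ _ Hw) as Hlt; simpl in Hw.
  4-7: apply andb_prop in Hw; destruct Hw as [W1 W2];
    destruct (ce_pair P st e1 e2 x y IH1 IH2 d pc m _ W1 W2 Hc Hr) as (m2 & E & V1 & V2 & L & C);
    apply code_at_cons in C; destruct C as [C _]; simpl esz;
    eexists; split; [eapply exec_trans; [eassumption|];
      replace (pc + (esz e1 + esz e2 + 1))%nat with (S (pc + (esz e1 + esz e2))) by lia; apply exec_1;
      (apply st_add + apply st_sub + apply st_mul + (apply st_div; [|rewrite V2])); eassumption|];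
    split; [rewrite upd_same, V1, V2; reflexivity|
      eapply low_eq_trans; [reflexivity|exact L|apply low_eq_upd; lia]].
  - simpl in Hc. apply code_at_cons in Hc. destruct Hc as [Hc _].
    eexists; split; [|split].
    + replace (pc + esz (ECst z))%nat with (S pc) by (simpl; lia). apply exec_1, st_cst, Hc.
    + apply upd_same.
    + apply low_eq_upd. lia.
  - apply andb_prop in Hw. destruct Hw as [Hd Ha]. apply Nat.ltb_lt in Hd, Ha.
    simpl in Hc. apply code_at_cons in Hc. destruct Hc as [C1 Hc].
    apply code_at_cons in Hc. destruct Hc as [C2 _].
    eexists; split; [|split].
    + replace (pc + esz (EVar a))%nat with (S (S pc)) by (simpl; lia).
      eapply ex_step; [apply st_cst; eassumption|]. apply exec_1, st_add, C2.
    + rewrite upd_same, upd_same, upd_diff by (unfold tmp; lia).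
      specialize (Hr a O Ha). simpl in Hr. rewrite Hr. ring.
    + apply (low_eq_trans d d) with (m' := upd m (tmp d) (RtoC 0)); [lia|apply low_eq_upd; lia|apply low_eq_upd; lia].
  - apply andb_prop in Hw. destruct Hw as [Hw Hd]. apply andb_prop in Hw. destruct Hw as [Hw Ha].
    apply Nat.ltb_lt in Hd, Ha. cbn [ce] in Hc. code Hc. rewrite ?ce_length in *.
    destruct (IH d pc m Hw Hc0 Hr) as (m1 & E1 & V1 & L1).
    destruct (caddr_correct P (pc + esz e) m1 a d (S d) k) as (m2 & E2 & V2 & L2);
      try assumption; try lia.
    apply code_at_cons in Hc. destruct Hc as [C3 _]. simpl length in C3.
    eexists; split; [|split].
    + change (esz (EArr a e)) with (esz e + 5)%nat. replace (esz e + 5)%nat with (esz e + (4 + 1))%nat by lia.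
      eapply exec_trans; [eassumption|]. eapply exec_trans; [eassumption|].
      replace (pc + (esz e + (4 + 1)))%nat with (S (pc + esz e + 4)) by lia.
      apply exec_1. eapply st_load; [eassumption|exact V2].
    + rewrite upd_same.
      assert (Hr1 : repr st m1) by (eapply low_eq_repr; eassumption).
      rewrite L2 by (unfold tmp; lia). apply Hr1. assumption.
    + eapply low_eq_trans; [reflexivity|exact L1|].
      eapply low_eq_trans; [reflexivity| |apply low_eq_upd; lia].
      intros x. destruct (Nat.eq_dec x (tmp d)); [left; unfold tmp in *; lia|].
      destruct (Nat.eq_dec x (tmp (S d))); [left; unfold tmp in *; lia|]. right. auto.
Qed.

Lemma cc_correct P st c b pc m t : cv st c b -> wfc c = true -> code_at P pc (cc c t) -> repr st m ->
  exists m', exec P (pc, m) (csz c) ((if b then t else pc + csz c)%nat, m') /\ repr st m'.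
Proof.
  intros Hv Hw Hc Hr. unfold wfc in Hw. apply andb_prop in Hw. destruct Hw as [W1 W2].
  unfold csz, cc in *.
  destruct Hv as [e1 e2 x H1 H2|e1 e2 x y H1 H2 Hn|e1 e2 x y H1 H2 Hn|e1 e2 x y H1 H2 Hn];
    simpl fst in *; simpl snd in *; simpl cjump in *;
    destruct (ce_pair P st e1 e2 _ _ (ce_correct P st _ _ H1) (ce_correct P st _ _ H2) 0 pc m _ W1 W2 Hc Hr)
      as (m2 & E & V1 & V2 & L & C);
    apply code_at_cons in C; destruct C as [C _];
    exists m2; (split; [eapply exec_trans; [eassumption|]|eapply low_eq_repr; eassumption]);
    replace (pc + (esz e1 + esz e2 + 1))%nat with (S (pc + (esz e1 + esz e2))) by lia; apply exec_1.
  - eapply st_jeq_t; [eassumption|congruence].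
  - eapply st_jeq_f; [eassumption|congruence].
  - eapply st_jlt_t; [eassumption|congruence].
  - eapply st_jlt_f; [eassumption|congruence].
Qed.

Lemma repr_upd st m a i z : (a < 48)%nat -> repr st m -> repr (up st a i z) (upd m (64 * i + a) z).
Proof.
  intros Ha Hr b j Hb. unfold upd, up, ieq.
  destruct (Nat.eqb_spec (64 * j + b) (64 * i + a)).
  - assert (j = i /\ b = a) as [-> ->] by lia. rewrite !Nat.eqb_refl. reflexivity.
  - destruct (Nat.eqb_spec b a), (Nat.eqb_spec j i); simpl; try (apply Hr; assumption).
    subst; contradiction.
Qed.

Theorem cs_correct P s st t st' : run s st t st' -> forall pc m, wfs s = true ->
  code_at P pc (cs s pc) -> repr st m ->
  exists m', exec P (pc, m) t ((pc + ssz s)%nat, m') /\ repr st' m'.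
Proof.
  induction 1 as [st|st a e v He|st a e1 e2 k v H1 H2|s1 s2 st t1 st1 t2 st2 H1 IH1 H2 IH2
    |c s1 s2 st t st' Hv H IH|c s1 s2 st t st' Hv H IH|c s st Hv|c s st t st1 t' st2 Hv H1 IH1 H2 IH2];
    intros pc m Hw Hc Hr; cbn [wfs cs ssz] in *.
  - exists m. rewrite Nat.add_0_r. split; [constructor|assumption].
  - apply andb_prop in Hw. destruct Hw as [W Ha]. apply Nat.ltb_lt in Ha. code Hc.
    rewrite ce_length in Hc.
    destruct (ce_correct P st e v He O pc m W Hc0 Hr) as (m1 & E1 & V1 & L1).
    apply code_at_cons in Hc. destruct Hc as [C1 Hc]. apply code_at_cons in Hc. destruct Hc as [C2 _].
    eexists. split.
    + eapply exec_trans; [eassumption|].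
      replace (pc + (esz e + 2))%nat with (S (S (pc + esz e))) by lia.
      eapply ex_step; [apply st_cst; eassumption|]. apply exec_1, st_add. eassumption.
    + rewrite upd_same, upd_diff, V1 by (unfold tmp; lia).
      replace (RtoC 0 + v)%C with v by ring.
      replace (upd (upd m1 a (RtoC 0)) a v) with (upd m1 (64 * 0 + a) v).
      * apply repr_upd; [assumption|]. eapply low_eq_repr; eassumption.
      * extensionality x. unfold upd. simpl. destruct (Nat.eqb x a); reflexivity.
  - apply andb_prop in Hw. destruct Hw as [W Ha]. apply Nat.ltb_lt in Ha.
    apply andb_prop in W. destruct W as [W1 W2].
    destruct (ce_pair P st e1 e2 _ _ (ce_correct P st _ _ H1) (ce_correct P st _ _ H2) 0 pc m _ W1 W2 Hc Hr)
      as (m2 & E & V1 & V2 & L & C). code C.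
    destruct (caddr_correct P _ m2 a 0 2 k Hc0) as (m3 & E3 & V3 & L3); try lia; try assumption.
    apply code_at_cons in C. destruct C as [C _]. simpl length in C.
    eexists. split.
    + replace (esz e1 + esz e2 + 5)%nat with (esz e1 + esz e2 + (4 + 1))%nat by lia.
      eapply exec_trans; [eassumption|]. eapply exec_trans; [eassumption|].
      replace (pc + (esz e1 + esz e2 + (4 + 1)))%nat with (S (pc + (esz e1 + esz e2) + 4)) by lia.
      apply exec_1. eapply st_store; [eassumption|exact V3].
    + rewrite L3 by (unfold tmp; lia). rewrite V2. apply repr_upd; [assumption|].
      assert (Hr2 : repr st m2) by (eapply low_eq_repr; eassumption).
      intros b j Hb. rewrite L3 by (unfold tmp; lia). apply Hr2. assumption.
  - apply andb_prop in Hw. destruct Hw as [W1 W2]. code Hc. rewrite cs_length in Hc.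
    destruct (IH1 pc m W1 Hc0 Hr) as (m1 & E1 & R1).
    destruct (IH2 _ m1 W2 Hc R1) as (m2 & E2 & R2).
    exists m2. rewrite Nat.add_assoc. split; [eapply exec_trans; eassumption|assumption].
  - apply andb_prop in Hw. destruct Hw as [Hw W2]. apply andb_prop in Hw. destruct Hw as [Wc W1].
    code Hc. rewrite ?cc_length, ?cs_length in *. simpl length in Hc.
    destruct (cc_correct P st c true pc m _ Hv Wc Hc0 Hr) as (m1 & E1 & R1).
    destruct (IH _ m1 W1 Hc R1) as (m2 & E2 & R2).
    exists m2. split; [|assumption]. eapply exec_trans; [eassumption|].
    rewrite !Nat.add_assoc. assumption.
  - apply andb_prop in Hw. destruct Hw as [Hw W2]. apply andb_prop in Hw. destruct Hw as [Wc W1].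
    code Hc. rewrite ?cc_length, ?cs_length in *.
    destruct (cc_correct P st c false pc m _ Hv Wc Hc0 Hr) as (m1 & E1 & R1).
    destruct (IH _ m1 W2 Hc1 R1) as (m2 & E2 & R2).
    apply code_at_cons in Hc2. destruct Hc2 as [C _].
    exists m2. split; [|assumption]. eapply exec_trans; [eassumption|].
    eapply exec_trans; [eassumption|]. rewrite !Nat.add_assoc. apply exec_1, st_jmp, C.
  - apply andb_prop in Hw. destruct Hw as [Wc W1]. code Hc. rewrite ?cc_length, ?cs_length in *.
    destruct (cc_correct P st c false pc m _ Hv Wc Hc0 Hr) as (m1 & E1 & R1).
    apply code_at_cons in Hc1. destruct Hc1 as [C _].
    exists m1. split; [|assumption]. eapply exec_trans; [eassumption|].
    rewrite !Nat.add_assoc. apply exec_1, st_jmp, C.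
  - pose proof Hc as Hloop. pose proof Hw as Hww.
    apply andb_prop in Hw. destruct Hw as [Wc W1]. code Hc. rewrite ?cc_length, ?cs_length in *.
    simpl length in *.
    destruct (cc_correct P st c true pc m _ Hv Wc Hc0 Hr) as (m1 & E1 & R1).
    destruct (IH1 _ m1 W1 Hc2 R1) as (m2 & E2 & R2).
    destruct (IH2 pc m2 Hww Hloop R2) as (m3 & E3 & R3).
    apply code_at_cons in Hc. destruct Hc as [C _].
    exists m3. split; [|assumption]. eapply exec_trans; [eassumption|].
    eapply exec_trans; [eassumption|]. eapply exec_trans; [|eassumption].
    apply exec_1, st_jmp, C.
Qed.

(** * Freeing the low registers *)

(* The input leaves no free register with a fixed address.  The four parameters are parked at
   512 M, ..., 512 M + 3, an address computed in place by doublings; then cell i moves to 64 i, from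
   the top down, which makes the input array number 0.  The test eps < M detects M = 0. *)
Definition boot : list instr :=
  [IJlt 3 1 7; ICst 6 0; IAdd 5 2 6; IAdd 4 3 6; IAdd 1 0 6; ICst 2 0; IJmp 52;
   IAdd 1 1 1; IAdd 1 1 1; IAdd 1 1 1; IAdd 1 1 1; IAdd 1 1 1; IAdd 1 1 1; IAdd 1 1 1; IAdd 1 1 1; IAdd 1 1 1;
   IStore 1 3; ICst 3 1; IAdd 1 1 3; IStore 1 2; IAdd 1 1 3; IStore 1 0;
   ICst 3 2; ISub 2 1 3; ICst 3 512; IDiv 2 2 3; ICst 3 1; IAdd 1 1 3; IStore 1 2;
   ICst 3 3; IMul 2 2 3; IAdd 2 2 3;
   ICst 3 3; IJlt 3 2 35; IJmp 42; ILoad 0 2; ICst 3 64; IMul 3 3 2; IStore 3 0; ICst 3 1; ISub 2 2 3; IJmp 32;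
   ILoad 2 1; ICst 3 1; ISub 1 1 3; ILoad 0 1; ISub 1 1 3; ILoad 5 1; ISub 1 1 3; ILoad 4 1; ICst 6 0; IAdd 1 0 6].

Ltac cnorm :=
  unfold is_index, CN; rewrite ?INR_IZR_INZ; rewrite <- ?RtoC_plus, <- ?RtoC_minus, <- ?RtoC_mult;
  rewrite <- ?plus_IZR, <- ?minus_IZR, <- ?mult_IZR; apply f_equal, f_equal; lia.

Ltac rd := repeat (rewrite upd_same || rewrite upd_diff by lia).

Lemma step_add P pc m a b c z : nth_error P pc = Some (IAdd a b c) -> (m b + m c)%C = z ->
  step P (pc, m) (S pc, upd m a z).
Proof. intros; subst; apply st_add; assumption. Qed.

Lemma step_sub P pc m a b c z : nth_error P pc = Some (ISub a b c) -> (m b - m c)%C = z ->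
  step P (pc, m) (S pc, upd m a z).
Proof. intros; subst; apply st_sub; assumption. Qed.

Lemma step_mul P pc m a b c z : nth_error P pc = Some (IMul a b c) -> (m b * m c)%C = z ->
  step P (pc, m) (S pc, upd m a z).
Proof. intros; subst; apply st_mul; assumption. Qed.

Lemma step_store P pc m a b k z : nth_error P pc = Some (IStore a b) -> m a = CN k -> m b = z ->
  step P (pc, m) (S pc, upd m k z).
Proof. intros; subst; eapply st_store; eassumption. Qed.

Lemma step_load P pc m a b k z : nth_error P pc = Some (ILoad a b) -> m b = CN k -> m k = z ->
  step P (pc, m) (S pc, upd m a z).
Proof. intros; subst; eapply st_load; eassumption. Qed.

Ltac stp tac := eapply ex_step; [tac; reflexivity|].
Ltac next_cst := eapply ex_step; [apply st_cst; reflexivity|].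
Ltac next_add z := eapply ex_step; [eapply (step_add _ _ _ _ _ _ z); [reflexivity|rd; cnorm]|].
Ltac next_sub z := eapply ex_step; [eapply (step_sub _ _ _ _ _ _ z); [reflexivity|rd; cnorm]|].
Ltac next_store k z tac :=
  eapply ex_step; [eapply (step_store _ _ _ _ _ k z); [reflexivity|rd; reflexivity|tac; rd; auto]|].
Ltac next_load k z := eapply ex_step; [eapply (step_load _ _ _ _ _ k z); [reflexivity|rd; auto|rd; auto]|].

Section Boot.
Variables (rest : list instr) (m0 : memory) (M : nat).
Local Notation P := (boot ++ rest).
Hypothesis HM : (1 <= M)%nat.

Definition saved (n lam eps : C) (m : memory) : Prop :=
  m (512 * M)%nat = eps /\ m (512 * M + 1)%nat = lam /\ m (512 * M + 2)%nat = n /\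
  m (512 * M + 3)%nat = CN M /\ m 1%nat = CN (512 * M + 3).

(** Going downwards, the target 64 i lies above every cell still to be moved. The largest target, 64
    (3 M + 3), is at most 384 M for M >= 1, below the parking place at 512 M. *)
Lemma boot_loop n lam eps k m : (k <= 3 * M)%nat ->
  m 2%nat = CN (k + 3) -> saved n lam eps m ->
  (forall x, (4 <= x <= k + 3)%nat -> m x = m0 x) ->
  (forall x, (k + 3 < x <= 3 * M + 3)%nat -> m (64 * x)%nat = m0 x) ->
  exists m', exec P (32%nat, m) (9 * k + 3) (42%nat, m') /\ saved n lam eps m' /\
    (forall x, (4 <= x <= 3 * M + 3)%nat -> m' (64 * x)%nat = m0 x).
Proof.
  revert m. induction k as [|k IH]; intros m Hk H2 Hs Hlo Hhi.
  - exists (upd m 3 (RtoC (IZR 3))). split; [|split].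
    + stp ltac:(apply st_cst). eapply ex_step.
      { apply (st_jlt_f _ _ _ 3 2 35); [reflexivity|]. rd. rewrite H2. unfold CN; simpl. lra. }
      apply exec_1, st_jmp. reflexivity.
    + destruct Hs as (?&?&?&?&?). unfold saved. rd. tauto.
    + intros x Hx. rd. apply Hhi. lia.
  - set (m1 := upd m 3 (RtoC (IZR 3))).
    set (m2 := upd m1 0 (m (S k + 3)%nat)).
    set (m3 := upd m2 3 (RtoC (IZR 64))).
    set (m4 := upd m3 3 (m3 3%nat * m3 2%nat)%C).
    set (m5 := upd m4 (64 * (S k + 3)) (m4 0%nat)).
    set (m6 := upd m5 3 (RtoC (IZR 1))).
    set (m7 := upd m6 2 (m6 2%nat - m6 3%nat)%C).
    destruct Hs as (S1 & S2 & S3 & S4 & S5).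
    destruct (IH m7) as (m' & E & Hs' & Hm'); try lia.
    + unfold m7, m6, m5, m4, m3, m2, m1. rd. rewrite H2. cnorm.
    + unfold saved, m7, m6, m5, m4, m3, m2, m1. rd. tauto.
    + intros x Hx. unfold m7, m6, m5, m4, m3, m2, m1. rd. apply Hlo. lia.
    + intros x Hx. unfold m7, m6. rd. unfold m5.
      destruct (Nat.eq_dec x (S k + 3)) as [->|Hn].
      * rd. unfold m4, m3, m2. rd. apply Hlo. lia.
      * rd. unfold m4, m3, m2, m1. rd. apply Hhi. lia.
    + exists m'. split; [|split; assumption].
      replace (9 * S k + 3)%nat with (S (S (S (S (S (S (S (S (S (9 * k + 3)))))))))) by lia.
      stp ltac:(apply st_cst). fold m1. eapply ex_step.
      { apply (st_jlt_t _ _ _ 3 2 35); [reflexivity|]. unfold m1. rd. rewrite H2.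
        change (3 < INR (S k + 3)). rewrite INR_IZR_INZ. apply IZR_lt. lia. }
      eapply ex_step.
      { apply (st_load _ _ _ 0 2 (S k + 3)); [reflexivity|]. unfold m1. rd. assumption. }
      replace (upd m1 0 (m1 (S k + 3)%nat)) with m2 by (unfold m2, m1; rd; reflexivity).
      stp ltac:(apply st_cst). fold m3. stp ltac:(apply st_mul). fold m4.
      eapply ex_step.
      { apply (st_store _ _ _ 3 0 (64 * (S k + 3))); [reflexivity|].
        unfold m4, m3, m2, m1. rd. rewrite H2. cnorm. }
      fold m5. stp ltac:(apply st_cst). fold m6. stp ltac:(apply st_sub). fold m7.
      stp ltac:(apply st_jmp). assumption.
Qed.
End Boot.

Definition booted (n M : nat) (lam eps : C) (m0 m : memory) : Prop :=
  m 1%nat = CN n /\ m 2%nat = CN M /\ m 4%nat = eps /\ m 5%nat = lam /\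
  (forall x, (4 <= x < 4 + 3 * M)%nat -> m (64 * x)%nat = m0 x).

Lemma boot_correct rest n M lam (eps : R) m0 : 0 < eps < 1 ->
  m0 0%nat = CN n -> m0 1%nat = CN M -> m0 2%nat = lam -> m0 3%nat = RtoC eps ->
  exists t m, exec (boot ++ rest) (0%nat, m0) t (52%nat, m) /\ (t <= 27 * M + 60)%nat /\
    booted n M lam eps m0 m.
Proof.
  intros He H0 H1 H2 H3.
  destruct (Nat.eq_dec M 0) as [->|HM0].
  - eexists 7%nat, _. split; [|split; [lia|]].
    + eapply ex_step.
      { apply (st_jlt_f _ _ _ 3 1 7); [reflexivity|]. rewrite H1, H3. unfold CN; simpl. lra. }
      next_cst.
      eapply ex_step; [apply st_add; reflexivity|].
      eapply ex_step; [apply st_add; reflexivity|].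
      eapply ex_step; [apply st_add; reflexivity|].
      next_cst.
      apply exec_1, st_jmp. reflexivity.
    + unfold booted. rd. rewrite H0, H2, H3. repeat split; try ring.
      intros x Hx. lia.
  - assert (HM : (1 <= M)%nat) by lia.
    assert (HMr : 1 <= INR M) by (change 1 with (INR 1); apply le_INR; assumption).
    set (X := (512 * M)%nat).
    set (a1 := upd m0 1 (CN X)).
    assert (E1 : exec (boot ++ rest) (0%nat, m0) 10 (16%nat, a1)).
    { eapply ex_step.
      { apply (st_jlt_t _ _ _ 3 1 7); [reflexivity|]. rewrite H1, H3. unfold CN; simpl. lra. }
      assert (Hd : forall pc m k, nth_error (boot ++ rest) pc = Some (IAdd 1 1 1) -> m 1%nat = CN k ->
        step (boot ++ rest) (pc, m) (S pc, upd m 1 (CN (2 * k)))).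
      { intros pc m k Hp Hm. replace (CN (2 * k)) with (m 1%nat + m 1%nat)%C.
        - apply st_add. assumption.
        - rewrite Hm. cnorm. }
      replace a1 with (upd (upd (upd (upd (upd (upd (upd (upd (upd m0 1 (CN (2 * M)))
        1 (CN (2 * (2 * M)))) 1 (CN (2 * (2 * (2 * M))))) 1 (CN (2 * (2 * (2 * (2 * M))))))
        1 (CN (2 * (2 * (2 * (2 * (2 * M))))))) 1 (CN (2 * (2 * (2 * (2 * (2 * (2 * M))))))))
        1 (CN (2 * (2 * (2 * (2 * (2 * (2 * (2 * M)))))))))
        1 (CN (2 * (2 * (2 * (2 * (2 * (2 * (2 * (2 * M))))))))))
        1 (CN (2 * (2 * (2 * (2 * (2 * (2 * (2 * (2 * (2 * M))))))))))).
      2:{ extensionality x. unfold a1, upd. destruct (Nat.eqb x 1); [|reflexivity]. f_equal. lia. }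
      do 8 (eapply ex_step; [apply Hd; [reflexivity|first [exact H1|rd; reflexivity]]|]).
      apply exec_1. apply Hd; [reflexivity|rd; reflexivity]. }
    set (b1 := upd a1 X (RtoC eps)).
    set (b2 := upd b1 3 (RtoC (IZR 1))).
    set (b3 := upd b2 1 (CN (X + 1))).
    set (b4 := upd b3 (X + 1) lam).
    set (b5 := upd b4 1 (CN (X + 2))).
    set (b6 := upd b5 (X + 2) (CN n)).
    set (b7 := upd b6 3 (RtoC (IZR 2))).
    set (b8 := upd b7 2 (CN X)).
    set (b9 := upd b8 3 (RtoC (IZR 512))).
    set (b10 := upd b9 2 (CN M)).
    set (b11 := upd b10 3 (RtoC (IZR 1))).
    set (b12 := upd b11 1 (CN (X + 3))).
    set (b13 := upd b12 (X + 3) (CN M)).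
    set (b14 := upd b13 3 (RtoC (IZR 3))).
    set (b15 := upd b14 2 (CN (3 * M))).
    set (b16 := upd b15 2 (CN (3 * M + 3))).
    assert (HX : (512 <= X)%nat) by (unfold X; lia).
    assert (E2 : exec (boot ++ rest) (16%nat, a1) 16 (32%nat, b16)).
    { next_store (X) (RtoC eps) ltac:(unfold a1).
      next_cst.
      eapply ex_step; [eapply step_add with (z := CN (X + 1)); [reflexivity|unfold b1, a1; rd; cnorm]|].
      next_store ((X + 1)%nat) (lam) ltac:(unfold a1).
      next_add (CN (X + 2)).
      next_store ((X + 2)%nat) (CN n) ltac:(unfold a1).
      next_cst.
      next_sub (CN X).
      next_cst.
      (* The doublings have destroyed the register that held [M]; it is recovered as 512 M / 512. *)
      eapply ex_step.
      { match goal with |- step _ (?pc, ?m) _ =>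
          assert (Hq : (m 2%nat * / m 3%nat)%C = CN M) end.
        { rd. replace (CN X) with (CN M * RtoC 512)%C by (unfold X; cnorm).
          field. }
        match goal with |- step _ (?pc, ?m) _ =>
          assert (Hst : step (boot ++ rest) (pc, m) (S pc, upd m 2 (CN M))) end.
        { rewrite <- Hq. apply st_div; [reflexivity|]. rd. intros HH. apply RtoC_inj in HH. lra. }
        exact Hst. }
      next_cst.
      next_add (CN (X + 3)).
      next_store ((X + 3)%nat) (CN M) ltac:(idtac).
      next_cst.
      eapply ex_step; [eapply step_mul with (z := CN (3 * M)); [reflexivity|rd; cnorm]|].
      apply exec_1. eapply step_add; [reflexivity|unfold b15, b14; rd; cnorm]. }
    destruct (boot_loop rest m0 M HM (CN n) lam (RtoC eps) (3 * M) b16) as (c & E3 & (S1 & S2 & S3 & S4 & S5) & Hc).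
    { lia. }
    { unfold b16. rd. reflexivity. }
    { unfold saved. fold X. unfold b16, b15, b14, b13, b12, b11, b10, b9, b8, b7, b6, b5, b4, b3, b2, b1.
      rd. tauto. }
    { intros x Hx. unfold b16, b15, b14, b13, b12, b11, b10, b9, b8, b7, b6, b5, b4, b3, b2, b1, a1.
      rd. reflexivity. }
    { intros x Hx. lia. }
    fold X in S1, S2, S3, S4, S5.
    set (c1 := upd c 2 (CN M)).
    set (c2 := upd c1 3 (RtoC (IZR 1))).
    set (c3 := upd c2 1 (CN (X + 2))).
    set (c4 := upd c3 0 (CN n)).
    set (c5 := upd c4 1 (CN (X + 1))).
    set (c6 := upd c5 5 lam).
    set (c7 := upd c6 1 (CN X)).
    set (c8 := upd c7 4 (RtoC eps)).
    set (c9 := upd c8 6 (RtoC (IZR 0))).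
    set (c10 := upd c9 1 (CN n)).
    assert (E4 : exec (boot ++ rest) (42%nat, c) 10 (52%nat, c10)).
    { next_load ((X + 3)%nat) (CN M).
      next_cst.
      eapply ex_step; [eapply step_sub with (z := CN (X + 2)); [reflexivity|rd; rewrite S5; cnorm]|].
      next_load ((X + 2)%nat) (CN n).
      next_sub (CN (X + 1)).
      next_load ((X + 1)%nat) (lam).
      next_sub (CN X).
      next_load (X) (RtoC eps).
      next_cst.
      apply exec_1. eapply step_add; [reflexivity|unfold c9, c8, c7, c6, c5, c4; rd; ring]. }
    eexists _, c10. split; [|split].
    + eapply exec_trans; [exact E1|]. eapply exec_trans; [exact E2|].
      eapply exec_trans; [exact E3|]. exact E4.
    + lia.
    + unfold booted, c10, c9, c8, c7, c6, c5, c4, c3, c2, c1. rd. repeat split.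
      intros x Hx. rd. apply Hc. lia.
Qed.

(** * The program *)

(** Total correctness from one fixed state, with a time bound. The postcondition may itself be a
    [hoare] assertion about the next statement; sequences are treated this way. *)
Definition hoare (s : stmt) (st : state) (T : nat) (Q : state -> Prop) : Prop :=
  exists t st', run s st t st' /\ (t <= T)%nat /\ Q st'.

Lemma h_le s st T T' (Q Q' : state -> Prop) : hoare s st T Q -> (T <= T')%nat ->
  (forall st', Q st' -> Q' st') -> hoare s st T' Q'.
Proof. intros (t & st' & H & Ht & HQ) HT HQQ. exists t, st'. repeat split; auto. lia. Qed.

Lemma h_time s st T T' Q : hoare s st T Q -> (T <= T')%nat -> hoare s st T' Q.
Proof. intros H HT. apply (h_le _ _ _ _ _ _ H HT). auto. Qed.

Lemma h_skip st (Q : state -> Prop) : Q st -> hoare SSkip st 0 Q.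
Proof. intros H. exists 0%nat, st. repeat split; auto. constructor. Qed.

Lemma h_set st a e v (Q : state -> Prop) : ev st e v -> Q (up st a 0 v) ->
  hoare (SSet a e) st (esz e + 2) Q.
Proof. intros H HQ. eexists _, _. repeat split; [constructor; eassumption|lia|assumption]. Qed.

Lemma h_arr st a e1 e2 k v (Q : state -> Prop) : ev st e1 (CN k) -> ev st e2 v -> Q (up st a k v) ->
  hoare (SArr a e1 e2) st (esz e1 + esz e2 + 5) Q.
Proof. intros H1 H2 HQ. eexists _, _. repeat split; [constructor; eassumption|lia|assumption]. Qed.

Lemma h_seq s1 s2 st T1 T2 Q : hoare s1 st T1 (fun st1 => hoare s2 st1 T2 Q) ->
  hoare (SSeq s1 s2) st (T1 + T2) Q.
Proof.
  intros (t1 & st1 & R1 & L1 & t2 & st2 & R2 & L2 & HQ).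
  exists (t1 + t2)%nat, st2. repeat split; [econstructor; eassumption|lia|assumption].
Qed.

Lemma h_if_t c s1 s2 st T Q : cv st c true -> hoare s1 st T Q -> hoare (SIf c s1 s2) st (csz c + T + 1) Q.
Proof.
  intros Hc (t & st' & R & L & HQ). eexists _, st'. repeat split; [apply r_if_t; eassumption|lia|assumption].
Qed.

Lemma h_if_f c s1 s2 st T Q : cv st c false -> hoare s2 st T Q -> hoare (SIf c s1 s2) st (csz c + T + 1) Q.
Proof.
  intros Hc (t & st' & R & L & HQ). eexists _, st'. repeat split; [apply r_if_f; eassumption|lia|assumption].
Qed.

Definition SFor (i : nat) (N : expr) (body : stmt) : stmt :=
  SSeq (SSet i (ECst 0)) (SWhile (CLt (EVar i) N) (SSeq body (SSet i (EAdd (EVar i) (ECst 1))))).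

Lemma CN_S k : (CN k + RtoC (IZR 1))%C = CN (S k).
Proof. unfold CN. rewrite <- RtoC_plus, S_INR. reflexivity. Qed.

Lemma CN_lt a b : (a < b)%nat -> Re (CN a) < Re (CN b).
Proof. intros H. unfold CN; simpl. apply lt_INR. assumption. Qed.

Lemma CN_nlt a b : (b <= a)%nat -> ~ Re (CN a) < Re (CN b).
Proof. intros H. unfold CN; simpl. apply le_INR in H. lra. Qed.

Lemma CN_inj a b : CN a = CN b -> a = b.
Proof. intros H. apply INR_eq, RtoC_inj. exact H. Qed.

Lemma ieq_refl i : ieq i i = true.
Proof. apply Nat.eqb_refl. Qed.

Lemma up_same st a i z : up st a i z a i = z.
Proof. unfold up. rewrite Nat.eqb_refl, ieq_refl. reflexivity. Qed.

(** [N] is evaluated anew at every test, so the invariant has to fix its value. The [esz N + 10]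
    steps per round are the test, the increment and the jump back. *)
Lemma h_for (Inv : nat -> state -> Prop) (n T : nat) i N body st (Q : state -> Prop) :
  Inv O (up st i 0 (CN 0)) ->
  (forall k st, Inv k st -> ev st N (CN n)) ->
  (forall k st, (k < n)%nat -> Inv k st -> st i O = CN k ->
     hoare body st T (fun st' => st' i O = CN k /\ Inv (S k) (up st' i 0 (CN (S k))))) ->
  (forall st, Inv n st -> Q st) ->
  hoare (SFor i N body) st (n * (T + esz N + 10) + esz N + 7) Q.
Proof.
  intros H0 HN HB HQ. unfold SFor.
  eapply h_le with (T := (3 + (n * (T + esz N + 10) + esz N + 4))%nat); [|lia|intros st' H; exact H].
  apply (h_seq _ _ _ 3). eapply h_le with (T := 3%nat); [eapply h_set; [constructor|]|simpl; lia|intros st' H; exact H].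
  change (RtoC (IZR 0)) with (CN 0).
  assert (H : forall r k st, (k + r = n)%nat -> Inv k st -> st i O = CN k ->
    hoare (SWhile (CLt (EVar i) N) (SSeq body (SSet i (EAdd (EVar i) (ECst 1))))) st
      (r * (T + esz N + 10) + esz N + 4) Q).
  { induction r as [|r IH]; intros k st1 Hk HI Hi.
    - assert (k = n) as -> by lia. exists (csz (CLt (EVar i) N) + 1)%nat, st1.
      split; [|split; [unfold csz; simpl; lia|auto]]. apply r_while_f.
      econstructor; [constructor|apply (HN n); assumption|]. rewrite Hi. apply CN_nlt. lia.
    - destruct (HB k st1 ltac:(lia) HI Hi) as (t & st2 & R & L & H2 & HI2).
      destruct (IH (S k) (up st2 i 0 (CN (S k))) ltac:(lia) HI2 (up_same _ _ _ _)) as (t' & st3 & R' & L' & HQ').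
      eexists _, st3. split; [|split].
      + eapply r_while_t; [|econstructor; [exact R|apply r_set]|exact R'].
        * econstructor; [constructor|apply (HN k); assumption|]. rewrite Hi. apply CN_lt. lia.
        * rewrite <- CN_S, <- H2. repeat constructor.
      + unfold csz. simpl. simpl in L'. nia.
      + assumption. }
  apply (H n O); [lia|assumption|apply up_same].
Qed.

Lemma evn_var st a k : st a O = CN k -> ev st (EVar a) (CN k).
Proof. intros <-. constructor. Qed.
Lemma ev_var' st a z : st a O = z -> ev st (EVar a) z.
Proof. intros <-. constructor. Qed.
Lemma evn_cst0 st : ev st (ECst 0) (CN 0). Proof. apply (ev_cst st 0). Qed.
Lemma evn_cst1 st : ev st (ECst 1) (CN 1). Proof. apply (ev_cst st 1). Qed.
Lemma evn_cst st k : ev st (ECst (Z.of_nat k)) (CN k).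
Proof. unfold CN. rewrite INR_IZR_INZ. constructor. Qed.
Lemma evn_add st e1 e2 a b : ev st e1 (CN a) -> ev st e2 (CN b) -> ev st (EAdd e1 e2) (CN (a + b)).
Proof. intros H1 H2. replace (CN (a + b)) with (CN a + CN b)%C by cnorm. constructor; assumption. Qed.
Lemma evn_mul st e1 e2 a b : ev st e1 (CN a) -> ev st e2 (CN b) -> ev st (EMul e1 e2) (CN (a * b)).
Proof. intros H1 H2. replace (CN (a * b)) with (CN a * CN b)%C by cnorm. constructor; assumption. Qed.
Lemma evn_sub st e1 e2 a b : ev st e1 (CN a) -> ev st e2 (CN b) -> (b <= a)%nat -> ev st (ESub e1 e2) (CN (a - b)).
Proof. intros H1 H2 H. replace (CN (a - b)) with (CN a - CN b)%C by cnorm. constructor; assumption. Qed.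
Lemma ev_arr' st a e k z : ev st e (CN k) -> st a k = z -> ev st (EArr a e) z.
Proof. intros H <-. constructor. assumption. Qed.

(** The frame condition. Membership is boolean so that concrete instances are settled by
    computation. *)
Definition same (ids : list nat) (st0 st : state) : Prop :=
  forall a i, existsb (Nat.eqb a) ids = false -> st a i = st0 a i.

Lemma same_refl ids st : same ids st st.
Proof. intros a i _. reflexivity. Qed.

Lemma same_up ids st0 st a i z : existsb (Nat.eqb a) ids = true -> same ids st0 st -> same ids st0 (up st a i z).
Proof.
  intros Ha H b j Hb. unfold up. destruct (Nat.eqb_spec b a) as [->|]; [congruence|]. simpl. auto.
Qed.

Lemma same_trans ids st0 st1 st2 : same ids st0 st1 -> same ids st1 st2 -> same ids st0 st2.
Proof. intros H1 H2 a i Ha. rewrite H2, H1 by assumption. reflexivity. Qed.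

Lemma same_incl ids ids' st0 st : forallb (fun a => existsb (Nat.eqb a) ids') ids = true ->
  same ids st0 st -> same ids' st0 st.
Proof.
  intros Hi H a i Ha. apply H. destruct (existsb (Nat.eqb a) ids) eqn:Hx; [|reflexivity].
  apply existsb_exists in Hx. destruct Hx as (b & Hb & Hab). apply Nat.eqb_eq in Hab. subst b.
  rewrite forallb_forall in Hi. specialize (Hi a Hb). congruence.
Qed.

Ltac same_ups := repeat (apply same_up; [reflexivity|]); try apply same_refl; try assumption.

Ltac lk := unfold up; cbn [Nat.eqb andb]; rewrite ?ieq_refl; cbn iota.

(* Array numbers.  Scalars: 1 n, 2 number of edges, 4 eps, 5 lam, 6 activity used, 7 factor per
   vertex, 8 depth m, 9 row length m + 1, 20 current level d, 21 mode (0 call, 1 next edge, 2 return,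
   3 stop), 22 edge, 23 24 loop counters, 25 sum, 26 vertex, 27 neighbour, 28 edge activity,
   29 product, 30 weight deciding the depth, 32 outer vertex, 33 substitute for activity 0.
   Arrays: 0 input, 10 vertex activities, 11 12 13 stacks of vertices, edge positions and saved
   activities, 14 series of level d at d (m + 1), ..., 15 auxiliary, 16 edge activities. *)
Definition eU (e : expr) : expr := EArr 0 (EAdd (EMul (ECst 3) e) (ECst 4)).
Definition eV (e : expr) : expr := EArr 0 (EAdd (EMul (ECst 3) e) (ECst 5)).
Definition pidx (d k : expr) : expr := EAdd (EMul d (EVar 9)) k.
Definition withother (S : stmt) : stmt :=
  SIf (CEq (eU (EVar 22)) (EVar 26)) (SSeq (SSet 27 (eV (EVar 22))) S)
    (SIf (CEq (eV (EVar 22)) (EVar 26)) (SSeq (SSet 27 (eU (EVar 22))) S) SSkip).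
Definition bb : expr := EMul (EArr 16 (EVar 22)) (EArr 16 (EVar 22)).
Definition mulact (f : expr) : stmt := SArr 10 (EVar 27) (EMul f (EArr 10 (EVar 27))).
Definition zeroP : stmt := SFor 23 (EVar 9) (SArr 14 (pidx (EVar 20) (EVar 23)) (ECst 0)).
Definition divloop : stmt := SFor 22 (EVar 2) (withother (mulact (EDiv (ECst 1) bb))).
(** The recursion is run as a loop with explicit stacks. The activities in array 10 are shared by
    all levels, so a call that descends must undo its changes: it divides at all edges of its vertex
    on entry, multiplies back edge by edge, and restores the saved activity of the vertex at the
    end. *)
Definition callS : stmt :=
  SSeq (SSet 26 (EArr 11 (EVar 20)))
  (SIf (CEq (EVar 20) (EVar 8))
    (SSeq zeroP (SSet 21 (ECst 2)))
    (SSeq (SArr 13 (EVar 20) (EArr 10 (EVar 26)))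
    (SSeq (SArr 10 (EVar 26) (ECst 0))
    (SSeq zeroP
    (SSeq (SArr 14 (pidx (EVar 20) (ECst 1)) (EArr 13 (EVar 20)))
    (SSeq divloop
    (SSeq (SArr 12 (EVar 20) (ECst 0)) (SSet 21 (ECst 1))))))))).
Definition descend : stmt :=
  SSeq (mulact bb) (SSeq (SSet 20 (EAdd (EVar 20) (ECst 1)))
    (SSeq (SArr 11 (EVar 20) (EVar 27)) (SSet 21 (ECst 0)))).
Definition runS : stmt :=
  SSeq (SSet 26 (EArr 11 (EVar 20)))
  (SSeq (SSet 22 (EArr 12 (EVar 20)))
  (SIf (CEq (EVar 22) (EVar 2))
    (SSeq (SArr 10 (EVar 26) (EArr 13 (EVar 20))) (SSet 21 (ECst 2)))
    (SSeq (SArr 12 (EVar 20) (EAdd (EVar 22) (ECst 1))) (withother descend)))).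
(** An in-place evaluation of [mobius_rec]: each new coefficient overwrites that of [P], while array
    15 keeps P_j / beta minus the new coefficient, the only combination needed later. *)
Definition combine : stmt := SFor 23 (EVar 9)
  (SSeq (SSet 25 (EMul (EVar 28) (EArr 14 (pidx (EVar 20) (EVar 23)))))
  (SSeq (SFor 24 (EVar 23) (SSet 25 (EAdd (EVar 25)
      (EMul (EArr 14 (pidx (EAdd (EVar 20) (ECst 1)) (EAdd (EVar 24) (ECst 1))))
            (EArr 15 (ESub (EVar 23) (EAdd (EVar 24) (ECst 1))))))))
  (SSeq (SArr 15 (EVar 23) (ESub (EDiv (EArr 14 (pidx (EVar 20) (EVar 23))) (EVar 28)) (EVar 25)))
        (SArr 14 (pidx (EVar 20) (EVar 23)) (EVar 25))))).
Definition retS : stmt :=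
  SIf (CEq (EVar 20) (ECst 0)) (SSet 21 (ECst 3))
   (SSeq (SSet 20 (ESub (EVar 20) (ECst 1)))
   (SSeq (SSet 28 (EArr 16 (ESub (EArr 12 (EVar 20)) (ECst 1))))
   (SSeq combine (SSet 21 (ECst 1))))).
Definition dfs_guard : cond := CLt (EVar 21) (ECst 3).
Definition dfs_body : stmt :=
  SIf (CEq (EVar 21) (ECst 0)) callS (SIf (CEq (EVar 21) (ECst 1)) runS retS).

(** * The depth-first evaluation of the recursion: correctness and cost *)

Lemma fmul_sum a b n : fmul a b n = psum (fun j => a j * b (n - j)%nat)%C (S n).
Proof.
  revert b; induction n as [|n IH]; intros b; [simpl; ring|].
  rewrite fmul_last, IH.
  change (psum (fun j => a j * b (S n - j)%nat)%C (S (S n))) with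
    (psum (fun j => a j * b (S n - j)%nat)%C (S n) + a (S n) * b (S n - S n)%nat)%C.
  rewrite Nat.sub_diag. f_equal. apply psum_agree. intros j Hj. unfold ftl. do 2 f_equal. lia.
Qed.

(** The equation M (1 + rho) = P (beta + rho / beta) is rewritten as M = beta P + rho (P / beta -
    M). As [rho] has no constant term, coefficient [k] on the right involves only earlier
    coefficients of M, and no series is inverted. *)
Lemma mobius_rec beta rho P k : rho O = RtoC 0 ->
  mobius beta rho P k = (beta * P k + psum (fun j => rho (S j) *
    (RtoC (/ beta) * P (k - S j)%nat - mobius beta rho P (k - S j)%nat))%C k)%C.
Proof.
  intros H0. set (D := fsub (fmul (fiota (/ beta)) P) (mobius beta rho P)).
  assert (H : mobius beta rho P = fadd (fmul (fiota beta) P) (fmul rho D)).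
  { pose proof (mobius_spec beta rho P H0) as H. unfold D.
    replace (mobius beta rho P) with (fsub (fmul (mobius beta rho P) (fadd (cst 1) rho)) (fmul rho (mobius beta rho P)))
      at 1 by ring.
    rewrite H. ring. }
  assert (Hk : fmul rho D k = psum (fun j => rho (S j) * D (k - S j)%nat)%C k).
  { destruct k as [|k]; simpl; rewrite H0; [ring|]. rewrite fmul_sum.
    rewrite Cmult_0_l, Cplus_0_l. reflexivity. }
  transitivity (fadd (fmul (fiota beta) P) (fmul rho D) k); [congruence|].
  unfold fadd, fiota. rewrite fmul_cst, Hk. f_equal.
  apply psum_agree. intros j Hj. unfold D, fsub, fadd, fopp, fiota. rewrite fmul_cst. reflexivity.
Qed.

Lemma divallC_app v L e x : divallC v (L ++ [e]) x = mulatC inv_sq v e (divallC v L x).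
Proof.
  induction L as [|e' L IH]; simpl; [reflexivity|]. rewrite IH.
  apply (setf_comm C _ _ _ _ _ _ C_th).
Qed.

Lemma ev_cn st e a b : ev st e (CN a) -> a = b -> ev st e (CN b).
Proof. intros H <-. assumption. Qed.

Ltac evn :=
  match goal with
  | |- ev _ (ECst 0) _ => apply evn_cst0
  | |- ev _ (ECst 1) _ => apply evn_cst1
  | |- ev _ (ECst ?z) _ => apply (evn_cst _ (Z.to_nat z))
  | |- ev _ (EVar _) _ => apply evn_var; lk; first [eassumption|reflexivity]
  | |- ev _ (EAdd _ _) _ => eapply evn_add; evn
  | |- ev _ (EMul _ _) _ => eapply evn_mul; evn
  | |- ev _ (EArr _ _) _ => eapply ev_arr'; [evn|lk; eassumption]
  | |- ev _ (ESub _ _) _ => eapply evn_sub; [evn|evn|lia]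
  end.

Ltac evi := eapply ev_cn; [evn|try lia].

Lemma cv_eqn_t st e1 e2 a : ev st e1 (CN a) -> ev st e2 (CN a) -> cv st (CEq e1 e2) true.
Proof. intros; econstructor; eassumption. Qed.
Lemma cv_eqn_f st e1 e2 a b : ev st e1 (CN a) -> ev st e2 (CN b) -> a <> b -> cv st (CEq e1 e2) false.
Proof. intros; econstructor; [eassumption|eassumption|]. intros HH. apply CN_inj in HH. contradiction. Qed.

Section Dfs.
Variables (n m : nat) (E : list wedge).
Hypothesis HE : loopless n E.
Hypothesis Hb : forall e, In e E -> e_beta e <> 0.
Notation M := (length E).
Notation W := (S m).

(** Endpoints are read from the input array but activities from array 16: in the application [E] is
    the list with zero activities replaced. *)
Record Env (st : state) : Prop := {
  env_M : st 2%nat O = CN M;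
  env_m : st 8%nat O = CN m;
  env_W : st 9%nat O = CN W;
  env_E : forall e ed, nth_error E e = Some ed ->
    st O (3 * e + 4)%nat = CN (e_u ed) /\ st O (3 * e + 5)%nat = CN (e_v ed) /\
    st 16%nat e = RtoC (e_beta ed) }.

Definition dfs_ids : list nat := [10;11;12;13;14;15;20;21;22;23;24;25;26;27;28]%nat.

Lemma Env_same st st' : same dfs_ids st st' -> Env st -> Env st'.
Proof.
  intros H []. constructor.
  - rewrite H by reflexivity. assumption.
  - rewrite H by reflexivity. assumption.
  - rewrite H by reflexivity. assumption.
  - intros e ed He. rewrite !H by reflexivity. auto.
Qed.

Lemma Env_incl ids st st' : same ids st st' -> Env st ->
  forallb (fun a => existsb (Nat.eqb a) dfs_ids) ids = true -> Env st'.
Proof. intros H HV Hi. revert HV. apply Env_same. eapply same_incl; eassumption. Qed.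

Lemma zeroP_spec st d : Env st -> st 20%nat O = CN d ->
  hoare zeroP st (26 * W + 9) (fun st' => same [14;23]%nat st st' /\
    (forall k, (k <= m)%nat -> st' 14%nat (d * W + k)%nat = 0) /\
    (forall i, (i < d * W)%nat -> st' 14%nat i = st 14%nat i)).
Proof.
  intros HV Hd. unfold zeroP. eapply h_le.
  - apply (h_for (fun k st' => same [14;23]%nat st st' /\
      (forall j, (j < k)%nat -> st' 14%nat (d * W + j)%nat = 0) /\
      (forall i, (i < d * W)%nat -> st' 14%nat i = st 14%nat i)) W 14).
    + split; [same_ups|]. split; [intros; lia|].
      intros i Hi. reflexivity.
    + intros k st' (H & _). pose proof (env_W _ (Env_incl _ _ _ H HV eq_refl)). evn.
    + intros k st1 Hk (H & H1 & H2) Hk0.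
      pose proof (env_W _ (Env_incl _ _ _ H HV eq_refl)) as HW.
      assert (Hd1 : st1 20%nat O = CN d) by (rewrite H; auto).
      eapply h_le; [eapply h_arr with (k := (d * W + k)%nat) (v := CN 0)|simpl; lia|intros st' Hst; exact Hst].
      * unfold pidx. evi.
      * evn.
      * split; [lk; assumption|]. split; [|split].
        -- apply same_up; [reflexivity|]. same_ups.
        -- intros j Hj. lk. unfold ieq. destruct (Nat.eqb_spec (d * W + j) (d * W + k)); [reflexivity|].
           apply H1. lia.
        -- intros i Hi. lk. unfold ieq. destruct (Nat.eqb_spec i (d * W + k)); [lia|]. auto.
    + intros st' HQ. exact HQ.
  - simpl esz. lia.
  - intros st' (H & H1 & H2). split; [assumption|]. split; [|assumption]. intros k Hk. apply H1. lia.
Qed.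

Lemma withother_spec st S T Q e v ed : Env st -> st 22%nat O = CN e -> st 26%nat O = CN v ->
  nth_error E e = Some ed ->
  (incident v ed = true -> hoare S (up st 27 0 (CN (other v ed))) T Q) ->
  (incident v ed = false -> Q st) ->
  hoare (withother S) st (T + 50) Q.
Proof.
  intros HV He Hv Hed H1 H0. destruct (env_E _ HV e ed Hed) as (HU & HVv & _).
  unfold withother.
  assert (EU : ev st (eU (EVar 22)) (CN (e_u ed))).
  { unfold eU. eapply ev_arr'; [|exact HU]. evi. }
  assert (EV : ev st (eV (EVar 22)) (CN (e_v ed))).
  { unfold eV. eapply ev_arr'; [|exact HVv]. evi. }
  unfold incident, other in H1, H0.
  destruct (Nat.eqb_spec (e_u ed) v) as [Heq|Hne].
  - eapply h_le; [apply h_if_t|..].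
    + eapply cv_eqn_t; [exact EU|rewrite Heq; evn].
    + apply h_seq. eapply h_set; [exact EV|]. apply H1. reflexivity.
    + cbn. lia.
    + auto.
  - eapply h_le; [apply h_if_f with (T := (T + 34)%nat) (Q := Q)|..].
    + eapply cv_eqn_f; [exact EU|evn|assumption].
    + destruct (Nat.eqb_spec (e_v ed) v) as [Heq|Hne'].
      * eapply h_le; [apply h_if_t|..].
        -- eapply cv_eqn_t; [exact EV|rewrite Heq; evn].
        -- apply h_seq. eapply h_set; [exact EU|]. apply H1. reflexivity.
        -- cbn. lia.
        -- auto.
      * eapply h_le; [apply h_if_f|..].
        -- eapply cv_eqn_f; [exact EV|evn|assumption].
        -- apply h_skip. apply H0. reflexivity.
        -- cbn. lia.
        -- auto.
    + cbn. lia.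
    + auto.
Qed.

Lemma firstn_S {T : Type} (l : list T) k x : nth_error l k = Some x -> firstn (S k) l = firstn k l ++ [x].
Proof.
  revert k; induction l as [|y l IH]; intros [|k] H; simpl in *; try discriminate.
  - congruence.
  - f_equal. apply IH. assumption.
Qed.

Lemma skipn_S {T : Type} (l : list T) k x : nth_error l k = Some x -> skipn k l = x :: skipn (S k) l.
Proof.
  revert k; induction l as [|y l IH]; intros [|k] H; simpl in *; try discriminate.
  - congruence.
  - apply IH. assumption.
Qed.

Lemma nth_lt {T : Type} (l : list T) k : (k < length l)%nat -> exists x, nth_error l k = Some x.
Proof.
  intros H. destruct (nth_error l k) eqn:Hx; [eauto|]. apply nth_error_None in Hx. lia.
Qed.

Lemma inv_sq_C beta : beta <> 0 -> (RtoC 1 * / (RtoC beta * RtoC beta))%C = RtoC (inv_sq beta).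
Proof.
  intros H. unfold inv_sq. rewrite <- RtoC_mult, <- RtoC_inv, Cmult_1_l by nra. reflexivity.
Qed.

Lemma RtoC_neq0 beta : beta <> 0 -> RtoC beta <> RtoC 0.
Proof. intros H H'. apply RtoC_inj in H'. contradiction. Qed.

Lemma divloop_spec st v x : Env st -> st 26%nat O = CN v ->
  (forall u, (u < n)%nat -> st 10%nat u = x u) ->
  hoare divloop st (120 * M + 9) (fun st' => same [10;22;27]%nat st st' /\
    forall u, (u < n)%nat -> st' 10%nat u = divallC v (filter (incident v) E) x u).
Proof.
  intros HV Hv Hx. unfold divloop. eapply h_le.
  - apply (h_for (fun k st' => same [10;22;27]%nat st st' /\
      forall u, (u < n)%nat -> st' 10%nat u = divallC v (filter (incident v) (firstn k E)) x u) M 100).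
    + split; [same_ups|]. intros u Hu. simpl. lk. auto.
    + intros k st' (H & _). pose proof (env_M _ (Env_incl _ _ _ H HV eq_refl)). evn.
    + intros k st1 Hk (H & H1) Hk0.
      pose proof (Env_incl _ _ _ H HV eq_refl) as HV1.
      assert (Hv1 : st1 26%nat O = CN v) by (rewrite H; auto).
      destruct (nth_lt E k Hk) as [ed Hed].
      pose proof (nth_error_In _ _ Hed) as Hin.
      destruct (env_E _ HV1 k ed Hed) as (_ & _ & HB).
      rewrite (firstn_S _ _ _ Hed), filter_app. cbn [filter].
      eapply h_le; [eapply (withother_spec st1 _ _ _ k v ed HV1 Hk0 Hv1 Hed)| |intros st' Hst; exact Hst].
      * intros Hi. rewrite Hi. set (w := other v ed).
        assert (Hw : (w < n)%nat) by (eapply other_lt; eassumption).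
        unfold mulact. eapply h_arr with (k := w).
        -- evn.
        -- eapply ev_mul.
           ++ eapply ev_div; [apply ev_cst| |].
              ** eapply ev_mul; (eapply ev_arr'; [evn|lk; exact HB]).
              ** rewrite <- RtoC_mult. apply RtoC_neq0. specialize (Hb ed Hin). nra.
           ++ eapply ev_arr'; [evn|]. lk. apply H1. assumption.
        -- split; [lk; assumption|]. split.
           ++ same_ups.
           ++ intros u Hu. lk. unfold ieq. rewrite divallC_app. unfold mulatC, setf. fold w.
              destruct (Nat.eqb u w); [|apply H1; assumption].
              rewrite inv_sq_C by auto. reflexivity.
      * intros Hi. rewrite Hi, app_nil_r. split; [lk; assumption|]. split.
        -- same_ups.
        -- intros u Hu. lk. auto.
      * cbn. lia.
    + intros st' HQ. exact HQ.
  - simpl esz. lia.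
  - intros st' (H & H1). split; [assumption|]. rewrite firstn_all in H1. assumption.
Qed.

Lemma combine_spec st d beta rho P : Env st -> st 20%nat O = CN d -> st 28%nat O = RtoC beta ->
  beta <> 0 -> rho O = RtoC 0 ->
  (forall k, (k <= m)%nat -> st 14%nat (d * W + k)%nat = P k) ->
  (forall k, (k <= m)%nat -> st 14%nat ((d + 1) * W + k)%nat = rho k) ->
  hoare combine st (W * (47 * W + 100) + 9) (fun st' => same [14;15;23;24;25]%nat st st' /\
    (forall k, (k <= m)%nat -> st' 14%nat (d * W + k)%nat = mobius beta rho P k) /\
    (forall i, (i < d * W)%nat -> st' 14%nat i = st 14%nat i)).
Proof.
  intros HV Hd Hbe Hb0 Hr0 HP Hr. unfold combine. eapply h_le.
  - apply (h_for (fun k st' => same [14;15;23;24;25]%nat st st' /\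
      (forall j, (j < k)%nat -> st' 14%nat (d * W + j)%nat = mobius beta rho P j /\
         st' 15%nat j = (RtoC (/ beta) * P j - mobius beta rho P j)%C) /\
      (forall j, (k <= j <= m)%nat -> st' 14%nat (d * W + j)%nat = P j) /\
      (forall j, (j <= m)%nat -> st' 14%nat ((d + 1) * W + j)%nat = rho j) /\
      (forall i, (i < d * W)%nat -> st' 14%nat i = st 14%nat i)) W (47 * W + 80)).
    + split; [same_ups|]. repeat split; intros; try lia; lk; auto.
      apply HP. lia.
    + intros k st' (H & _). pose proof (env_W _ (Env_incl _ _ _ H HV eq_refl)). evn.
    + intros k st1 Hk (H & H1 & H2 & H3 & H4) Hk0.
      pose proof (Env_incl _ _ _ H HV eq_refl) as HV1. pose proof (env_W _ HV1) as HW.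
      assert (Hd1 : st1 20%nat O = CN d) by (rewrite H; auto).
      assert (Hb1 : st1 28%nat O = RtoC beta) by (rewrite H; auto).
      eapply h_time; [apply h_seq|].
      * eapply h_set.
        -- eapply ev_mul; [apply ev_var'; exact Hb1|]. eapply ev_arr'; [unfold pidx; evn|]. apply H2. lia.
        -- apply h_seq. set (st2 := up st1 25 0 _).
           assert (Hs2 : same [25]%nat st1 st2) by (same_ups).
           set (F := fun j => (rho (S j) *
             (RtoC (/ beta) * P (k - S j)%nat - mobius beta rho P (k - S j)%nat))%C).
           apply (h_for (fun j st' => same [24;25]%nat st1 st' /\
             st' 25%nat O = (RtoC beta * P k + psum F j)%C) k 35).
           ++ split; [apply same_up; [reflexivity|]; same_ups|].
              unfold st2. lk. simpl. ring.
           ++ intros j st' (Hs & _).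
              assert (st' 23%nat O = CN k) by (rewrite Hs; auto). evn.
           ++ intros j st3 Hj (Hs & Hacc) Hj0.
              assert (K23 : st3 23%nat O = CN k) by (rewrite Hs; auto).
              assert (K20 : st3 20%nat O = CN d) by (rewrite Hs; auto).
              assert (K9 : st3 9%nat O = CN W) by (rewrite Hs; auto).
              eapply h_le; [eapply h_set| |intros st' Hst; exact Hst].
              ** eapply ev_add; [apply ev_var'; exact Hacc|]. eapply ev_mul.
                 --- eapply ev_arr' with (k := ((d + 1) * W + S j)%nat); [unfold pidx; evi|].
                     rewrite Hs by reflexivity. apply H3. lia.
                 --- eapply ev_arr' with (k := (k - S j)%nat); [evi|].
                     rewrite Hs by reflexivity. apply H1. lia.
              ** split; [lk; assumption|]. split.
                 --- same_ups.
                 --- lk. cbn [psum]. generalize (psum F j). intros z. unfold F. ring.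
              ** cbn. lia.
           ++ intros st3 (Hs & Hacc).
              assert (K23 : st3 23%nat O = CN k) by (rewrite Hs; auto).
              assert (K20 : st3 20%nat O = CN d) by (rewrite Hs; auto).
              assert (K9 : st3 9%nat O = CN W) by (rewrite Hs; auto).
              assert (K28 : st3 28%nat O = RtoC beta) by (rewrite Hs; auto).
              assert (K14 : st3 14%nat (d * W + k)%nat = P k) by (rewrite Hs by reflexivity; apply H2; lia).
              unfold F in Hacc. rewrite <- mobius_rec in Hacc by assumption.
              apply h_seq. eapply h_arr with (k := k).
              ** evn.
              ** eapply ev_sub; [|apply ev_var'; exact Hacc].
                 eapply ev_div; [eapply ev_arr'; [unfold pidx; evn|exact K14]|apply ev_var'; exact K28|].
                 apply RtoC_neq0. assumption.
              ** eapply h_arr with (k := (d * W + k)%nat).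
                 --- unfold pidx. evn.
                 --- apply ev_var'. lk. exact Hacc.
                 --- split; [lk; assumption|]. split; [|split; [|split; [|split]]].
                     +++ repeat (apply same_up; [reflexivity|]).
                         eapply same_trans; [exact H|]. eapply same_incl; [|exact Hs]. reflexivity.
                     +++ intros j Hj. lk. unfold ieq.
                         destruct (Nat.eqb_spec (d * W + j) (d * W + k)), (Nat.eqb_spec j k); try lia.
                         *** subst j. split; [reflexivity|].
                             rewrite RtoC_inv by assumption. ring.
                         *** rewrite !Hs by reflexivity. apply H1. lia.
                     +++ intros j Hj. lk. unfold ieq.
                         destruct (Nat.eqb_spec (d * W + j) (d * W + k)); [lia|].
                         rewrite Hs by reflexivity. apply H2. lia.
                     +++ intros j Hj. lk. unfold ieq.
                         destruct (Nat.eqb_spec ((d + 1) * W + j) (d * W + k)); [lia|].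
                         rewrite Hs by reflexivity. apply H3. lia.
                     +++ intros i Hi. lk. unfold ieq.
                         destruct (Nat.eqb_spec i (d * W + k)); [lia|].
                         rewrite Hs by reflexivity. auto.
      * cbn. nia.
    + intros st' HQ. exact HQ.
  - simpl esz. lia.
  - intros st' (H & H1 & _ & _ & H4). split; [assumption|]. split; [|assumption].
    intros k Hk. apply H1. lia.
Qed.
(** Runs of the loop that may stop before the guard fails. Unlike complete runs they can be
    concatenated, as nested calls require. *)
Inductive iters : state -> nat -> state -> Prop :=
| it_0 st : iters st 0 st
| it_S st t st1 t' st2 : cv st dfs_guard true -> run dfs_body st t st1 -> iters st1 t' st2 ->
    iters st (csz dfs_guard + (t + (1 + t'))) st2.

Definition reach (st : state) (T : nat) (Q : state -> Prop) : Prop :=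
  exists t st', iters st t st' /\ (t <= T)%nat /\ Q st'.

Lemma iters_trans st t st1 t' st2 : iters st t st1 -> iters st1 t' st2 -> iters st (t + t') st2.
Proof.
  induction 1 as [|st t st1 t1 st3 Hc Hr Hi IH]; intros H2; [exact H2|].
  replace (csz dfs_guard + (t + (1 + t1)) + t')%nat with (csz dfs_guard + (t + (1 + (t1 + t'))))%nat by lia.
  eapply it_S; eauto.
Qed.

Lemma reach_0 st T (Q : state -> Prop) : Q st -> reach st T Q.
Proof. intros H. exists O, st. repeat split; [constructor|lia|assumption]. Qed.

Lemma reach_trans st T1 T2 Q : reach st T1 (fun st1 => reach st1 T2 Q) -> reach st (T1 + T2) Q.
Proof.
  intros (t & st1 & H1 & L1 & t' & st2 & H2 & L2 & HQ). exists (t + t')%nat, st2.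
  repeat split; [eapply iters_trans; eassumption|lia|assumption].
Qed.

Lemma reach_le st T T' (Q Q' : state -> Prop) : reach st T Q -> (T <= T')%nat ->
  (forall st', Q st' -> Q' st') -> reach st T' Q'.
Proof. intros (t & st' & H & L & HQ) HT HQQ. exists t, st'. repeat split; auto. lia. Qed.

Lemma reach_step st k T1 T2 Q : st 21%nat O = CN k -> (k < 3)%nat ->
  hoare dfs_body st T1 (fun st1 => reach st1 T2 Q) -> reach st (T1 + 5 + T2) Q.
Proof.
  intros Hk Hk3 (t & st1 & R & L & t' & st2 & R' & L' & HQ). eexists _, st2.
  split; [eapply it_S; [|exact R|exact R']|split; [cbn; lia|assumption]].
  unfold dfs_guard. econstructor; [apply ev_var'; exact Hk|apply (evn_cst _ 3)|].
  apply CN_lt. assumption.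
Qed.

Lemma body_call st T Q : st 21%nat O = CN 0 -> hoare callS st T Q -> hoare dfs_body st (T + 5) Q.
Proof.
  intros H HS. eapply h_time; [apply h_if_t; [|exact HS]|cbn; lia].
  eapply cv_eqn_t; evn.
Qed.

Lemma body_run st T Q : st 21%nat O = CN 1 -> hoare runS st T Q -> hoare dfs_body st (T + 10) Q.
Proof.
  intros H HS. eapply h_time; [apply h_if_f; [|apply h_if_t; [|exact HS]]|cbn; lia].
  - eapply cv_eqn_f; [evn|evn|lia].
  - eapply cv_eqn_t; evn.
Qed.

Lemma body_ret st T Q : st 21%nat O = CN 2 -> hoare retS st T Q -> hoare dfs_body st (T + 10) Q.
Proof.
  intros H HS. eapply h_time; [apply h_if_f; [|apply h_if_f; [|exact HS]]|cbn; lia].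
  - eapply cv_eqn_f; [evn|evn|lia].
  - eapply cv_eqn_f; [evn|evn|lia].
Qed.

(** Entry [d] of array 11 is included because the caller wrote it; entry [d] of arrays 12 and 13 and
    row [d] of array 14 belong to the call itself. *)
Definition frame (d : nat) (st0 st : state) : Prop :=
  same dfs_ids st0 st /\ (forall i, (i <= d)%nat -> st 11%nat i = st0 11%nat i) /\
  (forall i, (i < d)%nat -> st 12%nat i = st0 12%nat i /\ st 13%nat i = st0 13%nat i) /\
  (forall i, (i < d * W)%nat -> st 14%nat i = st0 14%nat i).

Lemma frame_trans d st0 st1 st2 : frame d st0 st1 -> frame d st1 st2 -> frame d st0 st2.
Proof.
  intros (A1 & A2 & A3 & A4) (B1 & B2 & B3 & B4). split; [eapply same_trans; eassumption|].
  split; [|split].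
  - intros i Hi. rewrite B2, A2; auto.
  - intros i Hi. destruct (A3 i Hi), (B3 i Hi). split; congruence.
  - intros i Hi. rewrite B4, A4; auto.
Qed.

Lemma frame_weaken d st0 st : frame (S d) st0 st -> frame d st0 st.
Proof.
  intros (A1 & A2 & A3 & A4). split; [assumption|]. repeat split.
  - intros i Hi. apply A2. lia.
  - apply A3. lia.
  - apply A3. lia.
  - intros i Hi. apply A4. simpl. lia.
Qed.

Lemma frame_same ids d st0 st : same ids st0 st -> forallb (fun a => existsb (Nat.eqb a) dfs_ids) ids = true ->
  existsb (Nat.eqb 11%nat) ids = false -> existsb (Nat.eqb 12%nat) ids = false ->
  existsb (Nat.eqb 13%nat) ids = false ->
  (forall i, (i < d * W)%nat -> st 14%nat i = st0 14%nat i) -> frame d st0 st.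
Proof.
  intros H Hi H1 H2 H3 H4. split; [eapply same_incl; eassumption|]. repeat split; auto.
Qed.

(** A common bound for one round of the loop: [divloop] is linear in the number of edges and
    [combine] quadratic in the row length; 400 is chosen generously. *)
Definition step_cost : nat := (400 * (M + W * W + 1))%nat.
Notation A := step_cost.

Lemma W_sq : (W <= W * W)%nat /\ (W * (47 * W + 100) = 47 * (W * W) + 100 * W)%nat.
Proof. split; [nia|ring]. Qed.

Ltac cost :=
  unfold step_cost; cbv [esz csz cargs fst snd pidx bb eU eV];
  let H1 := fresh in let H2 := fresh in
  destruct W_sq as [H1 H2]; rewrite ?H2; revert H1; clear;
  generalize (W * W)%nat; generalize W; generalize M; intros; lia.

(** One round to enter, [M + 1] rounds to scan the edge list, and for each incident edge a subcall
    and the round that combines its result. *)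
Fixpoint call_cost (D f : nat) : nat :=
  match f with O => A | S f' => (A + (M + 1) * A + D * (call_cost D f' + A))%nat end.

Lemma ret_spec st d e v ed rho P : Env st -> st 20%nat O = CN (S d) -> st 21%nat O = CN 2 ->
  st 12%nat d = CN (S e) -> nth_error E e = Some ed -> st 11%nat d = CN v ->
  rho O = RtoC 0 ->
  (forall k, (k <= m)%nat -> st 14%nat (d * W + k)%nat = P k) ->
  (forall k, (k <= m)%nat -> st 14%nat (S d * W + k)%nat = rho k) ->
  hoare dfs_body st (A - 5) (fun st' => frame d st st' /\ st' 20%nat O = CN d /\ st' 21%nat O = CN 1 /\
    st' 10%nat = st 10%nat /\ st' 12%nat = st 12%nat /\ st' 13%nat = st 13%nat /\
    (forall k, (k <= m)%nat -> st' 14%nat (d * W + k)%nat = mobius (e_beta ed) rho P k)).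
Proof.
  intros HV Hd Hm Hes Hed Hv Hr0 HP Hr. pose proof (nth_error_In _ _ Hed) as Hin.
  destruct (env_E _ HV e ed Hed) as (_ & _ & HB).
  eapply h_time; [apply body_ret; [assumption|]|].
  - unfold retS. apply h_if_f.
    + eapply cv_eqn_f; [evn|evn|lia].
    + apply h_seq. eapply h_set with (v := CN d); [evi|].
      apply h_seq. eapply h_set with (v := RtoC (e_beta ed)).
      (* The stored edge position was advanced before the descent, so the edge being returned from
         is one below it. *)
      { eapply ev_arr' with (k := e); [|lk; exact HB].
        eapply ev_cn; [eapply evn_sub with (b := 1%nat); [eapply ev_arr'; [evn|lk; exact Hes]|evn|lia]|lia]. }
      apply h_seq. set (st2 := up _ 28 0 _).
      assert (Hs2 : same [20;28]%nat st st2)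
        by (apply same_up; [reflexivity|]; same_ups).
      eapply h_le; [apply (combine_spec st2 d (e_beta ed) rho P)| reflexivity|].
      * eapply Env_incl; [exact Hs2|assumption|reflexivity].
      * unfold st2. lk. reflexivity.
      * unfold st2. lk. reflexivity.
      * auto.
      * assumption.
      * intros k Hk. rewrite Hs2 by reflexivity. auto.
      * intros k Hk. rewrite Hs2 by reflexivity. replace (d + 1)%nat with (S d) by lia. auto.
      * intros st3 (Hs & H1 & H2). eapply h_set; [apply evn_cst1|].
        assert (Hss : same [14;15;20;21;23;24;25;28]%nat st (up st3 21 0 (CN 1))).
        { apply same_up; [reflexivity|]. eapply same_trans; [eapply same_incl; [|exact Hs2]; reflexivity|].
          eapply same_incl; [|exact Hs]; reflexivity. }
        split.
        { eapply frame_same; [exact Hss|reflexivity..|]. intros i Hi. lk. rewrite H2 by assumption.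
          apply Hs2. reflexivity. }
        split; [lk; rewrite Hs by reflexivity; unfold st2; lk; reflexivity|].
        split; [lk; reflexivity|].
        split; [extensionality i; rewrite Hss by reflexivity; reflexivity|].
        split; [extensionality i; rewrite Hss by reflexivity; reflexivity|].
        split; [extensionality i; rewrite Hss by reflexivity; reflexivity|].
        intros k Hk. lk. auto.
  - cost.
Qed.

Section Rec.
Variable D : nat.
Hypothesis HD : forall v, (v < n)%nat -> (length (filter (incident v) E) <= D)%nat.

(* The recursive call as a stretch of the main loop, with [f] levels left. *)
Definition call_ok (f : nat) : Prop := forall d st x v, (f + d = m)%nat -> Env st ->
  st 20%nat O = CN d -> st 21%nat O = CN 0 -> st 11%nat d = CN v -> (v < n)%nat ->
  (forall u, (u < n)%nat -> st 10%nat u = x u) ->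
  reach st (call_cost D f) (fun st' => frame d st st' /\ st' 20%nat O = CN d /\ st' 21%nat O = CN 2 /\
    (forall u, (u < n)%nat -> st' 10%nat u = x u) /\
    (forall k, (k <= m)%nat -> st' 14%nat (d * W + k)%nat = ratio_rec E f x v k)).

(** Induction on the number [r] of edges still to scan. At position [e] the activities are divided
    exactly at the incident edges from [e] on, and row [d] holds the product over the earlier
    ones. *)
Lemma run_loop f d v x : call_ok f -> (f + S d = m)%nat -> (v < n)%nat ->
  forall r e st P, (e + r = M)%nat -> Env st ->
  st 20%nat O = CN d -> st 21%nat O = CN 1 -> st 11%nat d = CN v -> st 12%nat d = CN e ->
  st 13%nat d = x v ->
  (forall u, (u < n)%nat -> st 10%nat u = divallC v (filter (incident v) (skipn e E)) (setf x v (RtoC 0)) u) ->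
  (forall k, (k <= m)%nat -> st 14%nat (d * W + k)%nat = P k) ->
  reach st ((r + 1) * A + length (filter (incident v) (skipn e E)) * (call_cost D f + A))
   (fun st' => frame d st st' /\ st' 20%nat O = CN d /\ st' 21%nat O = CN 2 /\
    (forall u, (u < n)%nat -> st' 10%nat u = x u) /\
    (forall k, (k <= m)%nat -> st' 14%nat (d * W + k)%nat =
      edge_fold (ratio_rec E f) v (filter (incident v) (skipn e E))
        (divallC v (filter (incident v) (skipn e E)) (setf x v (RtoC 0))) P k)).
Proof.
  intros Hcall Hf Hv. set (X := setf x v (RtoC 0)).
  induction r as [|r IH]; intros e st P He HV Hd Hm Hvs Hes Hsv Hact HP.
  - assert (e = M) as -> by lia. rewrite skipn_all in *. cbn [filter length edge_fold divallC fold_right] in *.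
    eapply reach_le; [eapply (reach_step st 1 _ 0); [assumption|lia|apply body_run; [assumption|]]| |intros st' H; exact H].
    + unfold runS. pose proof (env_M _ HV) as HM.
      apply h_seq. eapply h_set; [evn|]. apply h_seq. eapply h_set; [evn|].
      apply h_if_t; [eapply cv_eqn_t; evn|].
      apply h_seq. eapply h_arr with (k := v); [evn|eapply ev_arr'; [evn|lk; exact Hsv]|].
      eapply h_set; [apply (evn_cst _ 2)|]. apply reach_0.
      split; [|split; [|split; [|split]]].
      * eapply (frame_same [10;21;22;26]%nat); try reflexivity.
        repeat (apply same_up; [reflexivity|]). apply same_refl.
      * lk. assumption.
      * lk. reflexivity.
      * intros u Hu. lk. unfold ieq. destruct (Nat.eqb_spec u v) as [->|Hne]; [reflexivity|].
        rewrite Hact by assumption. unfold X, setf. destruct (Nat.eqb_spec u v); congruence.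
      * intros k Hk. lk. auto.
    + cost.
  - destruct (nth_lt E e ltac:(lia)) as [ed Hed]. pose proof (nth_error_In _ _ Hed) as Hin.
    pose proof (env_M _ HV) as HM. destruct (env_E _ HV e ed Hed) as (_ & _ & HB).
    rewrite (skipn_S _ _ _ Hed) in *. cbn [filter] in *.
    set (L' := filter (incident v) (skipn (S e) E)) in *.
    eapply reach_le; [eapply (reach_step st 1 (A - 5)
       (if incident v ed then call_cost D f + (A + ((r + 1) * A + length L' * (call_cost D f + A)))
        else (r + 1) * A + length L' * (call_cost D f + A))); [assumption|lia|]| |intros st' H; exact H].
    + eapply h_time; [apply body_run; [assumption|]|].
      * unfold runS. apply h_seq. eapply h_set; [evn|]. apply h_seq. eapply h_set; [evn|].
        apply h_if_f; [eapply cv_eqn_f; [evn|evn|lia]|].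
        apply h_seq. eapply h_arr with (k := d) (v := CN (S e)); [evn|evi|].
        set (st1 := up (up (up st 26 0 _) 22 0 _) 12 d _).
        assert (Hs1 : same [12;22;26]%nat st st1)
          by (same_ups).
        assert (HV1 : Env st1) by (eapply Env_incl; [exact Hs1|assumption|reflexivity]).
        assert (H12 : forall i, i <> d -> st1 12%nat i = st 12%nat i).
        { intros i Hi. unfold st1. lk. unfold ieq. destruct (Nat.eqb_spec i d); congruence. }
        assert (H12d : st1 12%nat d = CN (S e)) by (unfold st1; lk; reflexivity).
        assert (H26 : st1 26%nat O = CN v) by (unfold st1; lk; reflexivity).
        assert (H22 : st1 22%nat O = CN e) by (unfold st1; lk; reflexivity).
        assert (HB1 : st1 16%nat e = RtoC (e_beta ed)) by (rewrite Hs1 by reflexivity; assumption).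
        assert (Hd1 : st1 20%nat O = CN d) by (rewrite Hs1 by reflexivity; assumption).
        assert (Hact1 : forall u, (u < n)%nat -> st1 10%nat u = st 10%nat u) by (intros; apply Hs1; reflexivity).
        assert (HF1 : frame d st st1).
        { split; [eapply same_incl; [|exact Hs1]; reflexivity|].
          split; [intros i _; apply Hs1; reflexivity|].
          split; [intros i Hi; split; [apply H12; lia|apply Hs1; reflexivity]|].
          intros i _; apply Hs1; reflexivity. }
        apply (withother_spec st1 descend 100 _ e v ed HV1 H22 H26 Hed).
        -- intros Hi. rewrite Hi in *. set (w := other v ed).
           assert (Hw : (w < n)%nat) by (eapply other_lt; eassumption).
           assert (Hwv : w <> v) by (eapply other_neq; eassumption).
           unfold descend. eapply h_time; [apply h_seq|].
           ++ unfold mulact. eapply h_arr with (k := w);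
                [evn|eapply ev_mul; [unfold bb; eapply ev_mul; (eapply ev_arr'; [evn|lk; exact HB1])
                  |eapply ev_arr'; [evn|lk; rewrite Hact1 by assumption; apply Hact; assumption]]|].
              apply h_seq. eapply h_set with (v := CN (S d)); [evi|].
              apply h_seq. eapply h_arr with (k := S d); [evn|apply ev_var'; lk; reflexivity|].
              eapply h_set; [apply evn_cst0|].
              set (st2 := up (up _ 11 _ _) 21 0 _).
              assert (Hs2 : same [10;11;20;21;27]%nat st1 st2)
                by (same_ups).
              assert (HV2 : Env st2) by (eapply Env_incl; [exact Hs2|assumption|reflexivity]).
              assert (HF2 : frame d st st2).
              { eapply frame_trans; [exact HF1|]. split; [eapply same_incl; [|exact Hs2]; reflexivity|].
                split; [|split; [intros i _; split; apply Hs2; reflexivity|intros i _; apply Hs2; reflexivity]].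
                intros i Hi'. unfold st2. lk. unfold ieq.
                destruct (Nat.eqb_spec i (S d)); [lia|reflexivity]. }
              apply reach_trans. eapply reach_le; [apply (Hcall (S d) st2 (divallC v L' X) w)|reflexivity|].
              ** lia.
              ** assumption.
              ** unfold st2. lk. reflexivity.
              ** unfold st2. lk. reflexivity.
              ** unfold st2. lk. reflexivity.
              ** assumption.
              (* [descend] has just multiplied by beta^2 at the neighbour, which cancels the
                 division made for this edge; those for later edges remain. *)
              ** intros u Hu. rewrite <- (mulat_inv_sq v ed (divallC v L' X)) by auto.
                 unfold st2. lk. unfold mulatC at 1. unfold setf, ieq. fold w.
                 destruct (Nat.eqb u w).
                 --- rewrite RtoC_mult. reflexivity.
                 --- apply Hact. assumption.
              ** intros st3 (HF3 & H20 & H21 & H10 & H14).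
                 set (rho := ratio_rec E f (divallC v L' X) w) in *.
                 assert (HV3 : Env st3) by (eapply Env_same; [apply HF3|assumption]).
                 destruct HF3 as (G0 & G1 & G2 & G3).
                 assert (HFd : frame d st st3).
                 { eapply frame_trans; [exact HF2|]. apply frame_weaken. repeat split; auto; apply G2; assumption. }
                 assert (K12 : st3 12%nat d = CN (S e)).
                 { destruct (G2 d ltac:(lia)) as [-> _]. rewrite Hs2 by reflexivity. assumption. }
                 assert (K13 : st3 13%nat d = x v).
                 { destruct (G2 d ltac:(lia)) as [_ ->]. rewrite Hs2, Hs1 by reflexivity. assumption. }
                 assert (K11 : st3 11%nat d = CN v).
                 { destruct HFd as (_ & K & _). rewrite K by lia. assumption. }
                 replace (A + ((r + 1) * A + length L' * (call_cost D f + A)))%nat with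
                   (A - 5 + 5 + ((r + 1) * A + length L' * (call_cost D f + A)))%nat
                   by (unfold step_cost; lia).
                 eapply (reach_step st3 2); [assumption|lia|].
                 eapply h_le; [apply (ret_spec st3 d e v ed rho P)|reflexivity|]; try assumption.
                 --- apply ratio_rec_0.
                 --- intros k Hk. rewrite G3 by lia. rewrite Hs2, Hs1 by reflexivity. auto.
                 --- intros st4 (F4 & N20 & N21 & N10 & N12 & N13 & N14).
                     eapply reach_le; [apply (IH (S e) st4 (mobius (e_beta ed) rho P))|fold L'; reflexivity|].
                     +++ lia.
                     +++ eapply Env_same; [apply F4|assumption].
                     +++ assumption.
                     +++ assumption.
                     +++ destruct F4 as (_ & K & _). rewrite K by lia. assumption.
                     +++ rewrite N12. assumption.
                     +++ rewrite N13. assumption.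
                     +++ intros u Hu. rewrite N10. fold L'. auto.
                     +++ assumption.
                     +++ fold L'. intros st5 (F5 & Q1 & Q2 & Q3 & Q4).
                         split; [eapply frame_trans; [exact HFd|]; eapply frame_trans; eassumption|].
                         split; [assumption|]. split; [assumption|]. split; [assumption|].
                         intros k Hk. rewrite Q4 by assumption. cbn [divallC fold_right edge_fold].
                         rewrite mulat_inv_sq by auto. reflexivity.
           ++ cbn. lia.
        -- intros Hi. rewrite Hi in *.
           eapply reach_le; [apply (IH (S e) st1 P)|fold L'; reflexivity|].
           ++ lia.
           ++ assumption.
           ++ rewrite Hs1 by reflexivity. assumption.
           ++ rewrite Hs1 by reflexivity. assumption.
           ++ rewrite Hs1 by reflexivity. assumption.
           ++ assumption.
           ++ rewrite Hs1 by reflexivity. assumption.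
           ++ intros u Hu. rewrite Hs1 by reflexivity. fold L'. auto.
           ++ intros k Hk. rewrite Hs1 by reflexivity. auto.
           ++ fold L'. intros st5 (F5 & Q1 & Q2 & Q3 & Q4).
              split; [eapply frame_trans; eassumption|]. repeat split; assumption.
      * cost.
    + destruct (incident v ed); cbn [length]; unfold step_cost; nia.
Qed.

Lemma call_all f : call_ok f.
Proof.
  induction f as [|f IH]; intros d st x v Hf HV Hd Hm Hvs Hv Hact.
  - simpl in Hf. subst d. pose proof (env_m _ HV) as Hmm.
    cbn [call_cost ratio_rec].
    eapply reach_le; [eapply (reach_step st 0 (A - 5) 0); [assumption|lia|]|unfold step_cost; lia|intros st' H; exact H].
    eapply h_time; [apply body_call; [assumption|]|].
    + unfold callS. apply h_seq. eapply h_set; [evn|].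
      apply h_if_t; [eapply cv_eqn_t; evn|]. apply h_seq.
      set (st1 := up st 26 0 _).
      assert (Hs1 : same [26]%nat st st1) by (same_ups).
      eapply h_le; [apply (zeroP_spec st1 m)|reflexivity|].
      * eapply Env_incl; [exact Hs1|assumption|reflexivity].
      * unfold st1. lk. assumption.
      * intros st2 (Hs2 & H1 & H2). eapply h_set; [apply (evn_cst _ 2)|]. apply reach_0.
        assert (Hs : same [14;21;23;26]%nat st (up st2 21 0 (CN 2))).
        { apply same_up; [reflexivity|]. eapply same_trans; [eapply same_incl; [|exact Hs1]; reflexivity|].
          eapply same_incl; [|exact Hs2]; reflexivity. }
        split; [|split; [|split; [|split]]].
        -- eapply frame_same; [exact Hs|reflexivity..|]. intros i Hi. lk. rewrite H2 by assumption. reflexivity.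
        -- rewrite Hs by reflexivity. assumption.
        -- lk. reflexivity.
        -- intros u Hu. rewrite Hs by reflexivity. auto.
        -- intros k Hk. lk. rewrite H1 by assumption. destruct k; reflexivity.
    + cost.
  - pose proof (env_m _ HV) as Hmm. cbn [call_cost ratio_rec]. set (L := filter (incident v) E).
    set (X := setf x v (RtoC 0)).
    eapply reach_le; [eapply (reach_step st 0 (A - 5)
       ((M + 1) * A + length L * (call_cost D f + A))); [assumption|lia|]| |intros st' H; exact H].
    + eapply h_time; [apply body_call; [assumption|]|].
      * unfold callS. apply h_seq. eapply h_set; [evn|].
        apply h_if_f; [eapply cv_eqn_f; [evn|evn|lia]|].
        apply h_seq. eapply h_arr with (k := d) (v := x v); [evn|eapply ev_arr'; [evn|lk; apply Hact; assumption]|].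
        apply h_seq. eapply h_arr with (k := v) (v := CN 0); [evn|evn|].
        apply h_seq. set (st1 := up (up (up st 26 0 _) 13 _ _) 10 _ _).
        assert (Hs1 : same [10;13;26]%nat st st1)
          by (same_ups).
        assert (HV1 : Env st1) by (eapply Env_incl; [exact Hs1|assumption|reflexivity]).
        assert (K20 : st1 20%nat O = CN d) by (unfold st1; lk; assumption).
        eapply h_le; [apply (zeroP_spec st1 d HV1 K20)|reflexivity|].
        intros st2 (Hs2 & Z1 & Z2).
        assert (HV2 : Env st2) by (eapply Env_incl; [exact Hs2|assumption|reflexivity]).
        pose proof (env_W _ HV2) as HW2.
        assert (K20' : st2 20%nat O = CN d) by (rewrite Hs2 by reflexivity; assumption).
        assert (K13 : st2 13%nat d = x v) by (rewrite Hs2 by reflexivity; unfold st1; lk; reflexivity).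
        (* Row [d] starts as the series x_v t: zeros, and the saved activity at degree 1. *)
        apply h_seq. eapply h_arr with (k := (d * W + 1)%nat); [unfold pidx; evn|eapply ev_arr'; [evn|exact K13]|].
        set (st3 := up st2 14 _ _).
        assert (Hs3 : same [14]%nat st2 st3) by (same_ups).
        assert (HV3 : Env st3) by (eapply Env_incl; [exact Hs3|assumption|reflexivity]).
        apply h_seq. eapply h_le; [apply (divloop_spec st3 v X HV3)|reflexivity|].
        -- rewrite Hs3, Hs2 by reflexivity. unfold st1. lk. reflexivity.
        -- intros u Hu. rewrite Hs3, Hs2 by reflexivity. unfold st1. lk. unfold X, setf, ieq.
           destruct (Nat.eqb u v); [reflexivity|]. auto.
        -- intros st4 (Hs4 & H10).
           assert (K20'' : st4 20%nat O = CN d) by (rewrite Hs4, Hs3 by reflexivity; assumption).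
           apply h_seq. eapply h_arr with (k := d) (v := CN 0); [evn|evn|].
           eapply h_set; [apply evn_cst1|]. set (st5 := up (up st4 12 _ _) 21 0 _).
           assert (Hs45 : same [12;21]%nat st4 st5)
             by (same_ups).
           assert (Hs35 : same [10;12;14;21;22;27]%nat st2 st5).
           { eapply same_trans; [eapply same_incl; [|exact Hs3]; reflexivity|].
             eapply same_trans; [eapply same_incl; [|exact Hs4]; reflexivity|].
             eapply same_incl; [|exact Hs45]; reflexivity. }
           assert (Hs5 : same dfs_ids st st5).
           { eapply same_trans; [eapply same_incl; [|exact Hs1]; reflexivity|].
             eapply same_trans; [eapply same_incl; [|exact Hs2]; reflexivity|].
             eapply same_incl; [|exact Hs35]; reflexivity. }
           assert (HF5 : frame d st st5).
           { split; [exact Hs5|]. split; [|split].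
             - intros i Hi. rewrite Hs35, Hs2, Hs1 by reflexivity. reflexivity.
             - intros i Hi. split.
               + unfold st5. lk. unfold ieq. destruct (Nat.eqb_spec i d); [lia|].
                 rewrite Hs4, Hs3, Hs2, Hs1 by reflexivity. reflexivity.
               + rewrite Hs35, Hs2 by reflexivity. unfold st1. lk. unfold ieq.
                 destruct (Nat.eqb_spec i d); [lia|reflexivity].
             - intros i Hi. rewrite Hs45, Hs4 by reflexivity. unfold st3. lk. unfold ieq.
               destruct (Nat.eqb_spec i (d * W + 1)); [lia|].
               rewrite Z2 by assumption. apply Hs1. reflexivity. }
           eapply reach_le; [apply (run_loop f d v x IH ltac:(lia) Hv M 0 st5 (fmul (cst (x v)) tau))|reflexivity|].
           ++ lia.
           ++ eapply Env_same; eassumption.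
           ++ rewrite Hs35 by reflexivity. assumption.
           ++ unfold st5. lk. reflexivity.
           ++ rewrite Hs35, Hs2, Hs1 by reflexivity. assumption.
           ++ unfold st5. lk. reflexivity.
           ++ rewrite Hs35 by reflexivity. assumption.
           ++ intros u Hu. rewrite Hs45 by reflexivity. simpl skipn. apply H10. assumption.
           ++ intros k Hk. rewrite Hs45, Hs4 by reflexivity. unfold st3. lk. unfold ieq.
              rewrite fmul_cst.
              destruct (Nat.eqb_spec (d * W + k) (d * W + 1)).
              ** assert (k = 1%nat) as -> by lia. simpl. ring.
              ** rewrite Z1 by assumption. destruct k as [|[|k]]; [simpl; ring|lia|simpl; ring].
           ++ simpl skipn. fold L X. intros st6 (F6 & Q1 & Q2 & Q3 & Q4).
              split; [eapply frame_trans; eassumption|]. repeat split; assumption.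
      * cost.
    + specialize (HD v Hv). fold L in HD.
      assert (length L * (call_cost D f + A) <= D * (call_cost D f + A))%nat by (apply Nat.mul_le_mono_r; assumption).
      assert (5 <= A)%nat by (unfold step_cost; lia). lia.
Qed.
End Rec.
End Dfs.

(** * The complete program *)

Definition initS (big : bool) : stmt :=
  if big then SSeq (SSet 6 (EDiv (ECst 1) (EVar 5))) (SSet 7 (EVar 5))
  else SSeq (SSet 6 (EVar 5)) (SSet 7 (ECst 1)).
Definition deltaS (q : nat) : stmt :=
  SSeq (SSet 33 (EDiv (EVar 4) (EMul (ECst 4) (EAdd (EVar 2) (ECst 1)))))
       (SFor 23 (EVar 1) (SSet 33 (EDiv (EVar 33) (ECst (Z.of_nat (2 * q)))))).
Definition betaS : stmt :=
  SFor 22 (EVar 2)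
    (SSeq (SSet 28 (EArr 0 (EAdd (EMul (ECst 3) (EVar 22)) (ECst 6))))
      (SIf (CEq (EVar 28) (ECst 0)) (SArr 16 (EVar 22) (EVar 33)) (SArr 16 (EVar 22) (EVar 28)))).
Definition depthS (q : nat) : stmt :=
  SSeq (SSet 30 (EDiv (EMul (EVar 1) (ECst (Z.of_nat (4 * (q * q))))) (EVar 4)))
  (SSeq (SSet 8 (ECst 0))
  (SSeq (SWhile (CLt (ECst 1) (EVar 30))
     (SSeq (SSet 30 (EDiv (EMul (EVar 30) (ECst (Z.of_nat (q - 1)))) (ECst (Z.of_nat q))))
           (SSet 8 (EAdd (EVar 8) (ECst 1)))))
   (SSet 9 (EAdd (EVar 8) (ECst 1))))).
Definition actS : stmt := SFor 23 (EVar 1) (SArr 10 (EVar 23) (EVar 6)).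
(** Clearing the activity of the vertex at the end of a round takes array 10 from the activities
    [acts] at [k] to those at [S k]. *)
Definition topbody : stmt :=
  SSeq (SArr 11 (ECst 0) (EVar 32)) (SSeq (SSet 20 (ECst 0)) (SSeq (SSet 21 (ECst 0))
  (SSeq (SWhile dfs_guard dfs_body)
  (SSeq (SSet 25 (ECst 1))
  (SSeq (SFor 23 (EVar 9) (SSet 25 (EAdd (EVar 25) (EArr 14 (EVar 23)))))
  (SSeq (SSet 29 (EMul (EVar 29) (EMul (EVar 7) (EVar 25))))
        (SArr 10 (EVar 32) (ECst 0)))))))).
Definition topS : stmt := SSeq (SSet 29 (ECst 1)) (SFor 32 (EVar 1) topbody).
Definition mainS (q : nat) (big : bool) : stmt :=
  SSeq (initS big) (SSeq (deltaS q) (SSeq betaS (SSeq (depthS q) (SSeq actS (SSeq topS (SSet 0 (EVar 29))))))).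

Definition ising_program (q : nat) (big : bool) : program :=
  boot ++ cs (mainS q big) 52 ++ [IHalt].

Lemma wfs_main q big : wfs (mainS q big) = true.
Proof. destruct big; reflexivity. Qed.

Lemma h_dfs st T Q : reach st T (fun st' => cv st' dfs_guard false /\ Q st') ->
  hoare (SWhile dfs_guard dfs_body) st (T + 5) Q.
Proof.
  intros (t & st' & Hi & L & Hc & HQ).
  exists (t + (csz dfs_guard + 1))%nat, st'. split; [|split; [cbn; lia|assumption]].
  induction Hi as [st|st t st1 t' st2 Hg Hr Hi IH].
  - apply r_while_f. assumption.
  - replace (csz dfs_guard + (t + (1 + t')) + (csz dfs_guard + 1))%nat with
      (csz dfs_guard + (t + (1 + (t' + (csz dfs_guard + 1)))))%nat by lia.
    eapply r_while_t; [assumption|exact Hr|]. apply IH; auto. clear -L. lia.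
Qed.

Section Top.
Variables (n m D : nat) (E : list wedge) (L g : C).
Hypothesis HE : loopless n E.
Hypothesis Hb : forall e, In e E -> e_beta e <> 0.
Hypothesis HD : forall v, (v < n)%nat -> (length (filter (incident v) E) <= D)%nat.
Notation M := (length E).
Notation W := (S m).
Notation A := (step_cost m E).

Lemma dfs_spec st x v : Env m E st -> st 20%nat O = CN 0 -> st 21%nat O = CN 0 ->
  st 11%nat O = CN v -> (v < n)%nat -> (forall u, (u < n)%nat -> st 10%nat u = x u) ->
  hoare (SWhile dfs_guard dfs_body) st (call_cost m E D m + 30) (fun st' => same dfs_ids st st' /\
    (forall u, (u < n)%nat -> st' 10%nat u = x u) /\
    (forall k, (k <= m)%nat -> st' 14%nat k = ratio_rec E m x v k)).
Proof.
  intros HV H20 H21 H11 Hv Hx.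
  replace (call_cost m E D m + 30)%nat with (call_cost m E D m + (20 + 5 + 0) + 5)%nat by lia.
  apply h_dfs, reach_trans.
  eapply reach_le; [apply (call_all n m E HE Hb D HD m O st x v); auto; lia|reflexivity|].
  intros st1 ((Hs & _) & K20 & K21 & K10 & K14).
  eapply (reach_step st1 2); [assumption|lia|].
  eapply h_time; [apply body_ret; [assumption|]|].
  - unfold retS. apply h_if_t; [eapply cv_eqn_t; evn|].
    eapply h_set; [apply (evn_cst _ 3)|]. apply reach_0. split; [|split; [|split]].
    + unfold dfs_guard. econstructor; [apply ev_var'; lk; reflexivity|apply (evn_cst _ 3)|]. apply CN_nlt. lia.
    + same_ups.
    + assumption.
    + intros k Hk. lk. apply K14. assumption.
  - cbn. lia.
Qed.

Definition top_ids : list nat := dfs_ids ++ [29; 32]%nat.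

Definition top_cost : nat := (n * (call_cost m E D m + 40 * W + 200) + 20)%nat.

Lemma top_spec st : Env m E st -> st 1%nat O = CN n -> st 7%nat O = g ->
  (forall u, (u < n)%nat -> st 10%nat u = L) ->
  hoare topS st top_cost (fun st' => st' 29%nat O = prodf (fun v => g * factor L n E m v)%C n).
Proof.
  intros HV Hn Hg HL. unfold topS. eapply h_time; [apply h_seq|].
  - eapply h_set; [apply evn_cst1|].
    apply (h_for (fun k st' => same top_ids st st' /\
      (forall u, (u < n)%nat -> st' 10%nat u = acts L n k u) /\
      st' 29%nat O = prodf (fun v => g * factor L n E m v)%C k) n (call_cost m E D m + 40 * W + 150)).
    + split; [same_ups|]. split.
      * intros u Hu. lk. rewrite HL by assumption. unfold acts. destruct (Nat.ltb_spec u n); [reflexivity|lia].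
      * lk. reflexivity.
    + intros k st' (H & _). assert (st' 1%nat O = CN n) by (rewrite H; auto). evn.
    + intros k st1 Hk (Hs1 & H1 & H29) H32.
      assert (HV1 : Env m E st1).
      { assert (Ha : forall a i, In a [0;2;8;9;16]%nat -> st1 a i = st a i).
        { intros a i Ha. apply Hs1. simpl in Ha.
          repeat (destruct Ha as [<-|Ha]; [reflexivity|]). contradiction. }
        destruct HV. constructor; intros; rewrite ?Ha by (simpl; tauto); auto. }
      unfold topbody. eapply h_time; [apply h_seq|].
      * eapply h_arr with (k := O); [apply evn_cst0|evn|].
        apply h_seq. eapply h_set; [apply evn_cst0|]. apply h_seq. eapply h_set; [apply evn_cst0|].
        apply h_seq. set (st2 := up (up (up st1 11 _ _) 20 0 _) 21 0 _).
        assert (Hs2 : same [11;20;21]%nat st1 st2) by (same_ups).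
        eapply h_le; [apply (dfs_spec st2 (acts L n k) k)|reflexivity|].
        -- eapply Env_incl; [exact Hs2|assumption|reflexivity].
        -- unfold st2. lk. reflexivity.
        -- unfold st2. lk. reflexivity.
        -- unfold st2. lk. reflexivity.
        -- assumption.
        -- intros u Hu. rewrite Hs2 by reflexivity. auto.
        -- intros st3 (Hs3 & H3 & HP).
           assert (HV3 : Env m E st3).
           { eapply Env_same; [exact Hs3|]. eapply Env_incl; [exact Hs2|assumption|reflexivity]. }
           pose proof (env_W _ _ _ HV3) as HW3.
           apply h_seq. eapply h_set; [apply evn_cst1|]. set (st4 := up st3 25 0 _).
              apply h_seq.
           apply (h_for (fun j st' => same [23;25]%nat st3 st' /\
             st' 25%nat O = (1 + psum (ratio_rec E m (acts L n k) k) j)%C) W 20).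
           ++ split; [unfold st4; same_ups|].
              unfold st4. lk. simpl. unfold CN. simpl. ring.
           ++ intros j st' (H & _). assert (st' 9%nat O = CN W) by (rewrite H; auto). evn.
           ++ intros j st5 Hj (Hs5 & H25) H23.
              eapply h_time; [eapply h_set; [eapply ev_add; [apply ev_var'; exact H25|
                eapply ev_arr'; [evn|rewrite Hs5 by reflexivity; apply HP; lia]]|]|cbn; lia].
              split; [lk; assumption|]. split.
              ** same_ups.
              ** lk. simpl. ring.
           ++ intros st5 (Hs5 & H25).
              assert (Hs15 : same dfs_ids st1 st5).
              { eapply same_trans; [eapply same_incl; [|exact Hs2]; reflexivity|].
                eapply same_trans; [exact Hs3|]. eapply same_incl; [|exact Hs5]; reflexivity. }
              assert (K29 : st5 29%nat O = prodf (fun v => g * factor L n E m v)%C k)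
                by (rewrite Hs15 by reflexivity; assumption).
              assert (K7 : st5 7%nat O = g).
              { rewrite Hs15, Hs1 by reflexivity. assumption. }
              assert (K32 : st5 32%nat O = CN k) by (rewrite Hs15 by reflexivity; assumption).
              apply h_seq. eapply h_set.
              { eapply ev_mul; [apply ev_var'; exact K29|].
                eapply ev_mul; [apply ev_var'; exact K7|apply ev_var'; exact H25]. }
              eapply h_arr with (k := k); [evn|apply evn_cst0|].
              split; [lk; assumption|]. split; [|split].
              ** repeat (apply same_up; [reflexivity|]). eapply same_trans; [exact Hs1|].
                 eapply same_incl; [|exact Hs15]; reflexivity.
              ** intros u Hu. lk. unfold ieq. rewrite acts_S. unfold setf.
                 destruct (Nat.eqb u k); [reflexivity|].
                 rewrite Hs5 by reflexivity. auto.
              ** lk. reflexivity.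
      * cbn [esz]. lia.
    + intros st' (_ & _ & H). exact H.
  - unfold top_cost. cbn [esz]. lia.
Qed.
End Top.

(** * The parameters computed by the program and its overall specification *)

Definition ratio_q (q : nat) : R := INR (q - 1) / INR q.

Lemma INR_q q : (2 <= q)%nat -> 2 <= INR q.
Proof. intros Hq. change 2 with (INR 2). apply le_INR. assumption. Qed.

Lemma ratio_q_eq q : (2 <= q)%nat -> ratio_q q = 1 - / INR q.
Proof.
  intros Hq. unfold ratio_q. pose proof (INR_q q Hq). rewrite minus_INR by lia. simpl (INR 1). field. lra.
Qed.

Lemma ratio_q_bounds q : (2 <= q)%nat -> 1 / 2 <= ratio_q q < 1.
Proof.
  intros Hq. rewrite ratio_q_eq by assumption. pose proof (INR_q q Hq).
  assert (0 < / INR q <= / 2) by (split; [apply Rinv_0_lt_compat; lra|apply Rinv_le_contravar; lra]).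
  lra.
Qed.

Lemma CN_neq0 k : (0 < k)%nat -> CN k <> RtoC 0.
Proof. intros H HH. apply (CN_inj k 0) in HH. lia. Qed.

Section Init.
Variables (n q : nat) (E : list wedge) (lam : C) (eps : R) (big : bool).
Hypothesis Hq : (2 <= q)%nat.
Hypothesis Heps : 0 < eps < 1.
Notation M := (length E).

(** The 2^n subsets contribute an error of at most M delta each, and the total must stay below eps /
    4 times the lower bound q^(-n) for the partition function. [M + 1] keeps the divisor nonzero
    without edges. *)
Definition delta : R := eps / (4 * (INR M + 1)) / (2 * INR q) ^ n.
(** As 1 - r = 1 / q, the condition on the truncation error reads [depth_weight] r^(m + 1) <= 1. The
    loop multiplies by [r] and stops at the first [m] with [depth_weight] r^m <= 1. *)
Definition depth_weight : R := INR n * (4 * (INR q * INR q)) / eps.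

Record Inp (st : state) : Prop := {
  inp_n : st 1%nat O = CN n;
  inp_M : st 2%nat O = CN M;
  inp_eps : st 4%nat O = RtoC eps;
  inp_E : forall e ed, nth_error E e = Some ed ->
    st O (3 * e + 4)%nat = CN (e_u ed) /\ st O (3 * e + 5)%nat = CN (e_v ed) /\
    st O (3 * e + 6)%nat = RtoC (e_beta ed) }.

Lemma Inp_same ids st st' : same ids st st' -> Inp st ->
  forallb (fun a => negb (existsb (Nat.eqb a) ids)) [0;1;2;4]%nat = true -> Inp st'.
Proof.
  intros Hs [] Hi.
  assert (Ha : forall a i, In a [0;1;2;4]%nat -> st' a i = st a i).
  { intros a i Ha. apply Hs. rewrite forallb_forall in Hi. apply Hi in Ha.
    apply Bool.negb_true_iff. assumption. }
  constructor; intros; rewrite ?Ha by (simpl; tauto); auto.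
Qed.

Lemma delta_spec st : Inp st ->
  hoare (deltaS q) st (n * 30 + 40) (fun st' => same [23;33]%nat st st' /\ st' 33%nat O = RtoC delta).
Proof.
  intros HI. pose proof (INR_q q Hq) as Hq2. unfold deltaS. eapply h_time; [apply h_seq|].
  - pose proof (inp_eps _ HI) as He. pose proof (inp_M _ HI) as HM.
    eapply h_set.
    { eapply ev_div; [apply ev_var'; exact He|apply (evn_mul _ _ _ 4 (M + 1)); [apply (evn_cst _ 4)|evn]|].
      apply CN_neq0. lia. }
    apply (h_for (fun k st' => same [23;33]%nat st st' /\
      st' 33%nat O = RtoC (eps / (4 * (INR M + 1)) / (2 * INR q) ^ k)) n 10).
    + split; [same_ups|]. lk.
      unfold CN. rewrite <- RtoC_inv, <- RtoC_mult by (apply not_0_INR; lia). f_equal.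
      rewrite mult_INR, plus_INR. simpl. pose proof (pos_INR M). field. lra.
    + intros k st' (H & _). pose proof (inp_n _ (Inp_same _ _ _ H HI eq_refl)). evn.
    + intros k st1 Hk (Hs & H33) H23.
      eapply h_time; [eapply h_set; [eapply ev_div; [apply ev_var'; exact H33|apply evn_cst|apply CN_neq0; lia]|]|cbn; lia].
      split; [lk; assumption|]. split; [same_ups|].
      lk. unfold CN. rewrite <- RtoC_inv, <- RtoC_mult by (apply not_0_INR; lia). f_equal.
      rewrite mult_INR. simpl. pose proof (pos_INR M).
      assert ((2 * INR q) ^ k <> 0) by (apply pow_nonzero; lra). field. repeat split; lra.
    + intros st' H. exact H.
  - cbn [esz]. lia.
Qed.

Lemma beta_spec st : Inp st -> st 33%nat O = RtoC delta ->
  hoare betaS st (M * 60 + 20) (fun st' => same [16;22;28]%nat st st' /\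
    forall e ed, nth_error E e = Some ed -> st' 16%nat e = RtoC (e_beta (perturb delta ed))).
Proof.
  intros HI Hdl. unfold betaS. eapply h_le.
  - apply (h_for (fun k st' => same [16;22;28]%nat st st' /\
      forall e ed, (e < k)%nat -> nth_error E e = Some ed -> st' 16%nat e = RtoC (e_beta (perturb delta ed))) M 45).
    + split; [same_ups|]. intros; lia.
    + intros k st' (H & _). pose proof (inp_M _ (Inp_same _ _ _ H HI eq_refl)). evn.
    + intros k st1 Hk (Hs & H1) H22. destruct (nth_lt E k Hk) as [ed Hed].
      destruct (inp_E _ (Inp_same _ _ _ Hs HI eq_refl) k ed Hed) as (_ & _ & HB).
      assert (K33 : st1 33%nat O = RtoC delta) by (rewrite Hs by reflexivity; assumption).
      set (st2 := up st1 28 0 (RtoC (e_beta ed))).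
      assert (Hfin : forall z, z = RtoC (e_beta (perturb delta ed)) ->
        up st2 16 k z 22%nat O = CN k /\ same [16;22;28]%nat st (up (up st2 16 k z) 22 0 (CN (S k))) /\
        forall e ed, (e < S k)%nat -> nth_error E e = Some ed ->
          up (up st2 16 k z) 22 0 (CN (S k)) 16%nat e = RtoC (e_beta (perturb delta ed))).
      { intros z ->. unfold st2. split; [lk; assumption|]. split; [same_ups|].
        intros e ed' He Hed'. lk. unfold ieq. destruct (Nat.eqb_spec e k) as [->|]; [congruence|].
        apply H1; [lia|assumption]. }
      eapply h_time; [apply h_seq|].
      * eapply h_set; [eapply ev_arr' with (k := (3 * k + 6)%nat); [evi|exact HB]|]. fold st2.
        destruct (Req_dec_T (e_beta ed) 0) as [Hz|Hz].
        -- apply h_if_t.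
           { eapply cv_eq_t; [apply ev_var'; unfold st2; lk; rewrite Hz; reflexivity|apply evn_cst0]. }
           eapply h_time with (T' := 20%nat); [eapply h_arr with (k := k); [evn|apply ev_var'; unfold st2; lk; exact K33|]|cbn; lia].
           apply Hfin. unfold perturb. simpl. destruct (Req_dec_T (e_beta ed) 0); [reflexivity|contradiction].
        -- eapply h_time with (T' := (csz (CEq (EVar 28) (ECst 0)) + 20 + 1)%nat); [|reflexivity].
           apply h_if_f.
           { eapply cv_eq_f; [apply ev_var'; unfold st2; lk; reflexivity|apply evn_cst0|].
             apply RtoC_neq0. assumption. }
           eapply h_time with (T' := 20%nat); [eapply h_arr with (k := k); [evn|apply ev_var'; unfold st2; lk; reflexivity|]|cbn; lia].
           apply Hfin. unfold perturb. simpl. destruct (Req_dec_T (e_beta ed) 0); [contradiction|reflexivity].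
      * cbn. lia.
    + intros st' H. exact H.
  - cbn [esz]. lia.
  - intros st' (H & H1). split; [assumption|]. intros e ed Hed. apply H1; [|assumption].
    apply nth_error_Some. congruence.
Qed.

(** The first clause serves the error bound, the second, minimality of [m], the running time. In the
    proof [K0], where the weight has surely dropped to 1, acts as fuel for the loop. *)
Lemma depth_spec st : Inp st -> exists m, depth_weight * ratio_q q ^ m <= 1 /\
  (forall i, (i < m)%nat -> 1 < depth_weight * ratio_q q ^ i) /\
  hoare (depthS q) st (m * 40 + 60) (fun st' => same [8;9;30]%nat st st' /\
    st' 8%nat O = CN m /\ st' 9%nat O = CN (S m)).
Proof.
  intros HI. pose proof (INR_q q Hq) as Hq2. pose proof (ratio_q_bounds q Hq) as Hr.
  assert (Hw0 : 0 <= depth_weight).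
  { unfold depth_weight. apply Rdiv_le_0_compat; [|lra]. pose proof (pos_INR n). apply Rmult_le_pos; [assumption|nra]. }
  destruct (pow_lt_eps (ratio_q q) ltac:(lra) depth_weight 1 Hw0 ltac:(lra)) as [K0 HK0].
  specialize (HK0 K0 (le_n K0)).
  assert (Hloop : forall r j st1, (j + r = K0)%nat -> same [8;30]%nat st st1 ->
    st1 8%nat O = CN j -> st1 30%nat O = RtoC (depth_weight * ratio_q q ^ j) ->
    (forall i, (i < j)%nat -> 1 < depth_weight * ratio_q q ^ i) ->
    exists m, (j <= m)%nat /\ depth_weight * ratio_q q ^ m <= 1 /\ (forall i, (i < m)%nat -> 1 < depth_weight * ratio_q q ^ i) /\
    hoare (SWhile (CLt (ECst 1) (EVar 30))
     (SSeq (SSet 30 (EDiv (EMul (EVar 30) (ECst (Z.of_nat (q - 1)))) (ECst (Z.of_nat q))))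
           (SSet 8 (EAdd (EVar 8) (ECst 1))))) st1 ((m - j) * 40 + 10)
      (fun st' => same [8;30]%nat st st' /\ st' 8%nat O = CN m)).
  { induction r as [|r IH]; intros j st1 Hj Hs H8 H30 Hlt.
    - assert (j = K0) as -> by lia. exists K0. repeat split; auto.
      eexists _, st1. split; [apply r_while_f|split; [cbn; lia|split; assumption]].
      econstructor; [apply evn_cst1|apply ev_var'; exact H30|]. unfold CN. simpl. lra.
    - destruct (Rle_dec (depth_weight * ratio_q q ^ j) 1) as [Hle|Hgt].
      + exists j. repeat split; auto.
        eexists _, st1. split; [apply r_while_f|split; [cbn; lia|split; assumption]].
        econstructor; [apply evn_cst1|apply ev_var'; exact H30|]. unfold CN. simpl. lra.
      + destruct (IH (S j) (up (up st1 30 0 (RtoC (depth_weight * ratio_q q ^ S j))) 8 0 (CN (S j)))) as (m & Hm & H1 & H2 & t & st2 & R & Lt & HQ).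
        * lia.
        * same_ups.
        * lk. reflexivity.
        * lk. reflexivity.
        * intros i Hi. destruct (Nat.eq_dec i j) as [->|]; [lra|]. apply Hlt. lia.
        * exists m. split; [lia|]. split; [assumption|]. split; [assumption|].
          eexists _, st2. split; [|split; [|exact HQ]].
          -- eapply r_while_t; [|econstructor; [eapply r_set|eapply r_set]|exact R].
             ++ econstructor; [apply evn_cst1|apply ev_var'; exact H30|]. unfold CN. simpl. lra.
             ++ replace (RtoC (depth_weight * ratio_q q ^ S j)) with (RtoC (depth_weight * ratio_q q ^ j) * CN (q - 1) * / CN q)%C.
                ** eapply ev_div; [eapply ev_mul; [apply ev_var'; exact H30|apply evn_cst]|apply evn_cst|].
                   apply CN_neq0. lia.
                ** unfold CN. rewrite <- RtoC_inv, <- !RtoC_mult by (apply not_0_INR; lia). f_equal.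
                   simpl. unfold ratio_q. field. lra.
             ++ rewrite <- CN_S. constructor; [apply ev_var'; lk; assumption|constructor].
          -- cbn. cbn in Lt. lia. }
  destruct (Hloop K0 0%nat (up (up st 30 0 (RtoC depth_weight)) 8 0 (CN 0))) as (m & _ & H1 & H2 & Hh).
  { lia. } { same_ups. }
  { lk. reflexivity. } { lk. rewrite pow_O, Rmult_1_r. reflexivity. } { intros; lia. }
  exists m. split; [assumption|]. split; [assumption|].
  unfold depthS. eapply h_time; [apply h_seq|].
  - pose proof (inp_n _ HI) as Hn. pose proof (inp_eps _ HI) as He.
    eapply h_set with (v := RtoC depth_weight).
    { replace (RtoC depth_weight) with (CN (n * (4 * (q * q))) * / RtoC eps)%C.
      - eapply ev_div; [apply evn_mul; [evn|apply evn_cst]|apply ev_var'; exact He|]. apply RtoC_neq0. lra.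
      - unfold CN. rewrite <- RtoC_inv, <- RtoC_mult by lra. f_equal. unfold depth_weight.
        rewrite !mult_INR. simpl (INR 4). field. lra. }
    apply h_seq. eapply h_set; [apply evn_cst0|]. apply h_seq.
    eapply h_le; [exact Hh|reflexivity|].
    intros st' (Hs & H8). eapply h_set with (v := CN (S m)); [evi|].
    split; [|split; lk; [assumption|reflexivity]].
    apply same_up; [reflexivity|]. eapply same_incl; [|exact Hs]; reflexivity.
  - cbn [esz]. lia.
Qed.

Lemma act_spec st L : Inp st -> st 6%nat O = L ->
  hoare actS st (n * 30 + 20) (fun st' => same [10;23]%nat st st' /\
    forall u, (u < n)%nat -> st' 10%nat u = L).
Proof.
  intros HI HL. unfold actS. eapply h_time.
  - apply (h_for (fun k st' => same [10;23]%nat st st' /\ forall u, (u < k)%nat -> st' 10%nat u = L) n 15).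
    + split; [same_ups|]. intros; lia.
    + intros k st' (H & _). pose proof (inp_n _ (Inp_same _ _ _ H HI eq_refl)). evn.
    + intros k st1 Hk (Hs & H1) H23.
      assert (H6 : st1 6%nat O = L) by (rewrite Hs by reflexivity; assumption).
      eapply h_time; [eapply h_arr with (k := k); [evn|apply ev_var'; exact H6|]|cbn; lia].
      split; [lk; assumption|]. split; [same_ups|].
      intros u Hu. lk. unfold ieq. destruct (Nat.eqb_spec u k); [reflexivity|]. apply H1. lia.
    + intros st' H. exact H.
  - cbn [esz]. lia.
Qed.

Definition inner_activity : C := if big then (/ lam)%C else lam.
Definition outer_factor : C := if big then lam else RtoC 1.

Lemma init_spec st : Inp st -> st 5%nat O = lam -> (big = true -> lam <> RtoC 0) ->
  hoare (initS big) st 20 (fun st' => same [6;7]%nat st st' /\ st' 6%nat O = inner_activity /\ st' 7%nat O = outer_factor).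
Proof.
  intros HI H5 Hz. unfold initS, inner_activity, outer_factor. destruct big.
  - eapply h_time; [apply h_seq|].
    + eapply h_set; [eapply ev_div; [apply evn_cst1|apply ev_var'; exact H5|auto]|].
      eapply h_set; [apply ev_var'; lk; exact H5|].
      split; [same_ups|]. split; lk; [|reflexivity].
      unfold CN. simpl. ring.
    + cbn. lia.
  - eapply h_time; [apply h_seq|].
    + eapply h_set; [apply ev_var'; exact H5|]. eapply h_set; [apply evn_cst1|].
      split; [same_ups|]. split; lk; reflexivity.
    + cbn. lia.
Qed.

Definition total_cost (D m : nat) : nat :=
  (20 + (n * 30 + 40) + (M * 60 + 20) + (m * 40 + 60) + (n * 30 + 20) +
   top_cost n m D E + 10)%nat.

Lemma delta_pos : 0 < delta <= 1.
Proof.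
  unfold delta. pose proof (pos_INR M). pose proof (INR_q q Hq).
  assert (1 <= (2 * INR q) ^ n) by (apply pow_R1_Rle; lra).
  assert (0 < eps / (4 * (INR M + 1)) <= 1).
  { split; [apply Rdiv_lt_0_compat; lra|]. apply (Rmult_le_reg_r (4 * (INR M + 1))); [lra|].
    unfold Rdiv. rewrite Rmult_assoc, Rinv_l by lra. lra. }
  split; [apply Rdiv_lt_0_compat; lra|].
  apply (Rmult_le_reg_r ((2 * INR q) ^ n)); [lra|].
  unfold Rdiv at 1. rewrite Rmult_assoc, Rinv_l by lra. lra.
Qed.

Lemma main_spec st D : Inp st -> st 5%nat O = lam -> (big = true -> lam <> RtoC 0) ->
  loopless n E -> (forall v, (v < n)%nat -> (length (filter (incident v) E) <= D)%nat) ->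
  exists m, depth_weight * ratio_q q ^ m <= 1 /\ (forall i, (i < m)%nat -> 1 < depth_weight * ratio_q q ^ i) /\
  hoare (mainS q big) st (total_cost D m) (fun st' =>
    st' O O = prodf (fun v => outer_factor * factor inner_activity n (map (perturb delta) E) m v)%C n).
Proof.
  intros HI H5 Hz HE HD. set (E' := map (perturb delta) E).
  destruct (init_spec st HI H5 Hz) as (t1 & st1 & R1 & L1 & Hs1 & H6 & H7).
  pose proof (Inp_same _ _ _ Hs1 HI eq_refl) as HI1.
  destruct (delta_spec st1 HI1) as (t2 & st2 & R2 & L2 & Hs2 & H33).
  pose proof (Inp_same _ _ _ Hs2 HI1 eq_refl) as HI2.
  destruct (beta_spec st2 HI2 H33) as (t3 & st3 & R3 & L3 & Hs3 & H16).
  pose proof (Inp_same _ _ _ Hs3 HI2 eq_refl) as HI3.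
  destruct (depth_spec st3 HI3) as (m & Hm1 & Hm2 & t4 & st4 & R4 & L4 & Hs4 & H8 & H9).
  pose proof (Inp_same _ _ _ Hs4 HI3 eq_refl) as HI4.
  assert (K6 : st4 6%nat O = inner_activity) by (rewrite Hs4, Hs3, Hs2 by reflexivity; assumption).
  destruct (act_spec st4 inner_activity HI4 K6) as (t5 & st5 & R5 & L5 & Hs5 & H10).
  pose proof (Inp_same _ _ _ Hs5 HI4 eq_refl) as HI5.
  assert (HM : length E' = M) by apply length_map.
  assert (HV : Env m E' st5).
  { constructor.
    - rewrite HM. apply inp_M. assumption.
    - rewrite Hs5 by reflexivity. assumption.
    - rewrite Hs5 by reflexivity. assumption.
    - intros e ed He. unfold E' in He. rewrite nth_error_map in He.
      destruct (nth_error E e) as [ed'|] eqn:Hed; [|discriminate]. simpl in He.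
      assert (ed = perturb delta ed') as -> by congruence.
      destruct (inp_E _ HI5 e ed' Hed) as (? & ? & _). repeat split; auto.
      rewrite Hs5, Hs4 by reflexivity. auto. }
  assert (Hcost : top_cost n m D E' = top_cost n m D E).
  { unfold top_cost. f_equal. f_equal. f_equal. f_equal.
    assert (forall f, call_cost m E' D f = call_cost m E D f) as H; [|apply H].
    induction f as [|f IH]; simpl; unfold step_cost; rewrite HM; [|rewrite IH; unfold step_cost]; reflexivity. }
  destruct (top_spec n m D E' inner_activity outer_factor) with (st := st5) as (t6 & st6 & R6 & L6 & H29).
  - apply loopless_perturb. assumption.
  - apply perturb_neq_0. apply delta_pos.
  - intros v Hv. specialize (HD v Hv). revert HD. unfold E'. clear.
    assert (length (filter (incident v) (map (perturb delta) E)) = length (filter (incident v) E)) as ->; [|auto].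
    generalize delta. intros dl. induction E as [|e l IH]; simpl; [reflexivity|].
    change (incident v (perturb dl e)) with (incident v e). destruct (incident v e); simpl; lia.
  - assumption.
  - apply inp_n. assumption.
  - rewrite Hs5, Hs4, Hs3, Hs2 by reflexivity. assumption.
  - assumption.
  - exists m. split; [assumption|]. split; [assumption|].
    eexists _, _. split; [|split].
    + unfold mainS. econstructor; [exact R1|]. econstructor; [exact R2|]. econstructor; [exact R3|].
      econstructor; [exact R4|]. econstructor; [exact R5|]. econstructor; [exact R6|].
      apply r_set. apply ev_var'. exact H29.
    + unfold total_cost. rewrite Hcost in L6. cbn [esz]. lia.
    + lk. reflexivity.
Qed.
End Init.

(** * From the input encoding to the output of the machine *)

Lemma simple_loopless n E : simple_graph n E -> loopless n E.
Proof. intros [H _] e He. specialize (H e He). lia. Qed.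

(** Used to express costs that depend on the number of edges through [n] alone. *)
Lemma simple_graph_length n E : simple_graph n E -> (length E <= n * n)%nat.
Proof.
  intros [H Hnd]. transitivity (length (map fst E)); [rewrite length_map; reflexivity|].
  replace (n * n)%nat with (length (list_prod (seq 0 n) (seq 0 n)))
    by (rewrite length_prod, length_seq; reflexivity).
  apply NoDup_incl_length; [assumption|].
  intros p Hp. apply in_map_iff in Hp. destruct Hp as (e & <- & He). specialize (H e He).
  unfold e_u, e_v in H. destruct (fst e) as [u v]. simpl in H.
  apply in_prod; apply in_seq; lia.
Qed.

Lemma input_edge n E lam eps e ed : nth_error E e = Some ed ->
  input_memory n E lam eps (3 * e + 4)%nat = CN (e_u ed) /\
  input_memory n E lam eps (3 * e + 5)%nat = CN (e_v ed) /\
  input_memory n E lam eps (3 * e + 6)%nat = RtoC (e_beta ed).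
Proof.
  intros He.
  replace (3 * e + 4)%nat with (S (S (S (S (e * 3))))) by lia.
  replace (3 * e + 5)%nat with (S (S (S (S (1 + e * 3))))) by lia.
  replace (3 * e + 6)%nat with (S (S (S (S (2 + e * 3))))) by lia.
  cbn [input_memory].
  rewrite !Nat.div_add, !Nat.Div0.mod_add, Nat.div_mul, Nat.Div0.mod_mul by lia.
  change (1 / 3)%nat with 0%nat. change (2 / 3)%nat with 0%nat.
  change (1 mod 3)%nat with 1%nat. change (2 mod 3)%nat with 2%nat.
  rewrite !Nat.add_0_l, He. repeat split; reflexivity.
Qed.

Lemma booted_Inp n E lam eps m : booted n (length E) lam (RtoC eps) (input_memory n E lam eps) m ->
  Inp n E eps (fun a i => m (64 * i + a)%nat) /\ m 5%nat = lam.
Proof.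
  intros (H1 & H2 & H4 & H5 & HE). split; [|assumption].
  constructor; try assumption.
  intros e ed He. destruct (input_edge n E lam eps e ed He) as (I1 & I2 & I3).
  assert (e < length E)%nat by (apply nth_error_Some; congruence).
  rewrite !Nat.add_0_r, !HE by lia. auto.
Qed.

Lemma prodf_const g f k : prodf (fun v => g * f v)%C k = (g ^ k * prodf f k)%C.
Proof. induction k as [|k IH]; simpl; [ring|]. rewrite IH. ring. Qed.

(** The recurrence is c(f + 1) = B + D c(f); since D >= 1, each of the f + 1 terms B D^i is at most
    B D^f. *)
Lemma call_cost_le m E D f : (1 <= D)%nat ->
  (call_cost m E D f <= (f + 1) * ((length E + 2 + D) * step_cost m E) * D ^ f)%nat.
Proof.
  intros HD. set (B := ((length E + 2 + D) * step_cost m E)%nat).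
  induction f as [|f IH]; cbn [call_cost Nat.pow].
  - unfold B. nia.
  - assert (1 <= D ^ f)%nat by (apply Nat.neq_0_lt_0, Nat.pow_nonzero; lia).
    assert (step_cost m E + (length E + 1) * step_cost m E + D * (call_cost m E D f + step_cost m E)
      = B + D * call_cost m E D f)%nat as -> by (unfold B; ring).
    assert (D * call_cost m E D f <= D * ((f + 1) * B * D ^ f))%nat by (apply Nat.mul_le_mono_l; exact IH).
    assert (B * 1 <= B * (D * D ^ f))%nat by (apply Nat.mul_le_mono_l; nia).
    nia.
Qed.

(** * Running time *)

Section Poly.
Variables (r K : R).
Hypothesis HK : 0 <= K.

(** [X] stands for n + 1 / eps. The last clause says that the depth is logarithmic in [X]. *)
Definition valid (n M m : nat) (X : R) : Prop :=
  1 <= X /\ INR n <= X /\ INR M <= X ^ 2 /\ (/ r) ^ m <= K * X ^ 2.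

Definition polyb (f : nat -> nat -> nat -> nat) : Prop :=
  exists (c : R) (k : nat), 0 <= c /\ forall n M m X, valid n M m X -> INR (f n M m) <= c * X ^ k.

Lemma polyb_const a : polyb (fun _ _ _ => a).
Proof. exists (INR a), 0%nat. split; [apply pos_INR|]. intros. simpl. lra. Qed.

Lemma polyb_n : polyb (fun n _ _ => n).
Proof. exists 1, 1%nat. split; [lra|]. intros n M m X (? & ? & ? & ?). simpl. lra. Qed.

Lemma polyb_M : polyb (fun _ M _ => M).
Proof. exists 1, 2%nat. split; [lra|]. intros n M m X (? & ? & ? & ?). lra. Qed.

Lemma polyb_add f g : polyb f -> polyb g -> polyb (fun n M m => f n M m + g n M m)%nat.
Proof.
  intros (c1 & k1 & H1 & F1) (c2 & k2 & H2 & F2). exists (c1 + c2), (k1 + k2)%nat. split; [lra|].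
  intros n M m X HV. specialize (F1 n M m X HV). specialize (F2 n M m X HV).
  destruct HV as (HX & _). rewrite plus_INR, pow_add.
  pose proof (pow_R1_Rle X k1 HX). pose proof (pow_R1_Rle X k2 HX).
  assert (c1 * X ^ k1 <= c1 * (X ^ k1 * X ^ k2)) by (apply Rmult_le_compat_l; nra).
  assert (c2 * X ^ k2 <= c2 * (X ^ k1 * X ^ k2)) by (apply Rmult_le_compat_l; nra).
  lra.
Qed.

Lemma polyb_mul f g : polyb f -> polyb g -> polyb (fun n M m => f n M m * g n M m)%nat.
Proof.
  intros (c1 & k1 & H1 & F1) (c2 & k2 & H2 & F2). exists (c1 * c2), (k1 + k2)%nat. split; [nra|].
  intros n M m X HV. specialize (F1 n M m X HV). specialize (F2 n M m X HV).
  rewrite mult_INR, pow_add.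
  replace (c1 * c2 * (X ^ k1 * X ^ k2)) with (c1 * X ^ k1 * (c2 * X ^ k2)) by ring.
  apply Rmult_le_compat; auto using pos_INR.
Qed.

Variable q : nat.
Hypothesis Hq : (2 <= q)%nat.
Hypothesis Hr : r = 1 - / INR q.

Lemma inv_r : / r = 1 + / (INR q - 1).
Proof. pose proof (INR_q q Hq). rewrite Hr. field. lra. Qed.

Lemma bernoulli_inv_r m : 1 + INR m * / (INR q - 1) <= (/ r) ^ m.
Proof.
  rewrite inv_r. pose proof (INR_q q Hq). apply poly. apply Rinv_0_lt_compat. lra.
Qed.

(** Bernoulli's inequality bounds [m] by a multiple of r^(-m). *)
Lemma polyb_m : polyb (fun _ _ m => m).
Proof.
  pose proof (INR_q q Hq) as Hq2. exists (INR q * K), 2%nat. split; [nra|].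
  intros n M m X (_ & _ & _ & HV). pose proof (bernoulli_inv_r m) as Hm.
  assert (INR m = INR m * / (INR q - 1) * (INR q - 1)) by (field; lra).
  pose proof (pos_INR m). assert (0 <= INR m * / (INR q - 1)) by (apply Rdiv_le_0_compat; lra).
  rewrite H, Rmult_assoc.
  apply (Rle_trans _ (K * X ^ 2 * INR q)); [|lra].
  rewrite <- (Rmult_assoc (INR m)). apply Rmult_le_compat; lra.
Qed.

(** Some fixed power of 1 / r exceeds D, so D^m is at most that power of r^(-m). The exponent [k0]
    is where the degree comes to depend on the maximum degree and on [lam]. *)
Lemma polyb_pow D : polyb (fun _ _ m => D ^ m)%nat.
Proof.
  pose proof (INR_q q Hq) as Hq2.
  destruct (INR_unbounded (INR D * (INR q - 1))) as [k0 Hk0].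
  assert (HD : INR D <= (/ r) ^ k0).
  { pose proof (bernoulli_inv_r k0) as Hb. etransitivity; [|exact Hb].
    assert (INR D = INR D * (INR q - 1) * / (INR q - 1)) by (field; lra).
    assert (INR D * (INR q - 1) * / (INR q - 1) <= INR k0 * / (INR q - 1)).
    { apply Rmult_le_compat_r; [left; apply Rinv_0_lt_compat; lra|lra]. }
    lra. }
  exists (K ^ k0), (2 * k0)%nat. split; [apply pow_le; assumption|].
  intros n M m X (HX & _ & _ & HV). rewrite pow_INR, pow_mult, <- Rpow_mult_distr.
  apply (Rle_trans _ (((/ r) ^ k0) ^ m)); [apply pow_incr; split; [apply pos_INR|assumption]|].
  rewrite <- pow_mult, Nat.mul_comm, pow_mult. apply pow_incr. split; [|assumption].
  apply pow_le. rewrite inv_r. assert (0 < / (INR q - 1)) by (apply Rinv_0_lt_compat; lra). lra.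
Qed.
End Poly.

(** Written with sums, products and one power [D ^ m] only, so that the closure lemmas apply to it
    syntactically. *)
Definition time_bound (D n M m : nat) : nat :=
  (27 * M + 60 + (n * 30 + 40) + (M * 60 + 20) + (m * 40 + 60) + (n * 30 + 20) +
   (n * ((m + 1) * ((M + 2 + D) * (400 * (M + (m + 1) * (m + 1) + 1))) * D ^ m + 40 * (m + 1) + 200) + 20) + 30)%nat.

Lemma time_bound_polyb r K q D : 0 <= K -> (2 <= q)%nat -> r = 1 - / INR q ->
  polyb r K (time_bound D).
Proof.
  intros HK Hq Hr. unfold time_bound.
  repeat first [apply polyb_add|apply polyb_mul|apply polyb_n|apply polyb_M|apply (polyb_m r K HK q Hq Hr)
    |apply (polyb_pow r K HK q Hq Hr)|apply polyb_const].
Qed.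

Lemma total_cost_le n E D m : (1 <= D)%nat ->
  (27 * length E + 60 + total_cost n E D m <= time_bound D n (length E) m)%nat.
Proof.
  intros HD. pose proof (call_cost_le m E D m HD) as H.
  unfold total_cost, top_cost, time_bound. unfold step_cost in H.
  replace (S m) with (m + 1)%nat in * by lia.
  set (U := ((m + 1) * _ * D ^ m)%nat) in *.
  assert (n * (call_cost m E D m + 40 * (m + 1) + 200) <= n * (U + 40 * (m + 1) + 200))%nat
    by (apply Nat.mul_le_mono_l; lia).
  lia.
Qed.

Lemma program_correct (q : nat) (big : bool) (lam : C) n E eps D :
  (2 <= q)%nat -> (1 <= D)%nat -> Cmod (inner_activity lam big) <= ratio_q q -> (big = true -> lam <> RtoC 0) ->
  simple_graph n E -> max_degree_le n E D -> (forall e, In e E -> -1 <= e_beta e <= 1) ->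
  0 < eps < 1 ->
  exists (t m : nat) (Zhat : C), runs_to (ising_program q big) n E lam eps t Zhat /\
    Cmod (Cminus Zhat (ising_Z n E lam)) <= eps * Cmod (ising_Z n E lam) /\
    (t <= time_bound D n (length E) m)%nat /\
    (forall i, (i < m)%nat -> 1 < depth_weight n q eps * ratio_q q ^ i).
Proof.
  intros Hq HD HL Hz HG Hdeg Hbeta He.
  pose proof (simple_loopless n E HG) as HE.
  destruct (boot_correct (cs (mainS q big) 52 ++ [IHalt]) n (length E) lam eps
    (input_memory n E lam eps) He eq_refl eq_refl eq_refl eq_refl) as (t1 & m1 & X1 & T1 & HB).
  destruct (booted_Inp n E lam eps m1 HB) as [HI H5].
  set (st := fun a i => m1 (64 * i + a)%nat) in *.
  destruct (main_spec n q E lam eps big Hq He st D HI H5 Hz HE) as (m & Hm1 & Hm2 & t2 & st' & R & T2 & HO).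
  { intros v Hv. apply (Hdeg v Hv). }
  assert (Hboot : length boot = 52%nat) by reflexivity.
  destruct (cs_correct (ising_program q big) _ _ _ _ R 52%nat m1 (wfs_main q big)) as (m2 & X2 & HR).
  { intros i x Hx. unfold ising_program. rewrite nth_error_app2 by lia.
    replace (52 + i - length boot)%nat with i by lia.
    rewrite nth_error_app1; [assumption|]. apply nth_error_Some. congruence. }
  { intros a i _. reflexivity. }
  exists (t1 + t2)%nat, m, (prodf (fun v => outer_factor lam big * factor (inner_activity lam big) n (map (perturb (delta n q E eps)) E) m v)%C n).
  split; [|split; [|split]].
  - exists ((52 + ssz (mainS q big))%nat, m2). split; [|split].
    + eapply exec_trans; eassumption.
    + change (nth_error (ising_program q big) (52 + ssz (mainS q big))%nat = Some IHalt).
      unfold ising_program. generalize (mainS q big). intros s.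
      rewrite nth_error_app2 by lia.
      replace (52 + ssz s - length boot)%nat with (ssz s) by lia.
      rewrite nth_error_app2 by (rewrite cs_length; apply le_n).
      rewrite cs_length, Nat.sub_diag. reflexivity.
    + simpl snd. rewrite <- HO. apply (HR 0%nat 0%nat). lia.
  - pose proof (ratio_q_bounds q Hq) as Hrb. pose proof (INR_q q Hq) as Hq2.
    assert (H1r : 1 - ratio_q q = / INR q) by (rewrite ratio_q_eq by assumption; ring).
    assert (Hiq : 0 < / INR q) by (apply Rinv_0_lt_compat; lra).
    pose proof (approx_small (ratio_q q) (inner_activity lam big) n ltac:(lra) HL E m (delta n q E eps) eps HE Hbeta He) as HA.
    rewrite prodf_const. set (P := prodf (factor _ _ _ _) n) in *.
    assert (HP : Cmod (P - ising_Z n E (inner_activity lam big))%C <= eps * Cmod (ising_Z n E (inner_activity lam big))).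
    { rewrite ising_Z_from. apply HA.
      - rewrite H1r. pose proof (pos_INR n) as Hn.
        unfold depth_weight in Hm1.
        (* The double division by 1 - r = 1 / q is the factor q^2 in [depth_weight]. *)
        replace (INR n * (ratio_q q ^ S m / / INR q / / INR q))
          with (ratio_q q * (eps / 4) * (INR n * (4 * (INR q * INR q)) / eps * ratio_q q ^ m))
          by (simpl; field; lra).
        set (w := INR n * _ / eps * _) in *.
        assert (0 <= w).
        { apply Rmult_le_pos; [|apply pow_le; lra]. apply Rdiv_le_0_compat; [|lra].
          apply Rmult_le_pos; [assumption|nra]. }
        assert (ratio_q q * w <= 1) by nra.
        replace (ratio_q q * (eps / 4) * w) with (eps / 4 * (ratio_q q * w)) by ring. nra.
      - apply delta_pos; assumption.
      - rewrite H1r. unfold delta. pose proof (pos_INR (length E)) as HM.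
        rewrite pow_inv. rewrite Rpow_mult_distr.
        assert (0 < 2 ^ n) by (apply pow_lt; lra). assert (0 < INR q ^ n) by (apply pow_lt; lra).
        replace (2 ^ n * (INR (length E) * (eps / (4 * (INR (length E) + 1)) / (2 ^ n * INR q ^ n))))
          with (INR (length E) / (INR (length E) + 1) * (eps / 4 * / INR q ^ n)) by (field; lra).
        assert (INR (length E) / (INR (length E) + 1) <= 1).
        { apply (Rmult_le_reg_r (INR (length E) + 1)); [lra|]. unfold Rdiv.
          rewrite Rmult_assoc, Rinv_l by lra. lra. }
        assert (0 <= eps / 4 * / INR q ^ n).
        { apply Rmult_le_pos; [lra|]. left. apply Rinv_0_lt_compat. assumption. }
        nra. }
    unfold inner_activity, outer_factor in *. destruct big.
    + rewrite (ising_Z_inv n E lam HE (Hz eq_refl)).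
      replace (lam ^ n * P - lam ^ n * ising_Z n E (/ lam))%C with
        (lam ^ n * (P - ising_Z n E (/ lam)))%C by ring.
      rewrite !Cmod_mult. pose proof (Cmod_ge_0 (lam ^ n)%C).
      replace (eps * (Cmod (lam ^ n) * Cmod (ising_Z n E (/ lam)))) with
        (Cmod (lam ^ n) * (eps * Cmod (ising_Z n E (/ lam)))) by ring.
      apply Rmult_le_compat_l; assumption.
    + replace (RtoC 1 ^ n * P)%C with P; [assumption|].
      assert (RtoC 1 ^ n = RtoC 1)%C as ->; [|ring].
      clear. induction n as [|k IH]; simpl; [reflexivity|]. rewrite IH. ring.
  - pose proof (total_cost_le n E D m HD). lia.
  - assumption.
Qed.

(** Minimality at [m - 1] gives r^(-m) < [depth_weight] / r, at most twice the weight because r >=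
    1/2, and the weight is at most 4 q^2 X^2. The summand 1 covers m = 0. *)
Lemma depth_pow_le n q eps m : (2 <= q)%nat -> 0 < eps < 1 ->
  (forall i, (i < m)%nat -> 1 < depth_weight n q eps * ratio_q q ^ i) ->
  (/ ratio_q q) ^ m <= (1 + 8 * (INR q * INR q)) * (INR n + / eps) ^ 2.
Proof.
  intros Hq He Hm. pose proof (ratio_q_bounds q Hq) as Hr. pose proof (INR_q q Hq).
  set (X := INR n + / eps). pose proof (pos_INR n) as Hn.
  assert (Hi : 1 < / eps) by (rewrite <- Rinv_1; apply Rinv_lt_contravar; lra).
  assert (HX : 1 <= X) by (unfold X; lra).
  assert (HX2 : 1 <= X ^ 2) by (apply pow_R1_Rle; assumption).
  destruct m as [|m].
  - simpl. simpl in HX2. nra.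
  - specialize (Hm m ltac:(lia)).
    assert (Hw : depth_weight n q eps <= 4 * (INR q * INR q) * X ^ 2).
    { unfold depth_weight, Rdiv. replace (INR n * (4 * (INR q * INR q)) * / eps)
        with (4 * (INR q * INR q) * (INR n * / eps)) by ring.
      apply Rmult_le_compat_l; [nra|]. simpl. rewrite Rmult_1_r.
      apply Rmult_le_compat; unfold X; lra. }
    assert (Hp : 0 < ratio_q q ^ m) by (apply pow_lt; lra).
    rewrite pow_inv. simpl (ratio_q q ^ S m).
    apply (Rmult_le_reg_r (ratio_q q * ratio_q q ^ m)); [nra|]. rewrite Rinv_l by nra.
    assert (1 < 4 * (INR q * INR q) * X ^ 2 * ratio_q q ^ m) by nra.
    set (Y := X ^ 2 * ratio_q q ^ m) in *.
    replace ((1 + 8 * (INR q * INR q)) * X ^ 2 * (ratio_q q * ratio_q q ^ m))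
      with ((1 + 8 * (INR q * INR q)) * ratio_q q * Y) by (unfold Y; ring).
    assert (1 < 4 * (INR q * INR q) * Y) by (unfold Y; lra).
    assert (0 < Y) by (unfold Y; nra).
    assert (4 * (INR q * INR q) <= (1 + 8 * (INR q * INR q)) * ratio_q q) by nra.
    nra.
Qed.

(** Any integer [q] of at least 1 / (1 - a) will do; it becomes a constant of the program, which may
    depend on [lam]. *)
Lemma gap_exists a : a < 1 -> exists q, (2 <= q)%nat /\ a <= ratio_q q.
Proof.
  intros Ha. destruct (INR_unbounded (/ (1 - a))) as [k Hk].
  exists (k + 2)%nat. split; [lia|]. rewrite ratio_q_eq by lia.
  assert (0 < / (1 - a)) by (apply Rinv_0_lt_compat; lra).
  assert (/ INR (k + 2) <= / / (1 - a)).
  { apply Rinv_le_contravar; [assumption|]. rewrite plus_INR. simpl. lra. }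
  rewrite Rinv_inv in H0. lra.
Qed.

Theorem theorem1p1 (Delta : nat) (lam : C) :
  (0 < Delta)%nat -> Cmod lam <> 1 ->
  exists (P : program) (c : R) (k : nat),
    forall (n : nat) (E : list wedge) (eps : R),
      simple_graph n E ->
      max_degree_le n E Delta ->
      (forall e, In e E -> -1 <= e_beta e <= 1) ->
      0 < eps < 1 ->
      exists (t : nat) (Zhat : C),
        runs_to P n E lam eps t Zhat /\
        Cmod (Cminus Zhat (ising_Z n E lam)) <= eps * Cmod (ising_Z n E lam) /\
        INR t <= c * (INR n + / eps) ^ k.
Proof.
  intros HD Hlam.
  assert (Hbig : exists big, Cmod (inner_activity lam big) < 1 /\ (big = true -> lam <> RtoC 0)).
  { destruct (Rlt_dec (Cmod lam) 1) as [H|H].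
    - exists false. split; [assumption|discriminate].
    - assert (Hz : lam <> RtoC 0) by (intros ->; rewrite Cmod_0 in H; lra).
      exists true. split; [|intros _; assumption]. simpl. rewrite Cmod_inv by assumption.
      rewrite <- Rinv_1. apply Rinv_lt_contravar; lra. }
  destruct Hbig as (big & HL & Hz).
  destruct (gap_exists _ HL) as (q & Hq & HLq).
  destruct (time_bound_polyb (ratio_q q) (1 + 8 * (INR q * INR q)) q Delta) as (c & k & _ & Hpoly).
  { pose proof (INR_q q Hq). nra. } { assumption. } { apply ratio_q_eq. assumption. }
  exists (ising_program q big), c, k. intros n E eps HG Hdeg Hbeta He.
  destruct (program_correct q big lam n E eps Delta Hq HD HLq Hz HG Hdeg Hbeta He)
    as (t & m & Zhat & Hrun & Herr & Ht & Hm).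
  exists t, Zhat. split; [assumption|]. split; [assumption|].
  apply (Rle_trans _ (INR (time_bound Delta n (length E) m))); [apply le_INR; assumption|].
  apply Hpoly. pose proof (pos_INR n).
  assert (Hi : 1 < / eps) by (rewrite <- Rinv_1; apply Rinv_lt_contravar; lra).
  split; [lra|]. split; [lra|]. split; [|apply depth_pow_le; assumption].
  apply (Rle_trans _ (INR n * INR n)).
  - rewrite <- mult_INR. apply le_INR, simple_graph_length. assumption.
  - simpl. nra.
Qed.
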